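(* Let $\gamma\in(0,\sqrt2)$, let $D_\gamma=1-\gamma^2$ if $0<\gamma<\sqrt2/2$ and $D_\gamma=(\sqrt2-\gamma)^2$ if $\sqrt2/2\le\gamma<\sqrt2$, and let $\tau\in(0,D_\gamma)$. Then there exist $p\in(1,2)$ and $q\in(\frac{4}{1-\tau},\infty)$ such that \[ (p-1)\Big(1-\frac{\gamma^2p}{2}\Big)-\frac{\tau p}{2}-\frac pq>0. \] Moreover, for any such exponents $p$ and $q$, the random sequences $M_m=(n^{\tau/2}\,\widehat{\mu_{\gamma,m}}(n))_{n\ge1}$, $m\ge 0$, satisfy \[ \sup_{m\ge0}\mathbb E\big[\|M_m\|_{\ell^q}^p\big]<\infty . \]
   Context: On $\mathbb R\times\mathbb R_+$ let $\lambda(A)=\int_A y^{-2}\,\mathrm dx\,\mathrm dy$. Let $W$ be the white noise with control measure $\lambda$: a centered Gaussian family indexed by Borel sets $A$ with $\lambda(A)<\infty$, with $\mathbb E[W(A)W(B)]=\lambda(A\cap B)$. For $t\in[0,1]$ let $A_0(t)=\{(x,y): y>1,\ |x-t|<1/2\}$ and, for $m\ge1$, $A_m(t)=\{(x,y): \max\{2|x-t|,2^{-m}\}<y\le2^{-(m-1)}\}$ (subsets of $\mathbb R\times\mathbb R_+$). Put $\varphi_m(t)=W(A_m(t))$ and \[ X_m(t)=\exp\Big(\gamma\varphi_m(t)-\frac{\gamma^2}{2}\mathbb E[\varphi_m(t)^2]\Big),\qquad t\in[0,1], \] where versions continuous in $t$ are used. The random measure $\mu_{\gamma,m}$ on $[0,1]$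 is $\mu_{\gamma,m}(\mathrm dt)=\big[\prod_{j=0}^mX_j(t)\big]\mathrm dt$, and $\widehat{\mu_{\gamma,m}}(n)=\int_0^1e^{-2\pi int}\mu_{\gamma,m}(\mathrm dt)$. $\|\cdot\|_{\ell^q}$ is the usual norm on complex sequences indexed by $n\ge1$. *)

(* Defs.v *)
From HB Require Import structures.
From mathcomp Require Import all_boot all_order all_algebra.
From mathcomp Require Import complex.
From mathcomp Require Import all_classical all_reals all_analysis.
Set Implicit Arguments.
Unset Strict Implicit.
Unset Printing Implicit Defensive.
Import Order.TTheory GRing.Theory Num.Theory.
Import numFieldNormedType.Exports.
Local Open Scope classical_set_scope.
Local Open Scope ring_scope.

Section WhiteNoise.
Context (R : realType).

Definition half_plane : set (R * R) := [set z | 0 < z.2].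

(* y^-2 dx dy; only evaluated on subsets of half_plane. *)
Definition control_measure (A : set (R * R)) : \bar R :=
  (\int[lebesgue_measure \x lebesgue_measure]_(z in A) ((z.2 ^+ 2)^-1)%:E)%E.

Definition finite_control (A : set (R * R)) : Prop :=
  [/\ measurable A, A `<=` half_plane & (control_measure A < +oo)%E].

Context d (T : measurableType d) (P : probability T R).

(* normal_prob 0 0 is not the Dirac mass, so the degenerate law is added. *)
Definition centered_gaussian (X : T -> R) : Prop :=
  exists s : R, forall B : set R, measurable B ->
    P (X @^-1` B) = if s == 0 then \d_(0 : R) B else normal_prob 0 s B.

(* W is only constrained on the sets satisfying finite_control, which are the
   index set of the Gaussian family. *)
Record white_noise (W : set (R * R) -> {RV P >-> R}) : Prop := WhiteNoise {
  white_noise_gaussian : forall n (A : 'I_n -> set (R * R)) (a : 'I_n -> R),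
    (forall i, finite_control (A i)) ->
    centered_gaussian (fun w => \sum_(i < n) a i * W (A i) w);
  white_noise_cov : forall A B, finite_control A -> finite_control B ->
    ('E_P[fun w => (W A w * W B w)%R] = control_measure (A `&` B))%E }.

Definition cone (m : nat) (t : R) : set (R * R) :=
  if m is k.+1
  then [set z | Num.max (2 * `|z.1 - t|) (2 ^- k.+1) < z.2 <= 2 ^- k]
  else [set z | 1 < z.2 /\ `|z.1 - t| < 2^-1].

Record continuous_version (W : set (R * R) -> {RV P >-> R})
    (phi : nat -> R -> {RV P >-> R}) : Prop := ContinuousVersion {
  version_ae : forall (m : nat) (t : R), t \in `[0, 1] ->
    {ae P, forall w, phi m t w = W (cone m t) w};
  version_continuous : forall (m : nat) (w : T),
    {within `[(0 : R), 1], continuous (fun t : R => phi m t w)} }.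

Definition chaos_factor (gamma : R) (phi : nat -> R -> {RV P >-> R})
    (m : nat) (t : R) (w : T) : R :=
  expR (gamma * phi m t w
        - gamma ^+ 2 / 2 * fine 'E_P[fun w' => (phi m t w' ^+ 2)%R]%E).

(* The density is required for every w, and mu m w gives no mass to the
   complement of [0, 1]; this determines mu m w on Borel sets. *)
Definition chaos_measure (gamma : R) (phi : nat -> R -> {RV P >-> R})
    (mu : nat -> T -> {measure set (measurableTypeR R) -> \bar R}) : Prop :=
  forall m w (A : set (measurableTypeR R)), measurable A ->
    mu m w A = (\int[lebesgue_measure]_(t in A `&` `[0%R, 1%R])
                  (\prod_(j < m.+1) chaos_factor gamma phi j t w)%:E)%E.

End WhiteNoise.

Section Fourier.
Context (R : realType).
Local Open Scope complex_scope.

Definition expi (theta : R) : R[i] := cos theta +i* sin theta.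

Definition complex_integral (mu : {measure set (measurableTypeR R) -> \bar R})
    (D : set (measurableTypeR R)) (f : R -> R[i]) : R[i] :=
  (\int[mu]_(t in D) complex.Re (f t)) +i* (\int[mu]_(t in D) complex.Im (f t)).

Definition fourier_coef (mu : {measure set (measurableTypeR R) -> \bar R})
    (n : nat) : R[i] :=
  complex_integral mu `[0, 1] (fun t => expi (- (2 * pi * n%:R * t))).

(* Norm of (a n)_{n >= 1}: the value a 0 is ignored. *)
Definition lq_norm (q : R) (a : nat -> R[i]) : \bar R :=
  Lnorm counting q%:E (fun k => (Normc.normc (a k.+1))%:E).

Definition weighted_fourier (tau : R)
    (mu : {measure set (measurableTypeR R) -> \bar R}) (n : nat) : R[i] :=
  (n%:R `^ (tau / 2))%:C * fourier_coef mu n.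

End Fourier.

Definition D_ {R : realType} (gamma : R) : R :=
  if gamma < Num.sqrt 2 / 2 then 1 - gamma ^+ 2 else (Num.sqrt 2 - gamma) ^+ 2.

Definition admissible_exponents {R : realType} (gamma tau p q : R) : Prop :=
  [/\ 1 < p < 2, 4 / (1 - tau) < q &
      0 < (p - 1) * (1 - gamma ^+ 2 * p / 2) - tau * p / 2 - p / q].

(* Main.v *)
(** Evaluate the integrals on a grid, so that only finitely many Gaussian variables
    occur. Passing from level l to level l + 1 multiplies the density by the Wick
    exponentials X of cone fields that are uncorrelated with the lower levels; the
    weighted Fourier sums are therefore an l^q-valued martingale in l. Because the
    p-th power of the l^q norm is smooth of order p (1 < p < 2 < q), with a constant
    free of the dimension, the p-th moment of the martingale is controlled by the
    sum of those of its increments. Independence enters only as E[H (X - 1)] = 0 for H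
    measurable with respect to the uncorrelated variables, and this follows from
    E[e^Z (X - 1)] = 0 for such variables Z.

    An increment at scale 2^-k splits into 2^k blocks, and blocks of equal parity are
    again uncorrelated, so it remains to estimate one block. Weight the probability by
    the p-th power of the density at the left end point of the block. Frequencies
    n <= 2^k are bounded trivially; for n > 2^k the sum is averaged with its translate by
    half a period, which brings in the increments of the density, of order
    (2^k / n)^(1/2). Summing over n bounds the p-th moment of a block by 2^(-k(1+eps)),
    where eps is the positive quantity of the admissible exponents, so that the levels
    form a geometric series. The bound does not depend on the grid, and Fatou's lemma
    passes to the limit. *)
Require Import Defs.
From HB Require Import structures.
From mathcomp Require Import all_boot all_order all_algebra.
From mathcomp Require Import complex.
From mathcomp Require Import all_classical all_reals all_analysis.
From mathcomp Require Import measurable_realfun.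
From mathcomp Require Import ring lra.
Set Implicit Arguments.
Unset Strict Implicit.
Unset Printing Implicit Defensive.
Import Order.TTheory GRing.Theory Num.Theory.
Import numFieldNormedType.Exports.
Local Open Scope classical_set_scope.
Local Open Scope ring_scope.

(** * Smoothness of the l^q norm *)

(** Nothing is known about t -> W (cone j t) for a fixed outcome, not even measurability, so
    integrals in t can only be formed with the versions [phi]; these are compared with [W] on one
    finite grid at a time. The grid has N points, where N is divisible by 2^m and by 2n for every
    frequency n <= K in use: then dyadic blocks and half periods 1/(2n) consist of whole grid steps.
    The exponent eps is the balance of one block of length 2^-k. Its length gives 2^(-kp), the
    weights n^(tau/2) at n about 2^k give 2^(k tau p/2), the number of relevant frequencies gives
    2^(kp/q), and the p-th moment of the density gives 2^(k gamma^2 (p^2-p)/2). The product is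
    2^(-k(1+eps)), so that 2^k blocks leave 2^(-k eps). The condition q > 4/(1-tau) makes the q-th
    powers of the terms with n > 2^k decay at least like (2^k/n)^2, hence summable with a bound free
    of K. *)

Section real_powers.
Context (R : realType).
Implicit Types x y u v a b p q s t : R.

Lemma expR_le_quad v : expR v <= 1 + v + v ^+ 2 * expR `|v|.
Proof.
have h : expR v - 1 <= v * expR v.
  have := expR_ge1Dx (- v); have := expR_gt0 v; rewrite expRN => e0 h.
  have : (1 - v) * expR v <= 1 by rewrite -ler_pdivlMr// mul1r.
  by lra.
have [v0|v0] := leP 0 v.
  rewrite ger0_norm// expr2.
  have : v * (expR v - 1) <= v * (v * expR v) by rewrite ler_wpM2l.
  by nra.
have : v ^+ 2 * 1 <= v ^+ 2 * expR `|v|.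
  by rewrite ler_wpM2l ?sqr_ge0// -expR0 ler_expR.
have : - v * (1 - expR v) <= - v * - v.
  rewrite ler_wpM2l//; first by lra.
  by have := expR_ge1Dx v; lra.
by nra.
Qed.

Lemma powR_1D_le q u : 0 <= q -> -1 < u ->
  (1 + u) `^ q <= 1 + q * u + q ^+ 2 * u ^+ 2 * expR (q * `|u|).
Proof.
move=> q0 u1; have u0 : 1 + u != 0 by apply/lt0r_neq0; lra.
rewrite /powR (negbTE u0).
apply: (@le_trans _ _ (expR (q * u))).
  by rewrite ler_expR ler_wpM2l// le_ln1Dx.
apply: le_trans (expR_le_quad _) _.
by rewrite exprMn normrM (ger0_norm q0).
Qed.

Local Opaque powR expR.

Lemma powR_1D_concave t u : 0 < t <= 1 -> -1 <= u -> (1 + u) `^ t <= 1 + t * u.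
Proof.
move=> /andP[t0 t1] u1.
have [->|t1'] := eqVneq t 1; first by rewrite powRr1 ?mul1r//; lra.
(* Young's inequality for the product of (1 + u)^t and 1, with the conjugate exponents 1/t and 1/(1
   - t). *)
have := @conjugate_powR _ ((1 + u) `^ t) 1 t^-1 (1 - t)^-1.
rewrite powR_ge0 ler01 !invr_gt0 t0 !invrK subr_gt0 lt_neqAle t1' t1 addrCA subrr addr0.
move=> /(_ isT isT isT isT erefl).
rewrite powR1 -powRrM divff ?gt_eqF// powRr1; last by lra.
by lra.
Qed.

Lemma powR_tangent t a b : 0 < t <= 1 -> 0 < a -> 0 <= a + b ->
  (a + b) `^ t <= a `^ t + t * a `^ (t - 1) * b.
Proof.
move=> t01 a0 ab; have e : a + b = a * (1 + b / a) by field; rewrite gt_eqF.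
have h1 : -1 <= b / a by rewrite ler_pdivlMr//; lra.
rewrite e powRM; [|exact: ltW|lra].
apply: (@le_trans _ _ (a `^ t * (1 + t * (b / a)))).
  by rewrite ler_wpM2l ?powR_ge0// powR_1D_concave.
have <- : a * a `^ (t - 1) = a `^ t.
  by rewrite mulr_powRB1 ?(ltW a0)//; case/andP: t01.
by rewrite le_eqVlt; apply/orP; left; apply/eqP; field; rewrite gt_eqF.
Qed.

Lemma gt0_powRD a s t : 0 < a -> a `^ (s + t) = a `^ s * a `^ t.
Proof. by move=> a0; rewrite powRD// (gt_eqF a0) implybT. Qed.

(** The larger of [u] and [v] dominates the product. This is cruder than Young's inequality and
    costs the factor 2 in [lq_sum_hoelder]. *)
Lemma powRM_le_sum q s u v : 0 <= s <= q -> 0 < q -> 0 <= u -> 0 <= v ->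
  u `^ (q - s) * v `^ s <= u `^ q + v `^ q.
Proof.
move=> /andP[s0 sq] q0 u0 v0.
have D w : 0 <= w -> w `^ (q - s) * w `^ s = w `^ q.
  by move=> w0; rewrite -powRD subrK// gt_eqF.
have [uv|vu] := leP u v.
  apply: (@le_trans _ _ (v `^ q)); last by rewrite lerDr powR_ge0.
  by rewrite -(D v v0) ler_wpM2r ?powR_ge0// ge0_ler_powR ?nnegrE ?subr_ge0.
apply: (@le_trans _ _ (u `^ q)); last by rewrite lerDl powR_ge0.
by rewrite -(D u u0) ler_wpM2l ?powR_ge0// ge0_ler_powR ?nnegrE// ltW.
Qed.

Lemma powRM_le_scaled q s X Y a b : 0 <= s <= q -> 0 < q -> 0 < X -> 0 < Y ->
  0 <= a -> 0 <= b ->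
  a `^ (q - s) * b `^ s <= X `^ (q - s) * Y `^ s * (a `^ q / X `^ q + b `^ q / Y `^ q).
Proof.
move=> sq q0 X0 Y0 a0 b0.
have dv (x y z : R) : 0 <= x -> 0 < y -> (x / y) `^ z = x `^ z / y `^ z.
  move=> x0 y0; rewrite powRM ?invr_ge0 ?(ltW y0)//; congr (_ * _).
  by rewrite -powR_inv1 ?(ltW y0)// -powRrM mulN1r powRN.
rewrite -!dv//.
have -> : a `^ (q - s) * b `^ s
    = X `^ (q - s) * Y `^ s * ((a / X) `^ (q - s) * (b / Y) `^ s).
  rewrite !dv//; field.
  by rewrite !gt_eqF// powR_gt0.
rewrite ler_wpM2l ?mulr_ge0 ?powR_ge0// powRM_le_sum// divr_ge0// ltW//.
Qed.

Lemma norm_powRD_le q x y : 0 <= q ->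
  `|x + y| `^ q <= 2 `^ q * (`|x| `^ q + `|y| `^ q).
Proof.
move=> q0; have nn (z : R) : 0 <= `|z| by [].
have [xy|yx] := leP `|x| `|y|.
  apply: (@le_trans _ _ ((2 * `|y|) `^ q)).
    rewrite ge0_ler_powR ?nnegrE ?mulr_ge0//.
    by apply: le_trans (ler_normD _ _) _; lra.
  by rewrite powRM// ler_wpM2l ?powR_ge0// lerDr powR_ge0.
apply: (@le_trans _ _ ((2 * `|x|) `^ q)).
  rewrite ge0_ler_powR ?nnegrE ?mulr_ge0//.
  by apply: le_trans (ler_normD _ _) _; lra.
by rewrite powRM// ler_wpM2l ?powR_ge0// lerDl powR_ge0.
Qed.

(** The first summand bounds the Taylor remainder when |y| <= |x|/2. In the opposite case the other
    two bound |x + y|^q and the linear term by multiples of |y|^q. *)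
Definition smooth_const q : R := q ^+ 2 * expR q + 3 `^ q + q * 2 `^ q.

Lemma smooth_const_ge0 q : 0 <= q -> 0 <= smooth_const q.
Proof.
by move=> q0; rewrite !addr_ge0 ?mulr_ge0 ?powR_ge0 ?expR_ge0 ?sqr_ge0.
Qed.

(** Taylor expansion of second order for |.|^q. As q > 2 the second derivative is unbounded, so the
    remainder needs the term |y|^q for increments that are large compared with x. *)
Lemma norm_powRD_smooth q x y : 2 < q ->
  `|x + y| `^ q <= `|x| `^ q + q * (`|x| `^ (q - 2) * x) * y
     + smooth_const q * (`|x| `^ (q - 2) * `|y| `^ 2 + `|y| `^ q).
Proof.
move=> q2; have q0 : 0 < q by lra.
have nn (z : R) : 0 <= `|z| by [].
have P1 (w : R) : `|w| `^ (q - 2) * `|w| = `|w| `^ (q - 1).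
  have -> : q - 2 = (q - 1) - 1 by ring.
  by rewrite mulrC mulr_powRB1//; lra.
have c1 : 0 <= q ^+ 2 * expR q by rewrite mulr_ge0 ?sqr_ge0 ?expR_ge0.
have c2 : (0 : R) <= 3 `^ q by rewrite powR_ge0.
have c3 : 0 <= q * 2 `^ q by rewrite mulr_ge0 ?powR_ge0// ltW.
have [yx|xy] := leP (2 * `|y|) `|x|; last first.
  have A1 : `|x + y| `^ q <= 3 `^ q * `|y| `^ q.
    rewrite -powRM// ge0_ler_powR ?nnegrE ?(ltW q0) ?mulr_ge0//.
    by apply: le_trans (ler_normD _ _) _; lra.
  have A2 : - (q * (`|x| `^ (q - 2) * x) * y) <= q * 2 `^ q * `|y| `^ q.
    rewrite -!mulrA -mulrN ler_wpM2l ?(ltW q0)//.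
    apply: (le_trans (ler_norm _)); rewrite normrN !normrM (ger0_norm (powR_ge0 _ _)) mulrA P1.
    apply: (@le_trans _ _ ((2 * `|y|) `^ (q - 1) * (2 * `|y|))).
      rewrite ler_pM ?powR_ge0//; last by rewrite ler_peMl//; lra.
      by rewrite ge0_ler_powR ?nnegrE ?mulr_ge0//; [lra|exact: ltW].
    rewrite mulrC mulr_powRB1 ?mulr_ge0//.
    by rewrite powRM.
  rewrite /smooth_const.
  set a := _ `^ (q - 2) in A2 *.
  have a0 : 0 <= a by rewrite powR_ge0.
  have b0 : 0 <= `|y| `^ 2 by rewrite powR_ge0.
  have d0 : 0 <= `|y| `^ q by rewrite powR_ge0.
  have e0 : 0 <= `|x| `^ q by rewrite powR_ge0.
  have f0 : 0 <= (q ^+ 2 * expR q + 3 `^ q + q * 2 `^ q) * (a * `|y| `^ 2).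
    by rewrite !mulr_ge0// !addr_ge0.
  have g0 : 0 <= q ^+ 2 * expR q * `|y| `^ q by rewrite mulr_ge0.
  by lra.
have [x0|x0] := eqVneq x 0.
  have y0 : y = 0 by move: yx; rewrite x0 normr0 => h; apply/normr0_eq0; have := nn y; lra.
  rewrite x0 y0 addr0 !normr0 !(mulr0,mul0r) !addr0 lerDl.
  by rewrite mulr_ge0 ?smooth_const_ge0 ?(ltW q0)// ?addr_ge0 ?mulr_ge0 ?powR_ge0.
have nx0 : 0 < `|x| by rewrite normr_gt0.
(* By homogeneity the expansion is done at 1, in the relative increment [u], where |u| <= 1/2 keeps
   1 + u positive. *)
pose u := y / x.
have nu : `|u| <= 2^-1.
  by rewrite /u normrM normfV ler_pdivrMr// mulrC ler_pdivlMr//; lra.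
have [u1 u2] : - 2^-1 <= u /\ u <= 2^-1 by apply/andP; rewrite -ler_norml.
have xyE : x + y = x * (1 + u) by rewrite /u; field.
have yE : y = x * u by rewrite /u; field.
have E : `|x + y| `^ q = `|x| `^ q * (1 + u) `^ q.
  by rewrite xyE normrM powRM// (@ger0_norm _ (1 + u))//; lra.
have Q2 : `|x| `^ q = `|x| `^ (q - 2) * x ^+ 2.
  rewrite -(@real_normK _ x) ?num_real// -powR_mulrn// -powRD ?subrK//.
  by apply/implyP => _; rewrite gt_eqF.
have Y2 : `|y| `^ 2 = y ^+ 2 by rewrite powR_mulrn// real_normK ?num_real.
apply: (@le_trans _ _ (`|x| `^ q * (1 + q * u + q ^+ 2 * u ^+ 2 * expR (q * `|u|)))).
  by rewrite E ler_wpM2l ?powR_ge0// powR_1D_le//; lra.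
have B1 : expR (q * `|u|) <= expR q.
  rewrite ler_expR -{2}(mulr1 q) ler_wpM2l ?(ltW q0)//; lra.
have a0 : 0 <= `|x| `^ (q - 2) by rewrite powR_ge0.
apply: (@le_trans _ _ (`|x| `^ q + q * (`|x| `^ (q - 2) * x) * y + q ^+ 2 * expR q * (`|x| `^ (q - 2) * y ^+ 2))).
  have -> : `|x| `^ q * (1 + q * u + q ^+ 2 * u ^+ 2 * expR (q * `|u|)) =
    `|x| `^ q + q * (`|x| `^ (q - 2) * x) * y + (q ^+ 2 * (`|x| `^ (q - 2) * y ^+ 2)) * expR (q * `|u|).
    by rewrite Q2 yE; ring.
  rewrite lerD2l.
  have -> : q ^+ 2 * expR q * (`|x| `^ (q - 2) * y ^+ 2) =
      q ^+ 2 * (`|x| `^ (q - 2) * y ^+ 2) * expR q by ring.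
  by apply: ler_wpM2l B1; rewrite mulr_ge0 ?sqr_ge0// mulr_ge0 ?sqr_ge0.
rewrite lerD2l Y2 /smooth_const.
have b0 : 0 <= `|x| `^ (q - 2) * y ^+ 2 by rewrite mulr_ge0 ?sqr_ge0.
have d0 : 0 <= `|y| `^ q by rewrite powR_ge0.
have : 0 <= (3 `^ q + q * 2 `^ q) * (`|x| `^ (q - 2) * y ^+ 2) by rewrite mulr_ge0 ?addr_ge0.
have : 0 <= (q ^+ 2 * expR q + 3 `^ q + q * 2 `^ q) * `|y| `^ q by rewrite mulr_ge0 ?addr_ge0.
by lra.
Qed.

(** The linear term when the increment is the larger one: the total exponent of [a] is (p - 1)/q >=
    0, so [a] may be raised to [b]. *)
Lemma lq_exponent_lt p q a b : 1 < p -> 0 < q -> 0 < a -> a < b ->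
  p * a `^ (p / q - 1) * (2 * (a `^ ((q - 1) / q) * b `^ (1 / q))) <= 2 * p * b `^ (p / q).
Proof.
move=> p1 q0 a0 ab; have b0 := lt_trans a0 ab.
have -> : p * a `^ (p / q - 1) * (2 * (a `^ ((q - 1) / q) * b `^ (1 / q)))
    = 2 * p * (a `^ ((p - 1) / q) * b `^ (1 / q)).
  have -> : (p - 1) / q = (p / q - 1) + (q - 1) / q by field; rewrite gt_eqF.
  by rewrite (gt0_powRD _ ((q - 1) / q) a0); ring.
rewrite ler_wpM2l ?mulr_ge0//; first by lra.
have -> : p / q = (p - 1) / q + 1 / q by field; rewrite gt_eqF.
rewrite gt0_powRD// ler_wpM2r ?powR_ge0//.
by rewrite ge0_ler_powR ?nnegrE ?(ltW a0) ?(ltW b0) ?(ltW ab)// divr_ge0 ?(ltW q0)//; lra.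
Qed.

(** Here the total exponent of [a] is (p - s)/q <= 0, so [a] may be lowered to [b]. Its use with s =
    2, for the quadratic remainder, is where p < 2 enters. *)
Lemma lq_exponent_ge p q s a b : p <= s -> 0 < q -> 0 < b -> b <= a ->
  a `^ (p / q - 1) * (2 * (a `^ ((q - s) / q) * b `^ (s / q))) <= 2 * b `^ (p / q).
Proof.
move=> ps q0 b0 ba; have a0 := lt_le_trans b0 ba.
have -> : a `^ (p / q - 1) * (2 * (a `^ ((q - s) / q) * b `^ (s / q))) =
    2 * (a `^ ((p - s) / q) * b `^ (s / q)).
  have -> : (p - s) / q = (p / q - 1) + (q - s) / q by field; rewrite gt_eqF.
  by rewrite (gt0_powRD _ ((q - s) / q) a0); ring.
rewrite ler_wpM2l//.
have -> : p / q = (p - s) / q + s / q by field; rewrite gt_eqF.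
rewrite gt0_powRD// ler_wpM2r ?powR_ge0//.
have -> : (p - s) / q = - ((s - p) / q) by field; rewrite gt_eqF.
rewrite !powRN lef_pV2 ?posrE ?powR_gt0//.
by rewrite ge0_ler_powR ?nnegrE ?(ltW a0) ?(ltW b0)// divr_ge0 ?(ltW q0)//; lra.
Qed.

Lemma lq_exponent_top p q a b : p <= q -> 0 < q -> 0 < b -> b <= a ->
  a `^ (p / q - 1) * b <= b `^ (p / q).
Proof.
move=> pq q0 b0 ba; have := lq_exponent_ge pq q0 b0 ba.
by rewrite subrr mul0r powRr0 divff ?gt_eqF// powRr1 ?(ltW b0)// mul1r; lra.
Qed.

Section lq_sum.
Variable I : finType.
Implicit Types f g : I -> R.

Definition lq_sum q f := \sum_i `|f i| `^ q.

Lemma lq_sum_ge0 q f : 0 <= lq_sum q f.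
Proof. by apply: sumr_ge0 => i _; rewrite powR_ge0. Qed.

Lemma lq_sum_eq0 q f : 0 < q -> lq_sum q f = 0 -> forall i, f i = 0.
Proof.
move=> q0 /eqP; rewrite psumr_eq0; last by move=> i _; rewrite powR_ge0.
move=> /allP h i; apply/normr0_eq0/(@powR_eq0_eq0 _ _ q)/eqP.
by apply: h; rewrite mem_index_enum.
Qed.

Lemma eq_lq_sum q f g : f =1 g -> lq_sum q f = lq_sum q g.
Proof. by move=> fg; apply: eq_bigr => i _; rewrite fg. Qed.

Lemma lq_sumD_le q f g : 0 <= q ->
  lq_sum q (fun i => f i + g i) <= 2 `^ q * (lq_sum q f + lq_sum q g).
Proof.
move=> q0; rewrite -big_split/= mulr_sumr ler_sum// => i _.
exact: norm_powRD_le.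
Qed.

(** Hoelder's inequality up to the factor 2: after division by the norms [X] and [Y] each of the two
    normalised sums equals 1. *)
Lemma lq_sum_hoelder q s f g : 0 <= s <= q -> 0 < q -> 0 < lq_sum q f ->
  0 < lq_sum q g ->
  \sum_i `|f i| `^ (q - s) * `|g i| `^ s
    <= 2 * (lq_sum q f `^ ((q - s) / q) * lq_sum q g `^ (s / q)).
Proof.
move=> sq q0 f0 g0.
pose X := lq_sum q f `^ q^-1; pose Y := lq_sum q g `^ q^-1.
have X0 : 0 < X by rewrite powR_gt0.
have Y0 : 0 < Y by rewrite powR_gt0.
have XE (u : R) : lq_sum q f `^ (u / q) = X `^ u by rewrite mulrC powRrM.
have YE (u : R) : lq_sum q g `^ (u / q) = Y `^ u by rewrite mulrC powRrM.
have XqE : X `^ q = lq_sum q f.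
  by rewrite -powRrM mulVf ?gt_eqF// powRr1// ltW.
have YqE : Y `^ q = lq_sum q g.
  by rewrite -powRrM mulVf ?gt_eqF// powRr1// ltW.
rewrite XE YE; clearbody X Y.
apply: (@le_trans _ _ (\sum_i X `^ (q - s) * Y `^ s *
    (`|f i| `^ q / X `^ q + `|g i| `^ q / Y `^ q))).
  by apply: ler_sum => i _; exact: powRM_le_scaled.
have E (h : I -> R) : lq_sum q h != 0 -> \sum_i `|h i| `^ q / lq_sum q h = 1.
  by move=> c0; rewrite -mulr_suml; exact: divff.
have EX : \sum_i `|f i| `^ q / X `^ q = 1 by rewrite XqE (E _ (lt0r_neq0 f0)).
have EY : \sum_i `|g i| `^ q / Y `^ q = 1 by rewrite YqE (E _ (lt0r_neq0 g0)).
rewrite -mulr_sumr big_split/=.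
have EXY : \sum_i `|f i| `^ q / X `^ q + \sum_i `|g i| `^ q / Y `^ q = 2.
  by rewrite (_ : 2 = 1 + 1)//; congr (_ + _).
by rewrite EXY mulrC.
Qed.

(** Gradient of the p-th power of the l^q norm, that is, of f -> (sum of |f i|^q)^(p/q). *)
Definition lq_grad p q f i := p * lq_sum q f `^ (p / q - 1) * (`|f i| `^ (q - 2) * f i).

Lemma norm_lq_term q f i : 2 < q ->
  `| `|f i| `^ (q - 2) * f i| = `|f i| `^ (q - 1).
Proof.
move=> q2; rewrite normrM ger0_norm ?powR_ge0//.
have -> : q - 2 = q - 1 - 1 by ring.
by rewrite mulrC mulr_powRB1//; lra.
Qed.

(** Growth of order p - 1 in the norm is what makes the product of the gradient with a coefficient
    in L^p integrable. *)
Lemma lq_grad_le p q f i : 1 <= p -> 2 < q ->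
  `|lq_grad p q f i| <= p * lq_sum q f `^ ((p - 1) / q).
Proof.
move=> p1 q2; have q0 : 0 < q by lra.
rewrite /lq_grad normrM norm_lq_term// normrM.
rewrite (ger0_norm (powR_ge0 _ _)) (@ger0_norm _ p); last by lra.
rewrite -mulrA ler_wpM2l//; first by lra.
have [S0|S0] := eqVneq (lq_sum q f) 0.
  by rewrite (lq_sum_eq0 q0 S0) normr0 powR0 ?mulr0 ?powR_ge0// gt_eqF//; lra.
have Sp : 0 < lq_sum q f by rewrite lt_neqAle eq_sym S0 lq_sum_ge0.
have -> : (p - 1) / q = (p / q - 1) + (q - 1) / q by field; rewrite gt_eqF.
rewrite (gt0_powRD _ ((q - 1) / q) Sp) ler_wpM2l ?powR_ge0//.
rewrite mulrC powRrM; apply: ge0_ler_powR; rewrite ?nnegrE ?powR_ge0//; first by lra.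
rewrite -[leLHS]powRr1// -[X in _ `^ X](@mulfV _ q) ?gt_eqF// powRrM.
apply: ge0_ler_powR; rewrite ?nnegrE ?powR_ge0 ?invr_ge0 ?lq_sum_ge0 ?(ltW q0)//.
by rewrite /lq_sum (bigD1 i)//= lerDl sumr_ge0// => j _; rewrite powR_ge0.
Qed.

(** The first term serves a base that dominates the increment, with 3 = 2 + 1 for the two parts of
    the remainder; the other two serve a dominating increment. *)
Definition type_const p q : R :=
  p * smooth_const q * 3 + 2 `^ q * 2 + 2 * p.

Lemma type_const_ge0 p q : 0 <= p -> 0 <= q -> 0 <= type_const p q.
Proof.
move=> p0 q0; rewrite !addr_ge0 ?mulr_ge0 ?smooth_const_ge0 ?powR_ge0//.
Qed.

(* type_const is independent of I: this is what makes l^q of martingale type p. *)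
Lemma lq_sum_smooth p q f g : 1 < p < 2 -> 2 < q ->
  lq_sum q (fun i => f i + g i) `^ (p / q) <= lq_sum q f `^ (p / q)
    + \sum_i lq_grad p q f i * g i + type_const p q * lq_sum q g `^ (p / q).
Proof.
move=> /andP[p1 p2] q2; have q0 : 0 < q by lra.
have p0 : 0 < p by lra.
have t01 : 0 < p / q <= 1 by rewrite divr_gt0//= ler_pdivrMr//; lra.
have [t0 t1] := andP t01.
have q1 : (0 : R) <= 1 <= q by apply/andP; split; lra.
have q2' : (0 : R) <= 2 <= q by apply/andP; split; lra.
have sc := smooth_const_ge0 (ltW q0).
have pq : p < q by lra.
have tc := type_const_ge0 (ltW p0) (ltW q0).
have [Sg0|Sg0] := eqVneq (lq_sum q g) 0.
  have g0 := lq_sum_eq0 q0 Sg0.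
  rewrite Sg0 powR0 ?gt_eqF// mulr0 addr0 (@eq_lq_sum _ _ f) => [|i].
    by rewrite big1 ?addr0// => i _; rewrite g0 mulr0.
  by rewrite g0 addr0.
have Gp : 0 < lq_sum q g by rewrite lt_neqAle eq_sym Sg0 lq_sum_ge0.
have [Sf0|Sf0] := eqVneq (lq_sum q f) 0.
  have f0 := lq_sum_eq0 q0 Sf0.
  rewrite Sf0 powR0 ?gt_eqF// add0r (@eq_lq_sum _ _ g) => [|i]; last by rewrite f0 add0r.
  rewrite big1 ?add0r => [|i _]; last by rewrite /lq_grad f0 mulr0 mulr0 mul0r.
  rewrite ler_peMl ?powR_ge0// /type_const.
  have : 0 <= p * smooth_const q * 3 by rewrite !mulr_ge0// ltW.
  have : 0 <= 2 `^ q * 2 :> R by rewrite mulr_ge0 ?powR_ge0.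
  by lra.
have Fp : 0 < lq_sum q f by rewrite lt_neqAle eq_sym Sf0 lq_sum_ge0.
set F := lq_sum q f in Fp *; set G := lq_sum q g in Gp *.
have lin : \sum_i lq_grad p q f i * g i =
    p * F `^ (p / q - 1) * \sum_i `|f i| `^ (q - 2) * f i * g i.
  by rewrite mulr_sumr; apply: eq_bigr => i _; rewrite /lq_grad -mulrA.
(* If the increment is the larger one, both the left side and the linear term are bounded by the
   norm of [g] alone. Otherwise the expansion of |.|^q is summed and inserted into the tangent of
   the concave function t^(p/q) at [F]. *)
have [FG|GF] := ltP F G.
  have A1 : lq_sum q (fun i => f i + g i) `^ (p / q) <= 2 `^ q * 2 * G `^ (p / q).
    apply: (@le_trans _ _ ((2 `^ q * 2 * G) `^ (p / q))).
      apply: ge0_ler_powR; rewrite ?nnegrE ?lq_sum_ge0 ?(ltW t0)//.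
        by rewrite !mulr_ge0 ?powR_ge0// ltW.
      apply: le_trans (lq_sumD_le _ _ (ltW q0)) _.
      by rewrite -mulrA ler_wpM2l ?powR_ge0// -/F -/G; lra.
    rewrite powRM ?mulr_ge0 ?powR_ge0 ?(ltW Gp)// ler_wpM2r ?powR_ge0//.
    apply: ler1_powR => //.
    have : (1 : R) <= 2 `^ q.
      by rewrite -[leLHS](powRr0 2) ler_powR ?(ltW q0)//; lra.
    by lra.
  have A2 : - (\sum_i lq_grad p q f i * g i) <= 2 * p * G `^ (p / q).
    apply: (le_trans (ler_norm _)); rewrite normrN lin normrM.
    rewrite (@ger0_norm _ (p * _)) ?mulr_ge0 ?powR_ge0 ?(ltW p0)//.
    apply: (@le_trans _ _ (p * F `^ (p / q - 1) * (2 * (F `^ ((q - 1) / q) * G `^ (1 / q))))).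
      rewrite ler_wpM2l ?mulr_ge0 ?powR_ge0 ?(ltW p0)//.
      apply: le_trans (ler_norm_sum _ _ _) _.
      apply: le_trans (lq_sum_hoelder q1 q0 Fp Gp).
      by apply: ler_sum => i _; rewrite normrM norm_lq_term// powRr1.
    exact: lq_exponent_lt.
  have B1 : 0 <= F `^ (p / q) by rewrite powR_ge0.
  have B2 : 0 <= p * smooth_const q * 3 * G `^ (p / q).
    by rewrite !mulr_ge0 ?powR_ge0// ltW.
  move: A1 A2 B1 B2; rewrite /type_const; clear.
  move: (lq_sum q _ `^ _) (\sum_i _) (F `^ _) (G `^ _) (2 `^ q) => A B C D E.
  by lra.
pose L := \sum_i `|f i| `^ (q - 2) * f i * g i.
pose M := \sum_i `|f i| `^ (q - 2) * `|g i| `^ 2.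
have step : lq_sum q (fun i => f i + g i) <= F + (q * L + smooth_const q * (M + G)).
  rewrite /F /G /L /M /lq_sum -big_split/= !mulr_sumr -!big_split/=.
  apply: ler_sum => i _; rewrite addrA.
  by apply: le_trans (norm_powRD_smooth _ _ q2) _; rewrite !mulrA.
apply: (@le_trans _ _ ((F + (q * L + smooth_const q * (M + G))) `^ (p / q))).
  apply: ge0_ler_powR; rewrite ?nnegrE ?lq_sum_ge0 ?(ltW t0)//.
  exact: le_trans (lq_sum_ge0 _ _) step.
apply: le_trans (powR_tangent t01 Fp (le_trans (lq_sum_ge0 _ _) step)) _.
have E1 : p / q * F `^ (p / q - 1) * (q * L) = \sum_i lq_grad p q f i * g i.
  by rewrite lin -/L; field; rewrite gt_eqF.
have M1 : F `^ (p / q - 1) * M <= 2 * G `^ (p / q).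
  apply: (@le_trans _ _ (F `^ (p / q - 1) * (2 * (F `^ ((q - 2) / q) * G `^ (2 / q))))).
    by apply: ler_wpM2l (lq_sum_hoelder q2' q0 Fp Gp); rewrite powR_ge0.
  exact: lq_exponent_ge (ltW p2) q0 Gp GF.
have M2 : F `^ (p / q - 1) * G <= G `^ (p / q).
  exact: lq_exponent_top (ltW pq) q0 Gp GF.
have M0 : 0 <= M by rewrite /M sumr_ge0// => i _; rewrite mulr_ge0 ?powR_ge0.
rewrite mulrDr E1 -addrA lerD2l lerD2l.
move: sc p0 t1 q1 M1 M2 (powR_ge0 F (p / q - 1)) (powR_ge0 G (p / q)) M0 (ltW Gp).
rewrite /type_const => + + + +; clear -p1 q2 q0.
have : 0 <= (2 : R) `^ q by exact: powR_ge0.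
move: (2 `^ q) M G (F `^ _) (G `^ _) (smooth_const q) => A M G H K D.
move=> A0 D0 p0 _ _ M1 M2 H0 K0 M0 G0.
have -> : p / q * H * (D * (M + G)) = D * (p / q) * (H * M + H * G) by ring.
have h1 : p / q <= p by rewrite ler_pdivrMr// ler_peMr ?(ltW p0)//; lra.
have h2 : 0 <= p / q by rewrite divr_ge0 ?ltW.
have h3 : H * M + H * G <= 3 * K by lra.
have h4 : D * (p / q) * (H * M + H * G) <= D * p * (3 * K).
  by apply: ler_pM => //; [exact: mulr_ge0|rewrite addr_ge0 ?mulr_ge0|exact: ler_wpM2l].
apply: le_trans h4 _.
have : 0 <= A * K by rewrite mulr_ge0.
have : 0 <= p * K by rewrite mulr_ge0 ?(ltW p0).
by lra.
Qed.

End lq_sum.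

End real_powers.
(** * Gaussian spaces and Wick exponentials *)

Section density.
Local Open Scope ereal_scope.
Context d d' (T : measurableType d) (T' : measurableType d') (R : realType).
Variables (mu : {measure set T -> \bar R}) (nu : {measure set T' -> \bar R}).
Variables (phi : T -> T') (E : set T) (f : T -> R).
Hypotheses (mphi : measurable_fun setT phi) (mE : measurable E).
Hypotheses (mf : measurable_fun E f) (f0 : forall x, (0 <= f x)%R).
Hypothesis nuE : forall A, measurable A ->
  nu A = \int[mu]_(x in phi @^-1` A `&` E) (f x)%:E.

Import HBNNSimple.

(** Used three times: for a Gaussian law with its density on the line, for the measures mu with
    their density in t, and, with [phi] the identity into a coarser sigma-algebra, in place of
    conditional expectation. *)
Lemma ge0_integral_density (g : T' -> \bar R) : measurable_fun setT g ->
  (forall x, 0 <= g x) ->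
  \int[nu]_x g x = \int[mu]_(x in E) (g (phi x) * (f x)%:E).
Proof.
move=> mg g0; pose h := nnsfun_approx measurableT mg.
have hg x : (h n x)%:E @[n --> \oo] --> g x by apply: cvg_nnsfun_approx.
have mphiE : measurable_fun E phi by exact: measurable_funTS.
have mhE n : measurable_fun E (fun x => (h n (phi x))%:E).
  by apply/measurable_EFinP; apply: measurableT_comp mphiE.
have -> : \int[nu]_x g x = limn (fun n => \int[nu]_x (h n x)%:E).
  rewrite -monotone_convergence//.
  - by apply: eq_integral => x _; apply/esym/cvg_lim => //; exact: hg.
  - by move=> n; apply/measurable_EFinP.
  - by move=> n x _; rewrite lee_fin.
  - by move=> x _ a b ab; rewrite lee_fin; exact/lefP/nd_nnsfun_approx.
have -> : \int[mu]_(x in E) (g (phi x) * (f x)%:E) =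
    limn (fun n => \int[mu]_(x in E) ((h n (phi x))%:E * (f x)%:E)).
  rewrite -monotone_convergence//.
  - apply: eq_integral => x _; apply/esym/cvg_lim => //.
    by apply: cvgeZr => //; exact: hg.
  - by move=> n; apply: emeasurable_funM => //; exact/measurable_EFinP.
  - by move=> n x _; rewrite mule_ge0// lee_fin.
  - move=> x _ a b ab; rewrite lee_wpmul2r ?lee_fin//.
    exact/lefP/nd_nnsfun_approx.
congr (limn _); apply/funext => n.
have -> : \int[nu]_x (h n x)%:E =
    \sum_(y \in range (h n)) y%:E * nu (h n @^-1` [set y]).
  by rewrite -sintegralE -integralT_nnsfun.
transitivity (\int[mu]_(x in E) (\sum_(y \in range (h n))
    (y * \1_(h n @^-1` [set y]) (phi x))%:E * (f x)%:E)); last first.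
  apply: eq_integral => x _.
  rewrite -ge0_mule_fsuml => [|y]; last exact: nnfun_muleindic_ge0.
  by rewrite fsumEFin// -(fimfunE _ (phi x)).
rewrite ge0_integral_fsum//; last 2 first.
  - move=> y; apply: emeasurable_funM; last exact/measurable_EFinP.
    apply/measurable_EFinP/measurable_funM => //.
    by apply: measurableT_comp mphiE; exact: measurable_indic.
  - by move=> y x _; rewrite mule_ge0//; [exact: nnfun_muleindic_ge0|rewrite lee_fin].
apply: eq_fsbigr => y; rewrite inE => -[t _ yE].
have y0 : (0 <= y)%R by rewrite -yE.
under [RHS]eq_integral do rewrite EFinM -muleA.
rewrite ge0_integralZl ?lee_fin//; last 2 first.
  - apply: emeasurable_funM; last exact/measurable_EFinP.
    apply/measurable_EFinP.
    by apply: measurableT_comp mphiE; exact: measurable_indic.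
  - by move=> x _; rewrite mule_ge0 ?lee_fin.
congr (_ * _); rewrite nuE// setIC integral_mkcondr.
apply: eq_integral => x _; rewrite /patch indicE.
have -> : (x \in phi @^-1` (h n @^-1` [set y])) = (phi x \in h n @^-1` [set y]).
  by apply/idP/idP; rewrite !inE.
by case: ifP => _; rewrite ?mul1e ?mul0e.
Qed.

End density.

(** * Elementary limits that turn exponentials into indicators *)

Section real_limits.
Context (R : realType).
Implicit Types x y : R.

Lemma norm_expR1_le x : `|expR x - 1| <= `|x| * expR `|x|.
Proof.
have h (y : R) : 0 <= y -> expR y - 1 <= y * expR y.
  move=> y0; have := expR_ge1Dx (- y); have := expR_gt0 y; rewrite expRN => e0 h.
  have : (1 - y) * expR y <= 1 by rewrite -ler_pdivlMr// mul1r.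
  by lra.
have [x0|x0] := leP 0 x.
  by rewrite !ger0_norm ?h// -expR0 subr_ge0 ler_expR.
rewrite ler0_norm ?subr_le0 -?expR0 ?ler_expR ?(ltW x0)// expR0.
apply: (@le_trans _ _ (- x * 1)); first by have := expR_ge1Dx x; lra.
rewrite (ltr0_norm x0) ler_pM ?ler01 ?oppr_ge0 ?(ltW x0)//.
by rewrite -[leLHS]expR0 ler_expR oppr_ge0 ltW.
Qed.

Lemma norm_series_sin_coeff_le x n : `|series (sin_coeff x) n| <= expR `|x|.
Proof.
apply: (@le_trans _ _ (series (exp_coeff `|x|) n)).
  apply: le_trans (ler_norm_sum _ _ _) _; apply: ler_sum => k _.
  rewrite /sin_coeff /exp_coeff /= !normrM normfV !normr_nat !normrX normrN normr1 expr1n mulr1.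
  by rewrite ler_wpM2r ?invr_ge0 ?ler0n// ler_piMl ?exprn_ge0//; case: odd.
apply: nondecreasing_cvgn_le; last exact: is_cvg_series_exp_coeff.
by apply: nondecreasing_series => k _ _; exact: exp_coeff_ge0.
Qed.

Lemma bernoulli_le x n : 0 <= x <= 1 -> 1 - n%:R * x <= (1 - x) ^+ n.
Proof.
move=> /andP[x0 x1]; elim: n => [|n ih]; first by rewrite mul0r subr0 expr0.
rewrite exprS; apply: (@le_trans _ _ ((1 - x) * (1 - n%:R * x))).
  rewrite -natr1; have : 0 <= n%:R * (x * x) by rewrite !mulr_ge0 ?ler0n.
  by lra.
by rewrite ler_wpM2l// subr_ge0.
Qed.

Lemma cvg_natr_expr x : 0 <= x < 1 -> n%:R * x ^+ n @[n --> \oo] --> 0.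
Proof.
(* One factor s^n of x^n keeps n s^n below 1/(1 - s), and the other one tends to 0. *)
move=> /andP[x0 x1]; pose s := Num.sqrt x.
have s0 : 0 <= s by exact: sqrtr_ge0.
have s1 : s < 1 by rewrite -sqrtr1 ltr_sqrt.
have B n : n%:R * s ^+ n * (1 - s) <= 1.
  have : n%:R * s ^+ n * (1 - s) <= 1 - s ^+ n.
    elim: n => [|n ih]; first by rewrite mul0r mul0r expr0 subrr.
    rewrite exprS -natr1.
    have e0 : 0 <= s ^+ n by exact: exprn_ge0.
    have : s * (n%:R * s ^+ n * (1 - s)) <= s * (1 - s ^+ n) by rewrite ler_wpM2l.
    have : s * (s ^+ n * (1 - s)) <= s ^+ n * (1 - s) * 1.
      by rewrite mulrC ler_wpM2l ?mulr_ge0 ?subr_ge0 ?(ltW s1).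
    have : (1 - s) * s ^+ n <= (1 - s) * 1.
      by rewrite ler_wpM2l ?subr_ge0 ?(ltW s1)// exprn_ile1 ?(ltW s1).
    by lra.
  by have : 0 <= s ^+ n by [exact: exprn_ge0]; lra.
apply: (@squeeze_cvgr _ _ _ _ (cst 0) (fun n => (1 - s)^-1 * s ^+ n)).
- near=> n; rewrite mulr_ge0 ?exprn_ge0//=.
  have -> : x = s * s by rewrite -expr2 sqr_sqrtr.
  rewrite exprMn mulrA ler_wpM2r ?exprn_ge0//.
  by rewrite -[leRHS]mul1r ler_pdivlMr ?subr_gt0.
- exact: cvg_cst.
- rewrite -[X in _ --> X](mulr0 (1 - s)^-1); apply: cvgMr.
  by apply: cvg_expr; rewrite ger0_norm.
Unshelve. all: by end_near. Qed.

(** The power behaves like exp(- n (2y)^n), which tends to 0 for y >= 1/2 and to 1 for y < 1/2. The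
    factor n in the exponent decides the boundary case y = 1/2. *)
Lemma cvg_threshold y : 0 <= y <= 1 ->
  1 - (1 - y ^+ n) ^+ (n * 2 ^ n) @[n --> \oo] --> ((2^-1 <= y)%R%:R : R).
Proof.
move=> /andP[y0 y1].
have yn n : 0 <= y ^+ n <= 1 by rewrite exprn_ge0 ?exprn_ile1.
have zn n : 0 <= 1 - y ^+ n by rewrite subr_ge0; case/andP: (yn n).
have E n : (n * 2 ^ n)%:R * y ^+ n = n%:R * (2 * y) ^+ n :> R.
  by rewrite natrM natrX exprMn mulrA.
have [y2|y2] := leP 2^-1 y.
  rewrite -[X in _ --> X]subr0; apply: cvgB; first exact: cvg_cst.
  apply: (@squeeze_cvgr _ _ _ _ (cst 0) (fun n => expR (- n%:R))).
  - near=> n; rewrite /= exprn_ge0//=.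
    apply: (@le_trans _ _ (expR (- y ^+ n) ^+ (n * 2 ^ n))).
      by rewrite lerXn2r ?nnegrE ?expR_ge0// -[leLHS]/(1 + - y ^+ n) expR_ge1Dx.
    rewrite -expRM_natl ler_expR mulrN lerN2 E ler_peMr ?ler0n//.
    by rewrite exprn_ege1//; lra.
  - exact: cvg_cst.
  - exact: cvgn_expR.
apply: (@squeeze_cvgr _ _ _ _ (cst 0) (fun n => n%:R * (2 * y) ^+ n)).
- near=> n; rewrite /= subr_ge0 exprn_ile1//=; last first.
    by rewrite gerBl; case/andP: (yn n).
  by rewrite -E; have := bernoulli_le (n * 2 ^ n) (yn n); lra.
- exact: cvg_cst.
- by apply: cvg_natr_expr; apply/andP; split; lra.
Unshelve. all: by end_near. Qed.

End real_limits.

(** * From vanishing Laplace transforms to vanishing on a sigma-algebra *)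

Section null_functionals.
Context d (T : measurableType d) (R : realType) (P : {measure set T -> \bar R}).
Variables (Y : T -> R) (Zs : set (T -> R)).
Hypotheses (mY : measurable_fun setT Y)
  (mZ : forall Z, Zs Z -> measurable_fun setT Z)
  (ZsD : forall Z Z', Zs Z -> Zs Z' -> Zs (fun w => Z w + Z' w))
  (ZsZ : forall a Z, Zs Z -> Zs (fun w => a * Z w))
  (ZsC : forall a, Zs (fun=> a)).

(** Keeping e^Z in the condition makes the class stable under multiplication by e^Z, and it supplies
    the dominating functions for every limit taken below. In the application [Y] is a Wick
    exponential minus 1. *)
Definition null (H : T -> R) := measurable_fun setT H /\ forall Z, Zs Z ->
  P.-integrable setT (fun w => (H w * (expR (Z w) * Y w))%:E) /\
  (\int[P]_w (H w * (expR (Z w) * Y w))%:E = 0)%E.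

Lemma eq_null H H' : H =1 H' -> null H -> null H'.
Proof. by move=> /funext ->. Qed.

Lemma nullD H H' : null H -> null H' -> null (fun w => H w + H' w).
Proof.
move=> [mH nH] [mH' nH']; split; first exact: measurable_funD.
move=> Z ZZ; have [i e] := nH Z ZZ; have [i' e'] := nH' Z ZZ.
have -> : (fun w => ((H w + H' w) * (expR (Z w) * Y w))%:E) =
  ((fun w => (H w * (expR (Z w) * Y w))%:E) \+ (fun w => (H' w * (expR (Z w) * Y w))%:E)).
  by apply/funext => w /=; rewrite mulrDl EFinD.
by split; [exact: integrableD|rewrite integralD// e e' adde0].
Qed.

Lemma nullZ a H : null H -> null (fun w => a * H w).
Proof.
move=> [mH nH]; split; first exact: measurable_funM.
move=> Z ZZ; have [i e] := nH Z ZZ.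
have -> : (fun w => ((a * H w) * (expR (Z w) * Y w))%:E) =
  (fun w => a%:E * (H w * (expR (Z w) * Y w))%:E)%E.
  by apply/funext => w /=; rewrite -mulrA EFinM.
by split; [exact: integrableZl|rewrite integralZl// e mule0].
Qed.

Lemma nullB H H' : null H -> null H' -> null (fun w => H w - H' w).
Proof.
move=> nH nH'; apply: eq_null (nullD nH (nullZ (-1) nH')) => w /=.
by rewrite mulN1r.
Qed.

Lemma null_expM H Z : null H -> Zs Z -> null (fun w => H w * expR (Z w)).
Proof.
move=> [mH nH] ZZ; split.
  by apply: measurable_funM => //; apply: measurableT_comp => //; exact: mZ.
move=> Z' ZZ'; have [] := nH _ (ZsD ZZ ZZ').
have E : (fun w => (H w * (expR (Z w + Z' w) * Y w))%:E) =
    (fun w => (H w * expR (Z w) * (expR (Z' w) * Y w))%:E).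
  by apply/funext => w; rewrite expRD !mulrA.
by rewrite -!E.
Qed.

Definition dominating (G : T -> R) := forall Z, Zs Z ->
  P.-integrable setT (fun w => (G w * (expR (Z w) * Y w))%:E).

Lemma null_dominating H : null H -> dominating (fun w => `|H w|).
Proof.
move=> [mH nH] Z ZZ; have [i _] := nH Z ZZ.
apply: le_integrable i => //.
  apply/measurable_EFinP/measurable_funM; first exact: measurableT_comp.
  by apply: measurable_funM => //; apply: measurableT_comp => //; exact: mZ.
by move=> w _; rewrite lee_fin !normrM normr_id.
Qed.

Lemma dominatingD G G' : dominating G -> dominating G' ->
  dominating (fun w => G w + G' w).
Proof.
move=> dG dG' Z ZZ; have := integrableD measurableT (dG Z ZZ) (dG' Z ZZ).
by apply: eq_integrable => // w _ /=; rewrite mulrDl EFinD.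
Qed.

Lemma null_lim (Hn : nat -> T -> R) H G : (forall n, null (Hn n)) ->
  (forall w, Hn n w @[n --> \oo] --> H w) -> dominating G ->
  (forall n w, `|Hn n w| <= G w) -> null H.
Proof.
move=> nHn HnH dG HnG.
have mH : measurable_fun setT H.
  by apply: (measurable_fun_cvg (fun n => (nHn n).1)) => w _; exact: HnH.
split => // Z ZZ; have mV : measurable_fun setT (fun w => expR (Z w) * Y w).
  by apply: measurable_funM => //; apply: measurableT_comp => //; exact: mZ.
have := @dominated_convergence _ _ _ P setT measurableT
  (fun n w => (Hn n w * (expR (Z w) * Y w))%:E) (fun w => (H w * (expR (Z w) * Y w))%:E)
  (fun w => `|(G w * (expR (Z w) * Y w))%:E|)%E.
case.
- by move=> n; apply/measurable_EFinP/measurable_funM => //; case: (nHn n).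
- exact/measurable_EFinP/measurable_funM.
- apply: aeW => w _; apply: cvg_EFin; first by apply: nearW.
  by apply: cvgMl; exact: HnH.
- exact: integrable_abse (dG Z ZZ).
- apply: aeW => w n _ /=; rewrite lee_fin !normrM ler_wpM2r//.
  by apply: le_trans (HnG n w) _; exact: ler_norm.
move=> iH _ lim0; split => //.
apply: (cvg_unique _ lim0) => //.
have -> : [sequence (\int[P]_w (Hn n w * (expR (Z w) * Y w))%:E)%E]_n = cst 0%E.
  by apply/funext => n; exact: ((nHn n).2 Z ZZ).2.
exact: cvg_cst.
Qed.

(** Z is the limit of the difference quotients n (e^(Z/n) - 1), which are dominated by e^(2Z) +
    e^(-2Z). *)
Lemma null_mulM H Z : null H -> Zs Z -> null (fun w => H w * Z w).
Proof.
move=> nH ZZ.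
pose Hn n w := n.+1%:R * (H w * expR (n.+1%:R^-1 * Z w) - H w).
apply: (@null_lim Hn _ (fun w => `|H w * expR (2 * Z w)| + `|H w * expR (- 2 * Z w)|)).
- move=> n; apply: nullZ; apply: nullB => //.
  by apply: null_expM => //; exact: ZsZ.
- move=> w; rewrite /Hn.
  have -> : (fun n => n.+1%:R * (H w * expR (n.+1%:R^-1 * Z w) - H w)) =
      (fun n => H w * (n.+1%:R * (expR (n.+1%:R^-1 * Z w) - 1))).
    by apply/funext => n; ring.
  apply: cvgMr; rewrite -[X in _ --> X]subr0.
  apply/cvgrPdist_le => e e0; near=> n.
  have n0 : 0 < n.+1%:R :> R by [].
  set x := Z w; set u := n.+1%:R^-1 * x.
  have -> : x - 0 - n.+1%:R * (expR u - 1) = - (n.+1%:R * (expR u - 1 - u)).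
    by rewrite /u; field.
  rewrite normrN normrM ger0_norm ?ler0n//.
  have h1 : 0 <= expR u - 1 - u by have := expR_ge1Dx u; lra.
  have h2 := expR_le_quad u.
  rewrite ger0_norm//.
  apply: (@le_trans _ _ (n.+1%:R * (u ^+ 2 * expR `|x|))).
    rewrite ler_wpM2l ?ler0n//; apply: (@le_trans _ _ (u ^+ 2 * expR `|u|)); first by lra.
    rewrite ler_wpM2l ?sqr_ge0// ler_expR /u normrM ger0_norm ?invr_ge0//.
    by rewrite ler_piMl// invf_le1// ler1n.
  have -> : n.+1%:R * (u ^+ 2 * expR `|x|) = x ^+ 2 * expR `|x| / n.+1%:R.
    by rewrite /u; field; rewrite gt_eqF.
  rewrite ler_pdivrMr// [leRHS]mulrC -ler_pdivrMr//.
  apply: (@le_trans _ _ n%:R); last by rewrite ler_nat.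
  by near: n; exact: nbhs_infty_ger.
- by apply: dominatingD; apply: null_dominating; apply: null_expM => //; exact: ZsZ.
- move=> n w; rewrite /Hn -{2}(mulr1 (H w)) -mulrBr !normrM -mulrDr mulrCA.
  rewrite ler_wpM2l// normr_nat !(@ger0_norm _ (expR (_ * Z w))) ?expR_ge0//.
  set x := Z w; set u := n.+1%:R^-1 * x.
  have n0 : 0 < n.+1%:R :> R by [].
  apply: (@le_trans _ _ (`|x| * expR `|x|)).
    apply: (@le_trans _ _ (n.+1%:R * (`|u| * expR `|u|))).
      by rewrite ler_wpM2l ?ler0n// norm_expR1_le.
    have uE : n.+1%:R * `|u| = `|x|.
      by rewrite /u normrM ger0_norm ?invr_ge0// mulrA mulfV ?gt_eqF// mul1r.
    rewrite mulrA uE ler_wpM2l// ler_expR -uE ler_peMl// ler1n//.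
  apply: (@le_trans _ _ (expR (2 * `|x|))).
    rewrite mulr_natl mulr2n expRD ler_wpM2r ?expR_ge0//.
    by have := expR_ge1Dx `|x|; lra.
  have [x0|x0] := leP 0 x; first by rewrite ger0_norm// lerDl expR_ge0.
  by rewrite ltr0_norm// mulrN -mulNr lerDr expR_ge0.
Unshelve. all: by end_near. Qed.

(** Multipliers form an algebra closed under bounded pointwise limits; this is how indicators are
    reached. *)
Definition multiplier (u : T -> R) := measurable_fun setT u /\
  forall H, null H -> null (fun w => H w * u w).

Lemma multiplierM u v : multiplier u -> multiplier v ->
  multiplier (fun w => u w * v w).
Proof.
move=> [mu nu] [mv nv]; split; first exact: measurable_funM.
by move=> H nH; apply: eq_null (nv _ (nu _ nH)) => w; rewrite mulrA.
Qed.

Lemma multiplierC a : multiplier (fun=> a).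
Proof.
by split => // H nH; apply: eq_null (nullZ a nH) => w; rewrite mulrC.
Qed.

Lemma multiplierB u v : multiplier u -> multiplier v ->
  multiplier (fun w => u w - v w).
Proof.
move=> [mu nu] [mv nv]; split; first exact: measurable_funB.
by move=> H nH; apply: eq_null (nullB (nu _ nH) (nv _ nH)) => w; rewrite mulrBr.
Qed.

Lemma multiplierD u v : multiplier u -> multiplier v ->
  multiplier (fun w => u w + v w).
Proof.
move=> [mu nu] [mv nv]; split; first exact: measurable_funD.
by move=> H nH; apply: eq_null (nullD (nu _ nH) (nv _ nH)) => w; rewrite mulrDr.
Qed.

Lemma multiplierX u n : multiplier u -> multiplier (fun w => u w ^+ n).
Proof.
move=> mu; elim: n => [|n ih]; first exact: multiplierC.
have -> : (fun w => u w ^+ n.+1) = (fun w => u w * u w ^+ n).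
  by apply/funext => w; rewrite exprS.
exact: multiplierM.
Qed.

Lemma multiplier_lim (un : nat -> T -> R) u : (forall n, multiplier (un n)) ->
  (forall w, un n w @[n --> \oo] --> u w) -> (forall n w, `|un n w| <= 1) ->
  multiplier u.
Proof.
move=> mun unu un1; split.
  by apply: (measurable_fun_cvg (fun n => (mun n).1)) => w _; exact: unu.
move=> H nH; apply: (@null_lim (fun n w => H w * un n w) _ (fun w => `|H w|)).
- by move=> n; exact: (mun n).2.
- by move=> w; apply: cvgMr; exact: unu.
- exact: null_dominating.
- by move=> n w; rewrite normrM ler_piMr.
Qed.

(** The partial sums of the power series are dominated by e^Z + e^(-Z). The sine is a bounded
    function of Z that separates signs near 0, whereas polynomials in Z alone are unbounded. *)
Lemma multiplier_sin Z : Zs Z -> multiplier (fun w => sin (Z w)).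
Proof.
move=> ZZ; have mZ' := mZ ZZ; split.
  by apply: measurableT_comp => //; apply: continuous_measurable_fun; exact: continuous_sin.
move=> H nH; apply: (@null_lim (fun n w => H w * series (sin_coeff (Z w)) n) _
  (fun w => `|H w * expR (Z w)| + `|H w * expR (-1 * Z w)|)).
- elim=> [|n ih].
    by apply: eq_null (nullZ 0 nH) => w; rewrite seriesEnat/= big_nil mulr0 mul0r.
  have nX : null (fun w => H w * Z w ^+ n).
    elim: n {ih} => [|n ih]; first by apply: eq_null nH => w; rewrite mulr1.
    by apply: eq_null (null_mulM ih ZZ) => w; rewrite exprSr mulrA.
  apply: eq_null (nullD ih (nullZ ((odd n)%:R * (-1) ^+ n.-1./2 / n`!%:R) nX)) => w.
  rewrite [in RHS]/series/= big_nat_recr//= mulrDr; congr (_ + _).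
  by rewrite /sin_coeff/=; ring.
- move=> w; apply: cvgMr.
  have -> : sin (Z w) = limn (series (sin_coeff (Z w))) by rewrite unlock.
  exact: is_cvg_series_sin_coeff.
- by apply: dominatingD; apply: null_dominating; apply: null_expM => //; exact: ZsZ.
- move=> n w; rewrite !normrM -mulrDr ler_wpM2l// !(@ger0_norm _ (expR _)) ?expR_ge0//.
  apply: le_trans (norm_series_sin_coeff_le _ _) _.
  have [x0|x0] := leP 0 (Z w); first by rewrite ger0_norm// lerDl expR_ge0.
  by rewrite ltr0_norm// mulN1r lerDr expR_ge0.
Qed.

(* The polynomials 1 - (1 - y^n)^(n 2^n) in y = (1 + sin (Z / M)) / 2 converge to
   the indicator of sin (Z / M) >= 0, which tends to that of Z >= 0 as M grows. *)
Lemma multiplier_ge0 Z : Zs Z -> multiplier (fun w => (0 <= Z w)%R%:R).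
Proof.
move=> ZZ; apply: (@multiplier_lim (fun n w => (0 <= sin (n.+1%:R^-1 * Z w))%R%:R)).
- move=> M; pose y w := 2^-1 * (1 + sin (M.+1%:R^-1 * Z w)).
  have my : multiplier y.
    apply: multiplierM; first exact: multiplierC.
    apply: multiplierD; first exact: multiplierC.
    by apply: (@multiplier_sin (fun w => M.+1%:R^-1 * Z w)); exact: ZsZ.
  have y01 w : 0 <= y w <= 1.
    have := sin_le1 (M.+1%:R^-1 * Z w); have := sin_geN1 (M.+1%:R^-1 * Z w).
    by rewrite /y; move: (sin _) => s *; apply/andP; split; lra.
  apply: (@multiplier_lim (fun n w => 1 - (1 - y w ^+ n) ^+ (n * 2 ^ n))).
  + move=> n; apply: multiplierB; first exact: multiplierC.
    apply: (@multiplierX (fun w => 1 - y w ^+ n)).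
    by apply: multiplierB; [exact: multiplierC|exact: multiplierX].
  + move=> w; have -> : (0 <= sin (M.+1%:R^-1 * Z w)) = (2^-1 <= y w).
      by rewrite /y; move: (sin _) => s; apply/idP/idP => ?; lra.
    exact: cvg_threshold.
  + move=> n w; have /andP[y0 y1] := y01 w.
    have z0 : 0 <= 1 - y w ^+ n by rewrite subr_ge0 exprn_ile1.
    have z1 : 1 - y w ^+ n <= 1 by rewrite gerBl exprn_ge0.
    rewrite ger0_norm ?gerBl ?exprn_ge0//.
    by rewrite subr_ge0 exprn_ile1.
- move=> w; apply: cvg_near_cst; near=> n.
  have n0 : 0 < n.+1%:R :> R by [].
  have Zn : `|Z w| <= n.+1%:R.
    apply: (@le_trans _ _ n%:R); last by rewrite ler_nat.
    by near: n; exact: nbhs_infty_ger.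
  have pi2 := @pi_ge2 R.
  have u1 : `|n.+1%:R^-1 * Z w| <= 1.
    by rewrite normrM ger0_norm ?invr_ge0// mulrC ler_pdivrMr// mul1r.
  congr ((nat_of_bool _)%:R); have [z0|z0] := leP 0 (Z w).
    rewrite sin_ge0_pi// mulr_ge0 ?invr_ge0//=.
    by apply: le_trans (ler_norm _) (le_trans u1 _); lra.
  apply/negbTE; rewrite -ltNge -oppr_gt0 -sinN sin_gt0_pi// oppr_gt0.
  rewrite pmulr_rlt0 ?invr_gt0// z0/=.
  by apply: le_lt_trans (ler_norm _) _; rewrite normrN; apply: le_lt_trans u1 _; lra.
- by move=> n w; rewrite normr_nat; case: (0 <= _).
Unshelve. all: by end_near. Qed.

Definition generated_events : set (set T) :=
  <<s [set [set w | 0 <= Z w] | Z in Zs] >>.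

(** The events whose indicator is a multiplier form a sigma-algebra: unions of two come from 1 - (1
    - u)(1 - v), countable unions from bounded limits. Closure under products replaces a monotone
    class argument. *)
Lemma multiplier_indic B : generated_events B -> multiplier (\1_B).
Proof.
suff : generated_events `<=` [set B | multiplier (\1_B)] by apply.
apply: smallest_sub; last first.
  move=> _ [Z ZZ <-] /=; have := multiplier_ge0 ZZ; congr multiplier.
  by apply/funext => w; rewrite indicE; congr ((nat_of_bool _)%:R); apply/idP/idP; rewrite inE.
split => /=.
- by rewrite indic0; exact: multiplierC.
- move=> A mA; have -> : \1_(setT `\` A) = (fun w => 1 - \1_A w) :> (T -> R).
    apply/funext => w; rewrite !indicE in_setD in_setT/=.
    by case: (w \in A); rewrite ?subrr ?subr0.
  by apply: multiplierB => //; exact: multiplierC.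
- move=> A mA; apply: (@multiplier_lim (fun n => \1_(\big[setU/set0]_(k < n) A k))).
  + elim=> [|n ih]; first by rewrite big_ord0 indic0; exact: multiplierC.
    rewrite big_ord_recr/=; set U := (\big[_/_]_(_ < _) _) in ih *.
    have -> : \1_(U `|` A n) = (fun w => 1 - (1 - \1_U w) * (1 - \1_(A n) w)) :> (T -> R).
      apply/funext => w; rewrite !indicE in_setU.
      by case: (w \in U); case: (w \in A n); rewrite /= ?subrr ?subr0 ?mulr0 ?mulr1 ?subr0 ?subrr.
    apply: multiplierB; first exact: multiplierC.
    by apply: multiplierM; apply: multiplierB => //; exact: multiplierC.
  + move=> w; apply: cvg_near_cst.
    have [[k _ Akw]|nA] := pselect ((\bigcup_k A k) w).
      near=> n; rewrite !indicE !mem_set//; first by exists k.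
      rewrite -bigcup_mkord; exists k => //=.
      by near: n; exact: nbhs_infty_gt.
    near=> n; rewrite !indicE !memNset// -bigcup_mkord => -[k _ Akw].
    by apply: nA; exists k.
  + by move=> n w; rewrite indicE normr_nat; case: (w \in _).
Unshelve. all: by end_near. Qed.

Lemma null_generated_events : null (fun=> 1) -> forall B, generated_events B ->
  (\int[P]_w (\1_B w * Y w)%:E = 0)%E.
Proof.
move=> n1 B /multiplier_indic[_ /(_ _ n1)[_ /(_ _ (ZsC 0))[_]]].
by rewrite expR0; under eq_integral do rewrite !mul1r.
Qed.

End null_functionals.

(** * Laplace transform and second moment of a centered Gaussian variable *)

Section gaussian_law.
Context d (T : measurableType d) (R : realType) (P : probability T R).
Implicit Types (X : T -> R) (s : R).

Lemma cvg_expR_quotient (a : nat -> R) (x : R) : (forall n, 0 < a n <= 1) ->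
  a n @[n --> \oo] --> (0 : R) -> (a n)^-1 * (expR (a n * x) - 1) @[n --> \oo] --> x.
Proof.
move=> a01 a0; have c0 : 0 < x ^+ 2 * expR `|x| + 1.
  by rewrite ltr_wpDl// mulr_ge0 ?sqr_ge0 ?expR_ge0.
apply/cvgrPdist_le => e e0; near=> n.
have /andP[an0 an1] := a01 n.
have -> : x - (a n)^-1 * (expR (a n * x) - 1)
    = - ((a n)^-1 * (expR (a n * x) - 1 - a n * x)) by field; rewrite gt_eqF.
have h1 := expR_ge1Dx (a n * x); have h2 := expR_le_quad (a n * x).
rewrite normrN ger0_norm; last by rewrite mulr_ge0 ?invr_ge0 ?(ltW an0)//; lra.
apply: (@le_trans _ _ ((a n)^-1 * ((a n * x) ^+ 2 * expR `|x|))).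
  rewrite ler_wpM2l ?invr_ge0 ?(ltW an0)//.
  apply: (@le_trans _ _ ((a n * x) ^+ 2 * expR `|a n * x|)); first by lra.
  rewrite ler_wpM2l ?sqr_ge0// ler_expR normrM ger0_norm ?(ltW an0)//.
  by rewrite ler_piMl.
have -> : (a n)^-1 * ((a n * x) ^+ 2 * expR `|x|) = a n * (x ^+ 2 * expR `|x|).
  by field; rewrite gt_eqF.
apply: (@le_trans _ _ (a n * (x ^+ 2 * expR `|x| + 1))).
  by rewrite ler_wpM2l ?(ltW an0)// lerDl.
rewrite -ler_pdivlMr// -[leLHS]gtr0_norm// -[X in `|X|]subr0 distrC.
near: n; move/cvgrPdist_le : a0; by apply; exact: divr_gt0 e0 c0.
Unshelve. all: by end_near. Qed.

Lemma ge0_integral_gaussian X s (g : R -> \bar R) : measurable_fun setT X ->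
  s != 0 -> (forall B : set R, measurable B -> P (X @^-1` B) = normal_prob 0 s B) ->
  measurable_fun setT g -> (forall x, 0 <= g x)%E ->
  (\int[P]_w g (X w) = \int[lebesgue_measure]_x (g x * (normal_pdf 0 s x)%:E))%E.
Proof.
move=> mX s0 XE mg g0.
transitivity (\int[pushforward P X]_y g y)%E.
  by rewrite ge0_integral_pushforward// preimage_setT.
have := @ge0_integral_density _ _ _ _ R lebesgue_measure (pushforward P X) id setT
  (normal_pdf 0 s).
apply => //.
- exact: measurable_normal_pdf.
- by move=> x; exact: normal_pdf_ge0.
- by move=> A mA; rewrite setIT; exact: XE.
Qed.

Lemma gaussian_mgf X s a : measurable_fun setT X ->
  (forall B : set R, measurable B ->
    P (X @^-1` B) = if s == 0 then \d_(0 : R) B else normal_prob 0 s B) ->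
  (\int[P]_w (expR (a * X w))%:E = (expR (a ^+ 2 * s ^+ 2 / 2))%:E)%E.
Proof.
move=> mX XE.
have mE : measurable_fun setT (fun x : R => (expR (a * x))%:E).
  by apply/measurable_EFinP; apply: measurableT_comp => //; exact: measurable_funM.
have [s0|s0] := eqVneq s 0.
  transitivity (\int[pushforward P X]_y (expR (a * y))%:E)%E.
    by rewrite ge0_integral_pushforward// => y _; rewrite lee_fin expR_ge0.
  rewrite (eq_measure_integral \d_(0 : R)) => [|A mA _]; last first.
    by have := XE A mA; rewrite s0 eqxx.
  by rewrite integral_dirac// diracT mul1e s0 mulr0 !expr0n/= !(mulr0, mul0r).
rewrite (@ge0_integral_gaussian X s (fun x => (expR (a * x))%:E))//; last first.
  by move=> B mB; rewrite XE// (negbTE s0).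
(* Completing the square: the exponential tilt moves the mean of the normal density from 0 to a
   s^2. *)
transitivity (\int[lebesgue_measure]_x
    ((expR (a ^+ 2 * s ^+ 2 / 2))%:E * (normal_pdf (a * s ^+ 2) s x)%:E))%E.
  apply: eq_integral => x _; rewrite -!EFinM; congr (_%:E).
  rewrite !normal_pdfE// /normal_fun mulrCA [RHS]mulrCA; congr (_ * _).
  rewrite -!expRD; congr expR; field.
  by rewrite s0.
rewrite ge0_integralZl//; last 2 first.
- by apply/measurable_EFinP; exact: measurable_normal_pdf.
- by move=> x _; rewrite lee_fin normal_pdf_ge0.
by rewrite integral_normal_pdf mule1.
Qed.

(* The second moment is read off the Laplace transform:
   (e^(aX/2) - e^(-aX/2))^2 / a^2 tends to X^2 and has mean 2 (e^(a^2 v / 2) - 1) / a^2. *)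
Lemma second_moment_mgf X (v : R) : measurable_fun setT X ->
  (forall a, \int[P]_w (expR (a * X w))%:E = (expR (a ^+ 2 * v / 2))%:E)%E ->
  P.-integrable setT (fun w => (X w ^+ 2)%:E) /\ (\int[P]_w (X w ^+ 2)%:E = v%:E)%E.
Proof.
move=> mX XE.
have mexp a : measurable_fun setT (fun w => (expR (a * X w))%:E).
  by apply/measurable_EFinP; apply: measurableT_comp => //; exact: measurable_funM.
have iexp a : P.-integrable setT (fun w => (expR (a * X w))%:E).
  apply/integrableP; split => //.
  under eq_integral do rewrite gee0_abs ?lee_fin ?expR_ge0//.
  by rewrite XE ltry.
pose r n : R := n.+1%:R^-1.
have r01 n : 0 < r n <= 1 by rewrite invr_gt0 ltr0n/= invf_le1// ler1n.
have r0 : r n @[n --> \oo] --> (0 : R) by exact: cvg_harmonic.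
pose f n w := (r n)^-1 ^+ 2 * (expR (r n * X w) + expR (- r n * X w) - 2).
have fE n w : f n w = ((r n)^-1 * (expR (r n * (X w / 2)) - 1)
     - (r n)^-1 * (expR (r n * (- (X w / 2))) - 1)) ^+ 2.
  have e1 : expR (r n * X w) = expR (r n * (X w / 2)) ^+ 2.
    by rewrite -expRM_natl; congr expR; field.
  have e2 : expR (- r n * X w) = expR (r n * (- (X w / 2))) ^+ 2.
    by rewrite -expRM_natl; congr expR; field.
  rewrite /f e1 e2 -mulrBr exprMn; congr (_ * _).
  have : expR (r n * (X w / 2)) * expR (r n * (- (X w / 2))) = 1.
    by rewrite mulrN expRxMexpNx_1.
  move: (expR _) (expR _) => a b ab.
  have -> : (b - 1 - (a - 1)) ^+ 2 = b ^+ 2 + a ^+ 2 - 2 * (b * a) by ring.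
  by rewrite ab mulr1.
have mf n : measurable_fun setT (f n).
  apply: measurable_funM => //; apply: measurable_funB => //.
  by apply: measurable_funD; apply/measurable_EFinP; exact: mexp.
have fcvg w : f n w @[n --> \oo] --> X w ^+ 2.
  under eq_cvg do rewrite fE.
  have -> : X w ^+ 2 = (X w / 2 - - (X w / 2)) * (X w / 2 - - (X w / 2)) by field.
  by apply: cvgM; apply: cvgB; exact: cvg_expR_quotient.
have mX2 : measurable_fun setT (fun w => (X w ^+ 2)%:E).
  by apply/measurable_EFinP; exact: measurable_funX.
have cosh_le (x : R) : expR `|x| <= expR x + expR (- x).
  have [x0|x0] := leP 0 x; first by rewrite ger0_norm// lerDl expR_ge0.
  by rewrite ltr0_norm// lerDr expR_ge0.
have fle n w : `|f n w| <= 4 * (expR (2 * X w) + expR (- 2 * X w)).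
  have /andP[rn0 rn1] := r01 n; set x := X w.
  have h1 := expR_le_quad (r n * x); have h2 := expR_le_quad (- r n * x).
  have nu : `|r n * x| <= `|x| by rewrite normrM ger0_norm ?(ltW rn0)// ler_piMl.
  have eu : expR `|r n * x| <= expR `|x| by rewrite ler_expR.
  have fge : 0 <= f n w by rewrite fE sqr_ge0.
  rewrite ger0_norm// /f -/x.
  apply: (@le_trans _ _ ((r n)^-1 ^+ 2 * (2 * (r n * x) ^+ 2 * expR `|x|))).
    rewrite ler_wpM2l ?sqr_ge0//.
    move: h2; rewrite mulNr normrN sqrrN => h2.
    have : (r n * x) ^+ 2 * expR `|r n * x| <= (r n * x) ^+ 2 * expR `|x|.
      by rewrite ler_wpM2l ?sqr_ge0.
    by lra.
  have -> : (r n)^-1 ^+ 2 * (2 * (r n * x) ^+ 2 * expR `|x|) = 2 * (x ^+ 2 * expR `|x|).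
    by field; rewrite gt_eqF.
  have x2 : x ^+ 2 <= 2 * expR `|x|.
    have := @expR_ge1Dxn R `|x| 1 (normr_ge0 _).
    by rewrite -normrX ger0_norm ?sqr_ge0// (_ : 2`! = 2)//; lra.
  apply: (@le_trans _ _ (4 * expR (2 * `|x|))).
    have -> : expR (2 * `|x|) = expR `|x| * expR `|x| by rewrite mulr_natl mulr2n expRD.
    have : x ^+ 2 * expR `|x| <= 2 * expR `|x| * expR `|x|.
      by rewrite ler_wpM2r ?expR_ge0.
    by lra.
  rewrite ler_wpM2l// mulNr.
  by have := cosh_le (2 * x); rewrite normrM (@ger0_norm _ 2).
have := @dominated_convergence _ _ _ P setT measurableT
  (fun n w => (f n w)%:E) (fun w => (X w ^+ 2)%:E)
  (fun w => (4 * (expR (2 * X w) + expR (- 2 * X w)))%:E).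
case.
- by move=> n; apply/measurable_EFinP.
- by [].
- by apply: aeW => w _; apply: cvg_EFin; [exact: nearW|exact: fcvg].
- have := integrableZl measurableT 4 (integrableD measurableT (iexp 2) (iexp (- 2))).
  by apply: eq_integrable.
- by apply: aeW => w n _ /=; rewrite lee_fin.
move=> iX _ lim0; split => //.
apply: (cvg_unique _ lim0) => //.
have intf n : (\int[P]_w (f n w)%:E = ((r n ^+ 2)^-1 * (expR (r n ^+ 2 * (v / 2)) - 1)
    + (r n ^+ 2)^-1 * (expR (r n ^+ 2 * (v / 2)) - 1))%:E)%E.
  transitivity (((r n ^+ 2)^-1)%:E * \int[P]_w
      (((expR (r n * X w))%:E + (expR (- r n * X w))%:E) - (cst 2 w)%:E))%E.
    rewrite -integralZl//; last first.
      by apply: integrableB => //; [exact: integrableD|exact: finite_measure_integrable_cst].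
    by apply: eq_integral => w _; rewrite /f exprVn EFinM.
  rewrite integralB//; [|exact: integrableD|exact: finite_measure_integrable_cst].
  have -> : (\int[P]_x (cst (2 : R) x)%:E = (2 : R)%:E)%E.
    by have := expectation_cst P 2; rewrite unlock.
  rewrite integralD// !XE sqrrN.
  rewrite -[LHS]/(((r n ^+ 2)^-1 * (expR (r n ^+ 2 * v / 2) + expR (r n ^+ 2 * v / 2) - 2))%:E).
  by rewrite mulrA; congr (_%:E); ring.
suff h : (fun n => \int[P]_w (f n w)%:E)%E @ \oo --> v%:E by exact: h.
rewrite (funext intf); apply: cvg_EFin; first exact: nearW.
rewrite [X in _ --> X](_ : v = v / 2 + v / 2); last by field.
have r2 n : 0 < r n ^+ 2 <= 1.
  by have /andP[h1 h2] := r01 n; rewrite exprn_gt0// exprn_ile1// ltW.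
have r20 : r n ^+ 2 @[n --> \oo] --> (0 : R).
  by rewrite -(mulr0 0); under eq_cvg do rewrite expr2; exact: cvgM.
by apply: cvgD; exact: (@cvg_expR_quotient (fun n => r n ^+ 2)).
Qed.

End gaussian_law.

Section gaussian_space.
Context d (T : measurableType d) (R : realType) (P : probability T R).
Implicit Types L M : T -> R.

(** The members are functions, not classes modulo null sets, because the sigma-algebras below are
    generated by pointwise events. *)
Record gaussian_space (G : set (T -> R)) : Prop := GaussianSpace {
  gs_measurable : forall L, G L -> measurable_fun setT L;
  gs0 : G (fun=> 0);
  gsD : forall L M, G L -> G M -> G (fun w => L w + M w);
  gsZ : forall a L, G L -> G (fun w => a * L w);
  gs_gaussian : forall L, G L -> centered_gaussian P L }.

Definition cov L M : R := fine (\int[P]_w (L w * M w)%:E)%E.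

Lemma covC L M : cov L M = cov M L.
Proof. by rewrite /cov; under eq_integral do rewrite mulrC. Qed.

Variables (G : set (T -> R)) (gsG : gaussian_space G).

(** The law is given with an existential scale s only. The second moment identifies s^2 with
    [cov L L], so that from here on Laplace transforms are computed from covariances. *)
Lemma gs_moments L : G L -> [/\ P.-integrable setT (fun w => (L w ^+ 2)%:E),
  (\int[P]_w (L w ^+ 2)%:E = (cov L L)%:E)%E &
  (\int[P]_w (expR (L w))%:E = (expR (cov L L / 2))%:E)%E].
Proof.
move=> GL; have [s sE] := gs_gaussian gsG GL.
have mL := gs_measurable gsG GL.
have mgf a := gaussian_mgf a mL sE.
have [i e] := second_moment_mgf mL mgf.
have covE : cov L L = s ^+ 2.
  by rewrite /cov -[RHS]/(fine (s ^+ 2)%:E) -e; under eq_integral do rewrite -expr2.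
split => //; first by rewrite e covE.
by have := mgf 1; rewrite covE expr1n mul1r; under eq_integral do rewrite mul1r.
Qed.

Lemma gs_integrableM L M : G L -> G M -> P.-integrable setT (fun w => (L w * M w)%:E).
Proof.
move=> GL GM; have [iL _ _] := gs_moments GL; have [iM _ _] := gs_moments GM.
have mL := gs_measurable gsG GL; have mM := gs_measurable gsG GM.
apply: le_integrable (integrableD measurableT iL iM) => //.
  by apply/measurable_EFinP; exact: measurable_funM.
move=> w _; rewrite /= lee_fin [leRHS]ger0_norm ?addr_ge0 ?sqr_ge0//.
rewrite ler_norml; apply/andP; split.
  by have := sqr_ge0 (L w + M w); have := sqr_ge0 (L w); have := sqr_ge0 (M w); nra.
by have := sqr_ge0 (L w - M w); have := sqr_ge0 (L w); have := sqr_ge0 (M w); nra.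
Qed.

Lemma covDl L L' M : G L -> G L' -> G M ->
  cov (fun w => L w + L' w) M = cov L M + cov L' M.
Proof.
move=> GL GL' GM; rewrite /cov -fineD; last 2 first.
- exact: integrable_fin_num (gs_integrableM GL GM).
- exact: integrable_fin_num (gs_integrableM GL' GM).
rewrite -integralD//; [|exact: gs_integrableM|exact: gs_integrableM].
by congr fine; apply: eq_integral => w _; rewrite mulrDl EFinD.
Qed.

Lemma covZl a L M : G L -> G M -> cov (fun w => a * L w) M = a * cov L M.
Proof.
move=> GL GM; have i := gs_integrableM GL GM.
rewrite /cov -[a in RHS]/(fine a%:E) -fineM//; last exact: integrable_fin_num i.
by rewrite -integralZl//; congr fine; apply: eq_integral => w _; rewrite -mulrA EFinM.
Qed.

Lemma covDr L M M' : G L -> G M -> G M' ->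
  cov L (fun w => M w + M' w) = cov L M + cov L M'.
Proof. by move=> *; rewrite covC covDl// covC (covC M'). Qed.

Lemma covZr a L M : G L -> G M -> cov L (fun w => a * M w) = a * cov L M.
Proof. by move=> *; rewrite covC covZl// covC. Qed.

Lemma cov0l M : cov (fun=> 0) M = 0.
Proof. by rewrite /cov; under eq_integral do rewrite mul0r; rewrite integral0. Qed.

Lemma gsB L M : G L -> G M -> G (fun w => L w - M w).
Proof.
move=> GL GM; have := gsD gsG GL (gsZ gsG (-1) GM).
by congr G; apply/funext => w; rewrite mulN1r.
Qed.

Lemma gs_sum (I : Type) (s : seq I) (F : I -> T -> R) : (forall i, G (F i)) ->
  G (fun w => \sum_(i <- s) F i w).
Proof.
move=> GF; elim: s => [|i s ih].
  by have := gs0 gsG; congr G; apply/funext => w; rewrite big_nil.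
by have := gsD gsG (GF i) ih; congr G; apply/funext => w; rewrite big_cons.
Qed.

Lemma cov_suml (I : Type) (s : seq I) (F : I -> T -> R) M :
  (forall i, G (F i)) -> G M ->
  cov (fun w => \sum_(i <- s) F i w) M = \sum_(i <- s) cov (F i) M.
Proof.
move=> GF GM; elim: s => [|i s ih].
  have -> : (fun w => \sum_(i <- [::]) F i w) = (fun=> 0 : R).
    by apply/funext => w; rewrite big_nil.
  by rewrite cov0l big_nil.
rewrite big_cons -ih -covDl//; last exact: gs_sum.
by congr (cov _ M); apply/funext => w; rewrite big_cons.
Qed.

Lemma covBl L L' M : G L -> G L' -> G M ->
  cov (fun w => L w - L' w) M = cov L M - cov L' M.
Proof.
move=> GL GL' GM; rewrite -[- cov L' M]mulN1r -covZl// -covDl//; last exact: gsZ.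
by congr (cov _ M); apply/funext => w; rewrite mulN1r.
Qed.

End gaussian_space.

(** * Wick exponentials have conditional mean one given the orthogonal variables *)

Section wick_exponential.
Context d (T : measurableType d) (R : realType) (P : probability T R).
Variables (G : set (T -> R)) (gsG : gaussian_space P G).
Context (J : Type) (L : J -> T -> R) (GL : forall j, G (L j)).

Definition wick_exp j w : R := expR (L j w - cov P (L j) (L j) / 2).

Definition orthogonal_to : set (T -> R) :=
  [set Z | G Z /\ forall j, cov P Z (L j) = 0].

(* The constants make the thresholds of the generating events arbitrary. *)
Definition orthogonal_affine : set (T -> R) :=
  [set Z | exists Z0 c, orthogonal_to Z0 /\ Z = (fun w => Z0 w + c)].

Definition orthogonal_events := generated_events orthogonal_affine.

Local Notation T_orth := (g_sigma_algebraType
  [set [set w | 0 <= Z w] | Z in orthogonal_affine]).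

(** Measurability for the coarser sigma-algebra on [T] plays the role of independence of [H] from
    the family [L]. *)
Definition orth_measurable (H : T -> R) := measurable_fun setT (H : T_orth -> R).

Lemma measurable_wick_exp j : measurable_fun setT (wick_exp j).
Proof.
apply: measurableT_comp => //; apply: measurable_funB => //.
exact: (gs_measurable gsG (GL j)).
Qed.

Lemma orthogonal_affine_measurable Z : orthogonal_affine Z -> measurable_fun setT Z.
Proof.
move=> [Z0 [c [[GZ _] ->]]]; apply: measurable_funD => //.
exact: (gs_measurable gsG GZ).
Qed.

Lemma orthogonal_affineD Z Z' : orthogonal_affine Z -> orthogonal_affine Z' ->
  orthogonal_affine (fun w => Z w + Z' w).
Proof.
move=> [Z0 [c [[GZ oZ] ->]]] [Z0' [c' [[GZ' oZ'] ->]]].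
exists (fun w => Z0 w + Z0' w), (c + c'); split.
  split; first exact: (gsD gsG).
  by move=> j; rewrite (covDl gsG)// oZ oZ' addr0.
by apply/funext => w; rewrite addrACA.
Qed.

Lemma orthogonal_affineZ a Z : orthogonal_affine Z ->
  orthogonal_affine (fun w => a * Z w).
Proof.
move=> [Z0 [c [[GZ oZ] ->]]].
exists (fun w => a * Z0 w), (a * c); split.
  split; first exact: (gsZ gsG).
  by move=> j; rewrite (covZl gsG)// oZ mulr0.
by apply/funext => w; rewrite mulrDr.
Qed.

Lemma orthogonal_affineC a : orthogonal_affine (fun=> a).
Proof.
exists (fun=> 0), a; split; last by apply/funext => w; rewrite add0r.
by split; [exact: (gs0 gsG)|move=> j; rewrite cov0l].
Qed.

Lemma integrable_expR Z : G Z -> P.-integrable setT (fun w => (expR (Z w))%:E).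
Proof.
move=> GZ; have [_ _ e] := gs_moments gsG GZ; apply/integrableP; split.
  by apply/measurable_EFinP; apply: measurableT_comp => //; exact: (gs_measurable gsG GZ).
under eq_integral do rewrite gee0_abs ?lee_fin ?expR_ge0//.
by rewrite e ltry.
Qed.

(** For uncorrelated Z and L the variance of Z + L is the sum of the variances, and the
    normalisation of the Wick exponential cancels that of L. Here uncorrelatedness is turned into a
    statement about expectations. *)
Lemma wick_exp_orthogonal j Z : orthogonal_affine Z ->
  P.-integrable setT (fun w => (expR (Z w) * (wick_exp j w - 1))%:E) /\
  (\int[P]_w (expR (Z w) * (wick_exp j w - 1))%:E = 0)%E.
Proof.
move=> [Z0 [c [[GZ oZ] ->]]].
have GZL : G (fun w => Z0 w + L j w) by exact: (gsD gsG).
have i1 := integrableZl measurableT (expR (c - cov P (L j) (L j) / 2)) (integrable_expR GZL).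
have i2 := integrableZl measurableT (expR c) (integrable_expR GZ).
have E : (fun w => (expR (Z0 w + c) * (wick_exp j w - 1))%:E) =
  (fun w => (expR (c - cov P (L j) (L j) / 2))%:E * (expR (Z0 w + L j w))%:E
       - (expR c)%:E * (expR (Z0 w))%:E)%E.
  apply/funext => w; rewrite -!EFinM -EFinB; congr (_%:E).
  by rewrite mulrBr mulr1 /wick_exp -!expRD; congr (expR _ - expR _); ring.
rewrite E; split; first exact: integrableB.
rewrite integralB// integralZl; [|by []|exact: integrable_expR].
rewrite integralZl; [|by []|exact: integrable_expR].
have [_ _ ->] := gs_moments gsG GZL; have [_ _ ->] := gs_moments gsG GZ.
rewrite -!EFinM -EFinB -!expRD.
rewrite (covDl gsG)// !(covDr gsG)// (covC _ (L j) Z0) oZ.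
by apply/eqP; rewrite eqe subr_eq0; apply/eqP; congr expR; field.
Qed.

Lemma null_wick_exp j : forall B, orthogonal_events B ->
  (\int[P]_w (\1_B w * (wick_exp j w - 1))%:E = 0)%E.
Proof.
apply: (null_generated_events (Zs := orthogonal_affine)).
- by apply: measurable_funB => //; exact: measurable_wick_exp.
- exact: orthogonal_affine_measurable.
- exact: orthogonal_affineD.
- exact: orthogonal_affineZ.
- exact: orthogonal_affineC.
split => // Z ZZ; have [i e] := wick_exp_orthogonal j ZZ.
split; first by apply: eq_integrable i => // w _; rewrite mul1r.
by under eq_integral do rewrite mul1r.
Qed.

Lemma orthogonal_events_measurable : orthogonal_events `<=` @measurable _ T.
Proof.
apply: smallest_sub; first exact: sigma_algebra_measurable.
move=> _ [Z /orthogonal_affine_measurable mZ <-].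
rewrite -[X in measurable X]setTI.
have -> : [set w | 0 <= Z w] = Z @^-1` `[0, +oo[%classic.
  by apply/seteqP; split => w /=; rewrite in_itv/= andbT.
by apply: mZ.
Qed.

Lemma orth_measurableW H : orth_measurable H -> measurable_fun setT H.
Proof.
by move=> mH _ B mB; apply: orthogonal_events_measurable; exact: mH.
Qed.

Lemma orthogonal_measurable Z : orthogonal_to Z -> orth_measurable Z.
Proof.
move=> oZ; apply: (@measurability _ _ T_orth R setT Z (@RGenCInfty.G R)).
  exact: RGenCInfty.measurableE.
move=> _ [_ [x ->] <-]; rewrite setTI; apply: sub_sigma_algebra => /=.
exists (fun w => Z w + - x); first by exists Z, (- x).
by apply/seteqP; split => w /=; rewrite in_itv/= andbT subr_ge0.
Qed.

Lemma integral_wick_exp_events j B : orthogonal_events B ->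
  (\int[P]_(w in B) (wick_exp j w)%:E = P B)%E.
Proof.
move=> oB; have mB := orthogonal_events_measurable oB.
have iX : P.-integrable setT (fun w => (wick_exp j w)%:E).
  have [i _] := wick_exp_orthogonal j (orthogonal_affineC 0).
  have := integrableD measurableT i (finite_measure_integrable_cst P 1 measurableT).
  by apply: eq_integrable => // w _ /=; rewrite -EFinD expR0 mul1r subrK.
have iB : P.-integrable setT (fun w => (\1_B w)%:E).
  exact: integrable_indic.
have iXB : P.-integrable setT (fun w => (\1_B w * wick_exp j w)%:E).
  apply: le_integrable iX => //.
    apply/measurable_EFinP; apply: measurable_funM; last exact: measurable_wick_exp.
    exact: measurable_indic.
  move=> w _; rewrite lee_fin normrM indicE normr_nat.
  by rewrite ler_piMl//; case: (w \in B).
have := null_wick_exp j oB.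
have -> : (\int[P]_w (\1_B w * (wick_exp j w - 1))%:E =
    \int[P]_w (\1_B w * wick_exp j w)%:E - \int[P]_w (\1_B w)%:E)%E.
  rewrite -integralB//; apply: eq_integral => w _.
  by rewrite -EFinB mulrBr mulr1.
have f1 := integrable_fin_num measurableT iXB.
have f2 := integrable_fin_num measurableT iB.
move=> e; have {}e : (\int[P]_w (\1_B w * wick_exp j w)%:E = \int[P]_w (\1_B w)%:E)%E.
  by move: e; rewrite -(fineK f1) -(fineK f2) -EFinB => -[/subr0_eq ->].
transitivity (\int[P]_w (\1_B w)%:E)%E; last by rewrite integral_indic// setIT.
rewrite -e integral_mkcond.
by apply: eq_integral => w _; rewrite epatch_indic muleC -EFinM.
Qed.

Lemma ge0_integral_wick_exp j (H : T -> \bar R) :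
  measurable_fun setT (H : T_orth -> \bar R) -> (forall w, 0 <= H w)%E ->
  (\int[P]_w (H w * (wick_exp j w)%:E) = \int[P]_w H w)%E.
Proof.
(* The identity, seen as a map into the coarser space: there [wick_exp j] is a density whose
   integral over every event is the probability of that event. *)
move=> mH H0; pose i : T -> T_orth := id.
have mi : measurable_fun setT i.
  by move=> _ B mB; rewrite setTI; exact: orthogonal_events_measurable.
transitivity (\int[pushforward P i]_w H w)%E; last first.
  by rewrite ge0_integral_pushforward.
apply/esym; apply: (@ge0_integral_density _ _ T T_orth R P (pushforward P i) i setT
  (wick_exp j)) => //.
- exact: measurable_wick_exp.
- by move=> w; exact: expR_ge0.
- by move=> A mA; rewrite setIT; apply/esym; exact: integral_wick_exp_events.
Qed.

Lemma integral_wick_expB1 j (H : T -> R) : orth_measurable H ->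
  P.-integrable setT (EFin \o H) ->
  P.-integrable setT (fun w => (H w * (wick_exp j w - 1))%:E) /\
  (\int[P]_w (H w * (wick_exp j w - 1))%:E = 0)%E.
Proof.
move=> mH iH.
have mX := measurable_wick_exp j; have mHT := orth_measurableW mH.
have iHX : P.-integrable setT (fun w => (H w * wick_exp j w)%:E).
  apply/integrableP; split; first by apply/measurable_EFinP; exact: measurable_funM.
  move/integrableP : iH => [_]; rewrite -(@ge0_integral_wick_exp j (fun w => `|(H w)%:E|%E)) => [||w].
  - move=> h; apply: le_lt_trans h; rewrite le_eqVlt; apply/orP; left; apply/eqP.
    apply: eq_integral => w _; rewrite /= normrM EFinM.
    by rewrite (@ger0_norm _ (wick_exp j w)) ?expR_ge0.
  - by apply: measurableT_comp => //; exact/measurable_EFinP.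
  - by rewrite lee_fin.
have E : (fun w => (H w * (wick_exp j w - 1))%:E) =
    (fun w => (H w * wick_exp j w)%:E - (H w)%:E)%E.
  by apply/funext => w; rewrite mulrBr mulr1.
rewrite E; split; first exact: integrableB.
rewrite integralB//.
suff -> : (\int[P]_w (H w * wick_exp j w)%:E = \int[P]_w (H w)%:E)%E.
  by rewrite subee//; exact: integrable_fin_num iH.
(* The identity is known for nonnegative functions, so [H] is split into its positive and negative
   parts. *)
pose Hp w := Num.max (H w) 0; pose Hm w := Num.max (- H w) 0.
have HE w : H w = Hp w - Hm w.
  by rewrite /Hp /Hm; case: (leP (H w) 0) => h; case: (leP (- H w) 0) => h'; lra.
have mHp : orth_measurable Hp by exact: measurable_maxr.
have mHm : orth_measurable Hm.
  by apply: measurable_maxr => //; exact: measurableT_comp.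
have p0 w : 0 <= Hp w by rewrite le_max lexx orbT.
have m0 w : 0 <= Hm w by rewrite le_max lexx orbT.
have pH w : Hp w <= `|H w| by rewrite ge_max ler_norm normr_ge0.
have mH' w : Hm w <= `|H w| by rewrite ge_max normr_ge0 -normrN ler_norm.
have iHp : P.-integrable setT (fun w => (Hp w)%:E).
  apply: le_integrable iH => //; first by apply/measurable_EFinP; exact: orth_measurableW mHp.
  by move=> w _; rewrite lee_fin ger0_norm.
have iHm : P.-integrable setT (fun w => (Hm w)%:E).
  apply: le_integrable iH => //; first by apply/measurable_EFinP; exact: orth_measurableW mHm.
  by move=> w _; rewrite lee_fin ger0_norm.
have ge0X (K : T -> R) : orth_measurable K -> (forall w, 0 <= K w) ->
    (\int[P]_w (K w * wick_exp j w)%:E = \int[P]_w (K w)%:E)%E.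
  move=> mK K0; rewrite -(@ge0_integral_wick_exp j (fun w => (K w)%:E)) => [||w].
  - by apply: eq_integral => w _; rewrite EFinM.
  - exact/measurable_EFinP.
  - by rewrite lee_fin.
have iX (K : T -> R) : orth_measurable K -> (forall w, 0 <= K w) ->
    (forall w, K w <= `|H w|) -> P.-integrable setT (fun w => (K w * wick_exp j w)%:E).
  move=> mK K0 KH; apply: le_integrable iHX => //.
    by apply/measurable_EFinP; apply: measurable_funM => //; exact: orth_measurableW.
  move=> w _; rewrite lee_fin !normrM ler_wpM2r// ger0_norm//.
transitivity (\int[P]_w ((Hp w * wick_exp j w)%:E - (Hm w * wick_exp j w)%:E))%E.
  by apply: eq_integral => w _; rewrite {1}HE mulrBl.
rewrite integralB//; [|exact: iX|exact: iX].
rewrite !ge0X// -integralB//.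
by apply: eq_integral => w _; rewrite [in RHS]HE.
Qed.

End wick_exponential.
Section measurable_lq_sum.
Context d (T : measurableType d) (R : realType) (I : finType).

Lemma measurable_lq_sum (q : R) (x : I -> T -> R) :
  (forall i, measurable_fun setT (x i)) ->
  measurable_fun setT (fun w => lq_sum q (fun i => x i w)).
Proof.
move=> mx; apply: measurable_sum => i.
apply: (measurableT_comp (measurable_powR _)).
by apply: measurableT_comp => //; exact: mx.
Qed.

Lemma measurable_lq_sum_powR (q s : R) (x : I -> T -> R) :
  (forall i, measurable_fun setT (x i)) ->
  measurable_fun setT (fun w => lq_sum q (fun i => x i w) `^ s).
Proof.
move=> mx; apply: (measurableT_comp (measurable_powR _)).
exact: measurable_lq_sum.
Qed.

Lemma measurable_lq_grad (p q : R) (x : I -> T -> R) i :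
  (forall i, measurable_fun setT (x i)) ->
  measurable_fun setT (fun w => lq_grad p q (fun i => x i w) i).
Proof.
move=> mx; apply: measurable_funM.
  by apply: measurable_funM => //; exact: measurable_lq_sum_powR.
apply: measurable_funM => //; apply: (measurableT_comp (measurable_powR _)).
by apply: measurableT_comp => //; exact: mx.
Qed.

End measurable_lq_sum.

Lemma ge0_le_integralT d (T : measurableType d) (R : realType)
    (mu : {measure set T -> \bar R}) (f g : T -> \bar R) :
  (forall w, 0 <= f w)%E -> measurable_fun setT f -> measurable_fun setT g ->
  (forall w, f w <= g w)%E -> (\int[mu]_w f w <= \int[mu]_w g w)%E.
Proof. by move=> *; apply: ge0_le_integral. Qed.

Lemma le_addy (R : realType) (C : R) (a b c : \bar R) :
  0 < C -> (0 <= b)%E -> c = +oo%E -> (a <= b + C%:E * c)%E.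
Proof.
move=> C0 b0 ->; rewrite gt0_muley ?lte_fin// addey ?leey//.
by rewrite gt_eqF// (lt_le_trans _ b0).
Qed.

(** * One martingale step in l^q *)

Section martingale_type.
Context d (T : measurableType d) (R : realType) (P : probability T R).
Variables (G : set (T -> R)) (gsG : gaussian_space P G).
Context (J : finType) (L : J -> T -> R) (GL : forall j, G (L j)).
Context (I : finType).
Local Notation orth_measurable := (orth_measurable P G L).
Local Notation X := (wick_exp P L).

(** [lq_sum_smooth] is integrated; its linear term is a sum of products of an orthogonally
    measurable factor with a single X j - 1, hence has mean 0. The variables X j may be correlated
    with each other, since they enter this term linearly. *)
Lemma wick_martingale_type (p q : R) (x : I -> T -> R) (c : I -> J -> T -> R) :
  1 < p < 2 -> 2 < q ->
  (forall i, orth_measurable (x i)) -> (forall i j, orth_measurable (c i j)) ->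
  (\int[P]_w (lq_sum q (fun i => x i w) `^ (p / q))%:E < +oo)%E ->
  (forall i j, \int[P]_w (`|c i j w| `^ p)%:E < +oo)%E ->
  (\int[P]_w (lq_sum q (fun i => x i w + \sum_j c i j w * (X j w - 1)) `^ (p / q))%:E
    <= \int[P]_w (lq_sum q (fun i => x i w) `^ (p / q))%:E + (type_const p q)%:E *
       \int[P]_w (lq_sum q (fun i => (\sum_j c i j w * (X j w - 1))%R) `^ (p / q))%:E)%E.
Proof.
move=> p12 q2 mx mc ix ic; have /andP[p1 p2] := p12.
have p0 : 0 < p by lra.
have q0 : 0 < q by lra.
have C0 : 0 < type_const p q.
  rewrite ltr_wpDl ?mulr_gt0//.
  by rewrite addr_ge0// ?mulr_ge0 ?smooth_const_ge0 ?powR_ge0 ?ltW.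
have mxT i := orth_measurableW gsG (mx i).
have mcT i j := orth_measurableW gsG (mc i j).
have mX j := measurable_wick_exp gsG GL j.
pose D i w := \sum_j c i j w * (X j w - 1).
have mD i : measurable_fun setT (D i).
  by apply: measurable_sum => j; apply: measurable_funM => //; exact: measurable_funB.
pose Sx w := lq_sum q (fun i => x i w) `^ (p / q).
pose SD w := lq_sum q (D^~ w) `^ (p / q).
pose g i w := lq_grad p q (fun i => x i w) i.
have mSx : measurable_fun setT (EFin \o Sx).
  by apply/measurable_EFinP; exact: measurable_lq_sum_powR.
have mSD : measurable_fun setT (EFin \o SD).
  by apply/measurable_EFinP; exact: measurable_lq_sum_powR.
have iSx : P.-integrable setT (EFin \o Sx).
  apply/integrableP; split => //.
  by under eq_integral do rewrite gee0_abs ?lee_fin ?powR_ge0//.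
have igc i j : P.-integrable setT (fun w => (g i w * c i j w * (X j w - 1))%:E) /\
    (\int[P]_w (g i w * c i j w * (X j w - 1))%:E = 0)%E.
  apply: (integral_wick_expB1 gsG GL).
    apply: measurable_funM; last exact: mc.
    exact: (@measurable_lq_grad _ (g_sigma_algebraType
      [set [set w | 0 <= Z w] | Z in orthogonal_affine P G L])).
  have icp : P.-integrable setT (fun w => (`|c i j w| `^ p)%:E).
    apply/integrableP; split.
      apply/measurable_EFinP; apply: (measurableT_comp (measurable_powR _)).
      exact: measurableT_comp.
    by under eq_integral do rewrite gee0_abs ?lee_fin ?powR_ge0//; exact: ic.
  apply: le_integrable (integrableZl measurableT p (integrableD measurableT iSx icp)) => //.
    apply/measurable_EFinP; apply: measurable_funM => //; exact: measurable_lq_grad.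
  move=> w _; rewrite /= lee_fin normrM.
  rewrite [leRHS]ger0_norm ?mulr_ge0 ?addr_ge0 ?powR_ge0 ?(ltW p0)//.
  apply: (@le_trans _ _ (p * lq_sum q (fun i => x i w) `^ ((p - 1) / q) * `|c i j w|)).
    by rewrite ler_wpM2r// lq_grad_le// ltW.
  rewrite -mulrA ler_wpM2l ?(ltW p0)//.
  (* With N the l^q norm of x: N^(p-1) |c| <= N^p + |c|^p, and both terms are integrable by
     hypothesis. *)
  have := @powRM_le_sum _ p 1 (lq_sum q (fun i => x i w) `^ q^-1) `|c i j w|.
  rewrite -!powRrM powRr1// (mulrC _ (p - 1)) (mulrC _ p); apply => //.
  - by apply/andP; split; lra.
  - exact: powR_ge0.
pose Z w := \sum_i g i w * D i w.
have ZE w : (Z w)%:E = (\sum_i \sum_j (g i w * c i j w * (X j w - 1))%:E)%E.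
  rewrite /Z -sumEFin; apply: eq_bigr => i _; rewrite sumEFin mulr_sumr.
  by congr (_%:E); apply: eq_bigr => j _; rewrite mulrA.
have iZ : P.-integrable setT (EFin \o Z).
  rewrite (_ : EFin \o Z = (fun w => \sum_i \sum_j (g i w * c i j w * (X j w - 1))%:E)%E).
    apply: integrable_sum => //= i _; apply: integrable_sum => //= j _.
    exact: (igc i j).1.
  by apply/funext => w /=; exact: ZE.
have intZ : (\int[P]_w (Z w)%:E = 0)%E.
  under eq_integral do rewrite ZE.
  rewrite integral_sum//=; last first.
    by move=> i; apply: integrable_sum => //= j _; exact: (igc i j).1.
  apply: big1 => i _; rewrite integral_sum//=; last by move=> j; exact: (igc i j).1.
  by apply: big1 => j _; exact: (igc i j).2.
(* The increment is not assumed to have a finite moment; if it has none, the right side is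
   infinite. *)
have [SDoo|SDfin] := eqVneq (\int[P]_w (SD w)%:E)%E +oo%E.
  apply: le_addy C0 _ SDoo.
  by apply: integral_ge0 => w _; rewrite lee_fin powR_ge0.
have iSD : P.-integrable setT (EFin \o SD).
  apply/integrableP; split => //.
  under eq_integral do rewrite gee0_abs ?lee_fin ?powR_ge0//.
  by rewrite ltey.
have iCSD : P.-integrable setT (fun w => (type_const p q * SD w)%:E).
  by have := integrableZl measurableT (type_const p q) iSD; apply: eq_integrable.
apply: (@le_trans _ _ (\int[P]_w ((Sx w)%:E + (type_const p q * SD w)%:E + (Z w)%:E))%E).
  apply: ge0_le_integralT.
  - by move=> w; rewrite lee_fin powR_ge0.
  - apply/measurable_EFinP; apply: measurable_lq_sum_powR => i.
    by apply: measurable_funD; [exact: mxT|exact: mD].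
  - apply: emeasurable_funD; last exact: measurable_int iZ.
    by apply: emeasurable_funD; [exact: mSx|exact: measurable_int iCSD].
  - move=> w; rewrite -!EFinD lee_fin addrAC.
    exact: (lq_sum_smooth (x^~ w) (D^~ w) p12 q2).
have /= -> := integralD measurableT (integrableD measurableT iSx iCSD) iZ.
rewrite intZ adde0.
have /= -> := integralD measurableT iSx iCSD.
have /= <- := integralZl measurableT iSD (type_const p q).
exact: lexx.
Qed.

End martingale_type.
(** * Covariances of the cone fields *)

Section cone_geometry.
Context (R : realType).
Implicit Types (t s u v y : R) (j : nat).
Local Notation mu := (@lebesgue_measure R).

Definition cone_heights j : set R :=
  if j is k.+1 then `]2 ^- k.+1, 2 ^- k]%classic else `]1, +oo[%classic.

(** Level 0 is a strip of constant width; a width function lets all levels share one computation. *)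
Definition cone_width j y : R := if j is _.+1 then y else 1.

Lemma coneE j t :
  cone j t = [set z | cone_heights j z.2 /\ `|z.1 - t| < cone_width j z.2 / 2].
Proof.
apply/seteqP; case: j => [|k]; split => -[x y] /=; rewrite ?in_itv/=.
- by move=> [-> ]; rewrite mul1r.
- by rewrite andbT mul1r.
- by rewrite gt_max => /andP[/andP[h1 ->] ->]; split => //; lra.
- by move=> [/andP[h1 ->]] h2; rewrite gt_max h1 !andbT; lra.
Qed.

Lemma measurable_cone_heights j : measurable (cone_heights j).
Proof. by case: j => [|k]; exact: measurable_itv. Qed.

Lemma cone_heights_gt0 j y : cone_heights j y -> 0 < y.
Proof.
case: j => [|k] /=; rewrite in_itv/= => /andP[h _]; first by lra.
by apply: lt_trans h; rewrite invr_gt0 exprn_gt0.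
Qed.

Lemma cone_heights_disjoint i j y : cone_heights i y -> cone_heights j y -> i = j.
Proof.
wlog ij : i j / (i <= j)%N.
  move=> h hi hj; have [ij|ji] := leqP i j; first exact: h.
  by apply/esym; exact: h (ltnW ji) hj hi.
move: ij; rewrite leq_eqVlt => /predU1P[//|].
case: j => [//|j]; rewrite ltnS => ij hi /=; rewrite in_itv/= => /andP[_ yj].
exfalso; case: i ij hi => [_|i ij] /=; rewrite in_itv/= => /andP[iy _].
  have : (2 : R) ^- j <= 1 by rewrite invf_le1 ?exprn_gt0// exprn_ege1// ler1n.
  by lra.
have : (2 : R) ^- j <= 2 ^- i.+1.
  by rewrite lef_pV2 ?posrE ?exprn_gt0// ler_eXn2l// ltr1n.
by lra.
Qed.

Lemma cone_width_ge0 j y : cone_heights j y -> 0 <= cone_width j y.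
Proof. by case: j => [//|k] /cone_heights_gt0/ltW. Qed.

Lemma measurable_cone_width j : measurable_fun setT (cone_width j).
Proof. by case: j => [|k]; [exact: measurable_cst|exact: measurable_id]. Qed.

Lemma measurable_cone j t : measurable (cone j t).
Proof.
rewrite coneE; have m2 : measurable_fun setT (@snd R R) by exact: measurable_snd.
have m1 : measurable_fun setT (@fst R R) by exact: measurable_fst.
have mb : measurable_fun setT
    (fun z : R * R => `|z.1 - t| < cone_width j z.2 / 2).
  apply: measurable_fun_ltr.
    by apply: measurableT_comp => //; exact: measurable_funB.
  apply: measurable_funM => //.
  by apply: measurableT_comp m2; exact: measurable_cone_width.
have := measurableI _ _ (m2 measurableT _ (measurable_cone_heights j))
  (mb measurableT [set true] Logic.I).
by rewrite !setTI; congr measurable; apply/seteqP; split => z /=.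
Qed.

Lemma cone_half_plane j t : cone j t `<=` @half_plane R.
Proof. by rewrite coneE => z [/cone_heights_gt0]. Qed.

(** Covariance of the level-j field at distance u: two intervals of length w whose centers are at
    distance u overlap in length max(0, w - u). *)
Definition ekappa j u : \bar R :=
  (\int[mu]_(y in cone_heights j) (Num.max 0 (cone_width j y - u) * (y ^+ 2)^-1)%:E)%E.

Lemma lebesgue_measure_cone_section j t s y : cone_heights j y ->
  mu [set x | `|x - t| < cone_width j y / 2 /\ `|x - s| < cone_width j y / 2]
    = (Num.max 0 (cone_width j y - `|t - s|))%:E.
Proof.
move=> /cone_width_ge0; move: (cone_width j y) => w w0.
have -> : [set x | `|x - t| < w / 2 /\ `|x - s| < w / 2] =
    [set` `]Num.max t s - w / 2, Num.min t s + w / 2[].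
  apply/seteqP; split => x /=; rewrite in_itv/= !ltr_norml.
    move=> [/andP[h1 h2] /andP[h3 h4]]; apply/andP; split.
      by rewrite ltrBlDr gt_max; apply/andP; split; lra.
    by rewrite -ltrBlDr lt_min; apply/andP; split; lra.
  move=> /andP[]; rewrite ltrBlDr gt_max => /andP[h1 h2].
  rewrite -ltrBlDr lt_min => /andP[h3 h4].
  by split; apply/andP; split; lra.
rewrite lebesgue_measure_itv/= lte_fin.
have -> : `|t - s| = Num.max t s - Num.min t s.
  by case: (leP t s) => ts; [rewrite ler0_norm|rewrite gtr0_norm]; lra.
move: (Num.max t s) (Num.min t s) => a b.
by case: ifP => h; rewrite -?EFinB; congr (_%:E); case: (leP 0 (w - (a - b))) => h'; lra.
Qed.

Lemma measurable_invr_sqr : measurable_fun setT (fun y : R => (y ^+ 2)^-1).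
Proof.
have -> : (fun y : R => (y ^+ 2)^-1) = (fun y => (y ^+ 2) `^ (-1)).
  by apply/funext => y; rewrite powR_inv1 ?sqr_ge0.
by apply: (measurableT_comp (measurable_powR _)); exact: measurable_funX.
Qed.

Lemma control_measure_coneI j t s :
  control_measure (cone j t `&` cone j s) = ekappa j `|t - s|.
Proof.
have mC : measurable (cone j t `&` cone j s) by apply: measurableI; exact: measurable_cone.
have m2 : measurable_fun setT (@snd R R) by exact: measurable_snd.
rewrite /control_measure integral_mkcond.
set f := (X in (X \_ _)%E).
have fE z : (f \_ (cone j t `&` cone j s)) z =
    ((\1_(cone j t `&` cone j s) z)%:E * (Num.max 0 (z.2 ^+ 2)^-1)%:E)%E.
  rewrite epatch_indic muleC; congr (_ * _)%E; rewrite /f; congr (_%:E).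
  by rewrite max_r// invr_ge0 sqr_ge0.
rewrite (@fubini_tonelli2 _ _ _ _ R mu mu); last 2 first.
- rewrite (funext fE); apply: emeasurable_funM; apply/measurable_EFinP.
    exact: measurable_indic.
  by apply: measurable_maxr => //; apply: (measurableT_comp measurable_invr_sqr); exact: m2.
- by move=> z; rewrite fE mule_ge0// lee_fin// le_max lexx.
rewrite /ekappa [RHS]integral_mkcond; apply: eq_integral => y _.
have c0 : 0 <= Num.max 0 (y ^+ 2)^-1 by rewrite le_max lexx.
have cE : Num.max 0 (y ^+ 2)^-1 = (y ^+ 2)^-1 by rewrite max_r// invr_ge0 sqr_ge0.
have mS : measurable (ysection (cone j t `&` cone j s) y).
  exact: (@measurable_ysection _ _ (measurableTypeR R) (measurableTypeR R) _ y mC).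
transitivity (\int[mu]_x ((\1_(ysection (cone j t `&` cone j s) y) x)%:E *
    (Num.max 0 (y ^+ 2)^-1)%:E))%E.
  apply: eq_integral => x _; rewrite fE/= !indicE; congr ((_%:R)%:E * _)%E.
  by congr nat_of_bool; apply/idP/idP; rewrite !inE /ysection/= inE.
rewrite ge0_integralZr//; last exact/measurable_EFinP/measurable_indic.
rewrite integral_indic// setIT cE /patch.
have SE : ysection (cone j t `&` cone j s) y =
  [set x | (cone_heights j y /\ `|x - t| < cone_width j y / 2) /\
     (cone_heights j y /\ `|x - s| < cone_width j y / 2)].
  by apply/seteqP; split => x /=; rewrite /ysection/= inE !coneE.
rewrite SE; case: ifPn => [|]; [rewrite inE => hy|rewrite notin_setE => hy]; last first.
  have -> : [set x | (cone_heights j y /\ `|x - t| < cone_width j y / 2) /\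
     (cone_heights j y /\ `|x - s| < cone_width j y / 2)] = set0.
    by rewrite -subset0 => x /= [[]].
  by rewrite measure0 mul0e.
have -> : [set x | (cone_heights j y /\ `|x - t| < cone_width j y / 2) /\
     (cone_heights j y /\ `|x - s| < cone_width j y / 2)] =
   [set x | `|x - t| < cone_width j y / 2 /\ `|x - s| < cone_width j y / 2].
  by apply/seteqP; split => x /= => [[[_ ?] [_ ?]]|[? ?]].
by rewrite [X in (X * _)%E](lebesgue_measure_cone_section t s hy) EFinM.
Qed.

(** At level 0 this is the exact integral. At level k + 1 the maximum 2^(2(k+1)) of the integrand
    times the length 2^-(k+1) is enough. It serves as the Lipschitz constant of [kappa]. *)
Lemma mass_cone_heights_le j :
  (\int[mu]_(y in cone_heights j) ((y ^+ 2)^-1)%:E <= (2 ^+ j)%:E)%E.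
Proof.
have m2 D : measurable_fun D (fun y : R => ((y ^+ 2)^-1)%:E).
  by apply/measurable_EFinP; apply: measurable_funTS; exact: measurable_invr_sqr.
have p2 (y : R) : (0 <= ((y ^+ 2)^-1)%:E)%E by rewrite lee_fin invr_ge0 sqr_ge0.
case: j => [|k].
  apply: (@le_trans _ _ (\int[mu]_(y in `[1%R, +oo[) ((y ^+ 2)^-1)%:E)%E).
    apply: ge0_subset_integral => //=.
    - by apply/measurable_EFinP; apply: measurable_funTS; exact: measurable_invr_sqr.
    - by move=> y /=; rewrite !in_itv/= !andbT => /ltW.
  have dF (x : R) : 1 < x -> is_derive x 1 (fun x : R => - x^-1) ((x ^+ 2)^-1).
    move=> x1; have x0 : x != 0 by rewrite gt_eqF//; lra.
    have h : is_derive x 1 (fun x : R => x^-1) (- (x ^- 2) *: 1).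
      exact: is_deriveV.
    have -> : (x ^+ 2)^-1 = - (- (x ^- 2) *: 1) by rewrite /GRing.scale/= mulr1 opprK.
    exact: is_deriveN.
  have cV (x : R) : 1 <= x -> {for x, continuous (fun x : R => x^-1)}.
    by move=> x1; apply: inv_continuous; rewrite gt_eqF//; lra.
  rewrite (@ge0_continuous_FTC2y _ (fun y : R => (y ^+ 2)^-1) (fun x => - x^-1) 1 0).
  - by rewrite sub0e -EFinN opprK invr1 expr0.
  - by move=> x _; rewrite invr_ge0 sqr_ge0.
  - apply: continuous_in_subspaceT => x; rewrite inE/= in_itv/= andbT => x1.
    apply: (@cvgV _ _ _ _ (fun x : R => x ^+ 2)); last exact: exprn_continuous.
    by rewrite sqrf_eq0 gt_eqF//; lra.
  - rewrite -[X in _ --> X]oppr0; apply: cvgN; apply/gtr0_cvgV0; last exact: cvg_id.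
    exact: nbhs_pinfty_gt.
  - by move=> x x1; have [] := dF x x1.
  - by apply: cvg_at_right_filter; apply: cvgN; exact: (cV 1).
  - by move=> x; rewrite in_itv/= andbT => x1; rewrite derive1E; apply: derive_val; exact: dF.
have p0 : 0 < 2 ^- k.+1 :> R by rewrite invr_gt0 exprn_gt0.
apply: (@le_trans _ _ (\int[mu]_(y in cone_heights k.+1) ((2 ^+ k.+1) ^+ 2)%:E)%E).
  apply: ge0_le_integral => //=.
    by apply/measurable_EFinP; apply: measurable_funTS; exact: measurable_invr_sqr.
  move=> y; rewrite in_itv/= => /andP[h _]; rewrite lee_fin -exprVn lerXn2r ?nnegrE//.
  - by rewrite invr_ge0; apply: ltW; apply: lt_trans h.
  - by rewrite -[leRHS]invrK lef_pV2 ?posrE ?(ltW h)//; exact: lt_trans h.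
rewrite integral_cst//= lebesgue_measure_itv/= lte_fin.
rewrite ltf_pV2 ?posrE ?exprn_gt0// ltr_eXn2l ?ltr1n// ltnSn -EFinB -EFinM lee_fin.
have -> : (2 : R) ^+ k.+1 = 2 * 2 ^+ k by rewrite exprS.
have e0 : (2 : R) ^+ k != 0 by rewrite expf_neq0.
by rewrite le_eqVlt; apply/orP; left; apply/eqP; field.
Qed.

Lemma measurable_ekappa j u D :
  measurable_fun D (fun y => (Num.max 0 (cone_width j y - u) * (y ^+ 2)^-1)%:E).
Proof.
apply/measurable_EFinP; apply: measurable_funTS; apply: measurable_funM; last exact: measurable_invr_sqr.
apply: measurable_maxr => //; apply: measurable_funB => //; exact: measurable_cone_width.
Qed.

Lemma ekappa_ge0 j u : (0 <= ekappa j u)%E.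
Proof.
apply: integral_ge0 => y _; rewrite lee_fin mulr_ge0 ?invr_ge0 ?sqr_ge0//.
by rewrite le_max lexx.
Qed.

(** From level 1 on the integrand is y times y^-2, so every level adds ln 2 to the variance. This
    makes the p-th moment of the density a power of 2^k. *)
Lemma ekappa0_le j : (ekappa j 0 <= (if j is _.+1 then ln 2 else 1)%:E)%E.
Proof.
case: j => [|k].
  apply: le_trans (mass_cone_heights_le 0); rewrite /ekappa.
  by under eq_integral do rewrite /= subr0 max_r// mul1r.
have p0 j : 0 < 2 ^- j :> R by rewrite invr_gt0 exprn_gt0.
have ab : 2 ^- k.+1 < 2 ^- k :> R.
  by rewrite ltf_pV2 ?posrE ?exprn_gt0// ltr_eXn2l ?ltr1n.
have cV (x : R) : 0 < x -> {for x, continuous (fun x : R => x^-1)}.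
  by move=> x0; apply: inv_continuous; rewrite gt_eqF.
have cI : {within `[2 ^- k.+1, 2 ^- k], continuous (fun x : R => x^-1)}.
  apply: continuous_in_subspaceT => x; rewrite inE/= in_itv/= => /andP[h _].
  by apply: cV; exact: lt_le_trans h.
apply: (@le_trans _ _ (\int[mu]_(y in `[(2 ^- k.+1)%R, (2 ^- k)%R]) (y^-1)%:E)%E).
  have -> : ekappa k.+1 0 = (\int[mu]_(y in cone_heights k.+1) (y^-1)%:E)%E.
    apply: eq_integral => y; rewrite inE => /cone_heights_gt0 y0; congr (_%:E).
    by rewrite subr0 /= max_r ?(ltW y0)//; field; rewrite gt_eqF.
  apply: ge0_subset_integral => //=.
  - apply/measurable_EFinP; exact: subspace_continuous_measurable_fun cI.
  - by move=> y; rewrite in_itv/= => /andP[h _]; rewrite lee_fin invr_ge0 (le_trans _ h)// ltW.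
  - by move=> y /=; rewrite !in_itv/= => /andP[/ltW -> ->].
have cln (x : R) : 0 < x -> ln y @[y --> x] --> ln x by exact: continuous_ln.
rewrite (@continuous_FTC2 _ (fun x : R => x^-1) (@ln R) _ _ ab cI).
- rewrite -EFinB lee_fin -ln_div ?posrE//.
  rewrite (_ : 2 ^- k / 2 ^- k.+1 = 2 :> R)// exprS; field.
  by rewrite expf_neq0.
- split.
  + by move=> x; rewrite in_itv/= => /andP[h _]; apply: ex_derive; apply: is_derive1_ln; exact: lt_trans h.
  + by apply: cvg_at_right_filter; exact: cln.
  + by apply: cvg_at_left_filter; exact: cln.
- move=> x; rewrite in_itv/= => /andP[h _]; rewrite derive1E; apply: derive_val.
  by apply: is_derive1_ln; exact: lt_trans h.
Qed.

Lemma ekappa_lip j u v :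
  (ekappa j u <= ekappa j v + (2 ^+ j * `|u - v|)%:E)%E.
Proof.
have m2 D : measurable_fun D (fun y : R => ((y ^+ 2)^-1)%:E).
  by apply/measurable_EFinP; apply: measurable_funTS; exact: measurable_invr_sqr.
have mH := measurable_cone_heights j.
have i0 (y : R) : 0 <= (y ^+ 2)^-1 by rewrite invr_ge0 sqr_ge0.
apply: (@le_trans _ _ (ekappa j v + `|u - v|%:E *
    \int[mu]_(y in cone_heights j) ((y ^+ 2)^-1)%:E)%E); last first.
  rewrite leeD2l// mulrC EFinM lee_wpmul2l ?lee_fin//; exact: mass_cone_heights_le.
pose f2 (y : R) := (`|u - v| * (y ^+ 2)^-1)%:E.
have mf2 D : measurable_fun D f2.
  apply/measurable_EFinP; apply: measurable_funM => //.
  by apply: measurable_funTS; exact: measurable_invr_sqr.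
have E2 : (`|u - v|%:E * \int[mu]_(y in cone_heights j) ((y ^+ 2)^-1)%:E =
    \int[mu]_(y in cone_heights j) f2 y)%E.
  rewrite -ge0_integralZl//.
  - exact: m2.
  - by move=> y _; rewrite lee_fin.
pose f1 (y : R) := (Num.max 0 (cone_width j y - v) * (y ^+ 2)^-1)%:E.
have f10 y : (0 <= f1 y)%E by rewrite lee_fin mulr_ge0// le_max lexx.
have f20 y : (0 <= f2 y)%E by rewrite lee_fin mulr_ge0.
have E1 : (ekappa j v + \int[mu]_(y in cone_heights j) f2 y =
    \int[mu]_(y in cone_heights j) (f1 y + f2 y))%E.
  by rewrite ge0_integralD//; [exact: measurable_ekappa|exact: mf2].
rewrite E2 E1; apply: ge0_le_integral => //.
- by move=> y _; rewrite lee_fin mulr_ge0// le_max lexx.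
- exact: measurable_ekappa.
- by apply: emeasurable_funD; [exact: measurable_ekappa|exact: mf2].
move=> y _; rewrite /f1 /f2 -EFinD lee_fin -mulrDl ler_wpM2r//.
rewrite ge_max; apply/andP; split; first by rewrite addr_ge0// le_max lexx.
have : cone_width j y - v <= Num.max 0 (cone_width j y - v) by rewrite le_max lexx orbT.
have := ler_norm (v - u); rewrite distrC.
by lra.
Qed.

Definition kappa j u : R := fine (ekappa j u).

Lemma kappaE j u : 0 <= u -> ekappa j u = (kappa j u)%:E.
Proof.
move=> u0; rewrite fineK// ge0_fin_numE ?ekappa_ge0//.
apply: le_lt_trans (ekappa_lip j u 0) _; rewrite lte_add_pinfty ?ltry//.
by apply: le_lt_trans (ekappa0_le j) _; rewrite ltry.
Qed.

Lemma kappa0_le j : kappa j 0 <= if j is _.+1 then ln 2 else 1.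
Proof. by rewrite -lee_fin -kappaE//; exact: ekappa0_le. Qed.

Lemma kappa_lip j u v : 0 <= u -> 0 <= v ->
  `|kappa j u - kappa j v| <= 2 ^+ j * `|u - v|.
Proof.
move=> u0 v0; have h (a b : R) : 0 <= a -> 0 <= b -> kappa j a <= kappa j b + 2 ^+ j * `|a - b|.
  by move=> a0 b0; rewrite -lee_fin EFinD -!kappaE//; exact: ekappa_lip.
have h1 := h u v u0 v0; have h2 := h v u v0 u0.
rewrite distrC in h2; rewrite ler_norml; apply/andP; split; lra.
Qed.

(** No section at level j is wider than 2 times 2^-j, so cones at this distance are disjoint. *)
Lemma kappa_far j u : 2 * 2 ^- j <= u -> kappa j u = 0.
Proof.
move=> ju; rewrite /kappa /ekappa integral0_eq// => y hy.
rewrite max_l ?mul0r// subr_le0; apply: le_trans ju.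
case: j hy => [|k]; rewrite /=; first by rewrite expr0 invr1; lra.
rewrite in_itv/= => /andP[_ h]; rewrite exprS invfM mulrA mulfV// mul1r//.
Qed.

End cone_geometry.
Section noise_fields.
Context (R : realType) d (T : measurableType d) (P : probability T R).
Variables (W : set (R * R) -> {RV P >-> R}) (wnW : white_noise W).
Implicit Types (t s u v : R) (i j l : nat).

Definition noise_span : set (T -> R) := [set L | exists n (A : 'I_n -> set (R * R)) (a : 'I_n -> R),
  (forall i : 'I_n, finite_control (A i)) /\ L = (fun w => \sum_(i < n) a i * W (A i) w)].

Lemma gaussian_noise_span : gaussian_space P noise_span.
Proof.
split.
- move=> _ [n [A [a [_ ->]]]]; apply: measurable_sum => i.
  by apply: measurable_funM => //; exact: measurable_funP.
- exists 0, (fun=> set0), (fun=> 0); split; first by case.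
  by apply/funext => w; rewrite big_ord0.
- move=> _ _ [n [A [a [fA ->]]]] [m [B [b [fB ->]]]].
  exists (n + m)%N, (fun i : 'I_(n + m) => match fintype.split i with inl i => A i | inr i => B i end),
    (fun i : 'I_(n + m) => match fintype.split i with inl i => a i | inr i => b i end); split.
    by move=> i; case: (fintype.split i) => j; [exact: fA|exact: fB].
  apply/funext => w; rewrite big_split_ord/=; congr (_ + _); apply: eq_bigr => i _.
    by rewrite (unsplitK (inl i)).
  by rewrite (unsplitK (inr i)).
- move=> c _ [n [A [a [fA ->]]]]; exists n, A, (fun i : 'I_n => c * a i); split => //.
  by apply/funext => w; rewrite mulr_sumr; apply: eq_bigr => i _; rewrite mulrA.
- by move=> _ [n [A [a [fA ->]]]]; exact: white_noise_gaussian wnW _ _ _ fA.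
Qed.

Lemma finite_control_cone j t : finite_control (cone j t).
Proof.
split; [exact: measurable_cone|exact: cone_half_plane|].
rewrite -(setIid (cone j t)) control_measure_coneI subrr normr0 kappaE//.
exact: ltry.
Qed.

(** Built from [W], so that finite combinations belong to [noise_span] for every outcome; the
    versions [phi] agree with it only almost surely at each time. *)
Definition cone_field j t : T -> R := W (cone j t).

Lemma noise_span_cone j t : noise_span (cone_field j t).
Proof.
exists 1, (fun=> cone j t), (fun=> 1); split; first by move=> _; exact: finite_control_cone.
by apply/funext => w; rewrite big_ord1 mul1r.
Qed.

Lemma cov_cone_field i j t s :
  cov P (cone_field i t) (cone_field j s) = if i == j then kappa j `|t - s| else 0.
Proof.
have := white_noise_cov wnW (finite_control_cone i t) (finite_control_cone j s).
rewrite unlock /cov => ->; case: eqP => [->|ij].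
  by rewrite control_measure_coneI kappaE.
have -> : cone i t `&` cone j s = set0.
  rewrite -subset0 => z []; rewrite !coneE => -[hi _] [hj _].
  by apply: ij; exact: cone_heights_disjoint hi hj.
by rewrite /control_measure integral_set0.
Qed.

Definition log_field l t w : R := \sum_(j <- iota 0 l) cone_field j t w.

Definition log_cov l u : R := \sum_(j <- iota 0 l) kappa j u.

Lemma noise_span_log l t : noise_span (log_field l t).
Proof. by apply: (gs_sum gaussian_noise_span) => j; exact: noise_span_cone. Qed.

Lemma log_fieldS l t w : log_field l.+1 t w = log_field l t w + cone_field l t w.
Proof. by rewrite /log_field -addn1 iotaD big_cat/= big_seq1. Qed.

Lemma cov_log_cone l i t s :
  cov P (log_field l t) (cone_field i s) = if (i < l)%N then kappa i `|t - s| else 0.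
Proof.
rewrite (cov_suml gaussian_noise_span); last 2 first.
- by move=> j; exact: noise_span_cone.
- exact: noise_span_cone.
under eq_bigr do rewrite cov_cone_field.
rewrite -big_mkcond/=; case: ifPn => il.
  rewrite -big_filter (_ : [seq j <- iota 0 l | j == i] = [:: i]) ?big_seq1//.
  rewrite (eq_filter (a2 := pred1 i))// filter_pred1_uniq ?iota_uniq//.
  by rewrite mem_iota.
rewrite big1_seq// => j /andP[/eqP ->]; rewrite mem_iota add0n => /andP[_].
by rewrite (negbTE il).
Qed.

Lemma cov_log_field l t s : cov P (log_field l t) (log_field l s) = log_cov l `|t - s|.
Proof.
rewrite covC (cov_suml gaussian_noise_span); last 2 first.
- by move=> j; exact: noise_span_cone.
- exact: noise_span_log.
apply: eq_big_seq => j; rewrite mem_iota add0n => /andP[_ jl].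
by rewrite covC cov_log_cone jl.
Qed.

End noise_fields.

Section log_covariance.
Context (R : realType).
Implicit Types (u v : R) (l : nat).

Lemma log_cov0_le l : log_cov l (0 : R) <= 1 + l%:R * ln 2.
Proof.
have ln2 : 0 <= ln 2 :> R by rewrite ln_ge0// ler1n.
have h j : kappa j 0 <= (j == 0)%:R + ln 2 :> R.
  by apply: le_trans (kappa0_le _ _) _; case: j => [|j]; rewrite ?lerDl ?add0r.
rewrite /log_cov; case: l => [|l]; first by rewrite big_nil mul0r addr0.
rewrite /= big_cons; apply: (@le_trans _ _ (1 + ln 2 + \sum_(j <- iota 1 l) ln 2)).
  apply: lerD; first by have := h 0%N.
  rewrite big_seq [leRHS]big_seq; apply: ler_sum => j; rewrite mem_iota => /andP[j1 _].
  by have := h j; rewrite gtn_eqF// add0r.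
by rewrite big_const_seq iter_addr_0 count_predT size_iota -addrA -mulrS mulr_natl.
Qed.

(** The Lipschitz constants 2^j of the levels j < l add up to less than 2^l. *)
Lemma log_cov_lip l u v : 0 <= u -> 0 <= v ->
  `|log_cov l u - log_cov l v| <= 2 ^+ l * `|u - v|.
Proof.
move=> u0 v0; elim: l => [|l ih].
  by rewrite /log_cov !big_nil subrr normr0 expr0 mul1r.
have E w : log_cov l.+1 w = log_cov l w + kappa l w.
  by rewrite /log_cov -addn1 iotaD big_cat/= big_seq1.
rewrite !E opprD addrACA; apply: le_trans (ler_normD _ _) _.
by have := kappa_lip l u0 v0; rewrite exprS; lra.
Qed.

End log_covariance.
(** * Moments of one block *)

Section power_sums.
Context (R : realType).
Implicit Types (q x m c : R).

(** Bernoulli's inequality, obtained by raising its concave form with exponent 1/q to the power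
    q. *)
Lemma powR_1D_convex q x : 1 <= q -> -1 <= x -> 1 + q * x <= (1 + x) `^ q.
Proof.
move=> q1 x1; have q0 : 0 < q by lra.
have [h|h] := ltP (1 + q * x) 0; first by apply: (le_trans (ltW h)); rewrite powR_ge0.
have t01 : 0 < q^-1 <= 1 by rewrite invr_gt0 q0 invf_le1.
have := @powR_1D_concave R q^-1 (q * x) t01.
rewrite mulKf ?gt_eqF// => /(_ _)/wrap[]; first by lra.
move=> h1; have -> : 1 + q * x = ((1 + q * x) `^ q^-1) `^ q.
  by rewrite -powRrM mulVf ?gt_eqF// powRr1.
by apply: ge0_ler_powR; rewrite ?nnegrE ?powR_ge0 ?(ltW q0)//; lra.
Qed.

Lemma powR_tangent_convex q x m : 1 <= q -> 0 <= x -> 0 < m ->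
  m `^ q + q * m `^ (q - 1) * (x - m) <= x `^ q.
Proof.
move=> q1 x0 m0; have q0 : 0 < q by lra.
have xE : x = m * (1 + (x / m - 1)) by field; rewrite gt_eqF.
have u1 : -1 <= x / m - 1 by rewrite lerBrDl subrr divr_ge0// ltW.
rewrite [in leRHS]xE powRM ?(ltW m0)//; last by lra.
apply: (@le_trans _ _ (m `^ q * (1 + q * (x / m - 1)))).
  rewrite le_eqVlt; apply/orP; left; apply/eqP.
  rewrite -(mulr_powRB1 (ltW m0) q0); field.
  by rewrite gt_eqF.
by rewrite ler_wpM2l ?powR_ge0// powR_1D_convex.
Qed.

(** Jensen's inequality: every term is compared with the tangent of t^q at the mean [m], and the
    linear parts cancel in the sum. *)
Lemma powR_sum_le (I : Type) (s : seq I) q (a : I -> R) : 1 <= q ->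
  (forall i, 0 <= a i) ->
  (\sum_(i <- s) a i) `^ q <= (size s)%:R `^ (q - 1) * \sum_(i <- s) a i `^ q.
Proof.
move=> q1 a0; have q0 : 0 < q by lra.
case: s => [|i0 s]; first by rewrite !big_nil powR0 ?mulr0// gt_eqF.
set r := i0 :: s; pose M : R := (size r)%:R.
have M0 : 0 < M by rewrite ltr0n.
have A0 : 0 <= \sum_(i <- r) a i by apply: sumr_ge0 => i _.
have [Az|Az] := eqVneq (\sum_(i <- r) a i) 0.
  by rewrite Az powR0 ?gt_eqF// mulr_ge0 ?powR_ge0// sumr_ge0// => i _; rewrite powR_ge0.
pose m := (\sum_(i <- r) a i) / M.
have m0 : 0 < m by rewrite divr_gt0// lt_neqAle eq_sym Az.
have mE : \sum_(i <- r) a i = M * m by rewrite /m mulrC divfK// gt_eqF.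
have C (c : R) : \sum_(i <- r) c = M * c.
  by rewrite big_const_seq iter_addr_0 count_predT mulr_natl.
clearbody m.
have h : M * m `^ q <= \sum_(i <- r) a i `^ q.
  apply: (@le_trans _ _ (\sum_(i <- r) (m `^ q + q * m `^ (q - 1) * (a i - m)))).
    rewrite big_split/= -mulr_sumr sumrB mE.
    by rewrite !C subrr mulr0 addr0.
  by apply: ler_sum => i _; exact: powR_tangent_convex.
rewrite mE powRM ?(ltW M0) ?(ltW m0)// -(mulr_powRB1 (ltW M0) q0).
by rewrite (mulrC M) -mulrA ler_wpM2l ?powR_ge0.
Qed.

End power_sums.

Section weighted_expectation.
Context d (T : measurableType d) (R : realType) (mu : {measure set T -> \bar R}).
Variables (wt : T -> R) (wt0 : forall w, 0 <= wt w) (mwt : measurable_fun setT wt).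
Implicit Types (f g : T -> R) (q c : R).

(** Expectation under a change of measure that is left unnormalised. The weight will be the p-th
    power of the density at the left end of a block. *)
Definition wexp f : \bar R := (\int[mu]_w (wt w * f w)%:E)%E.

Let mwM f : measurable_fun setT f -> measurable_fun setT (fun w => (wt w * f w)%:E).
Proof. by move=> mf; apply/measurable_EFinP; exact: measurable_funM. Qed.

Lemma le_wexp f g : measurable_fun setT f -> measurable_fun setT g ->
  (forall w, 0 <= f w) -> (forall w, f w <= g w) -> (wexp f <= wexp g)%E.
Proof.
move=> mf mg f0 fg; apply: ge0_le_integralT.
- by move=> w; rewrite lee_fin mulr_ge0.
- exact: mwM.
- exact: mwM.
- by move=> w; rewrite lee_fin ler_wpM2l.
Qed.

Lemma wexpZ c f : measurable_fun setT f -> (forall w, 0 <= f w) -> 0 <= c ->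
  wexp (fun w => c * f w) = (c%:E * wexp f)%E.
Proof.
move=> mf f0 c0; rewrite /wexp -ge0_integralZl//.
- by apply: eq_integral => w _; rewrite -EFinM mulrCA.
- exact: mwM.
- by move=> w _; rewrite lee_fin mulr_ge0.
Qed.

Lemma wexpD f g : measurable_fun setT f -> measurable_fun setT g ->
  (forall w, 0 <= f w) -> (forall w, 0 <= g w) ->
  wexp (fun w => f w + g w) = (wexp f + wexp g)%E.
Proof.
move=> mf mg f0 g0; rewrite /wexp -ge0_integralD//.
- by apply: eq_integral => w _; rewrite -EFinD mulrDr.
- by move=> w _; rewrite lee_fin mulr_ge0.
- exact: mwM.
- by move=> w _; rewrite lee_fin mulr_ge0.
- exact: mwM.
Qed.

Lemma wexp_sum (I : Type) (s : seq I) (f : I -> T -> R) :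
  (forall i, measurable_fun setT (f i)) -> (forall i w, 0 <= f i w) ->
  wexp (fun w => \sum_(i <- s) f i w) = (\sum_(i <- s) wexp (f i))%E.
Proof.
move=> mf f0; elim: s => [|i s ih].
  rewrite big_nil /wexp; under eq_integral do rewrite big_nil mulr0.
  by rewrite integral0.
rewrite big_cons -ih -wexpD//.
- by congr wexp; apply/funext => w; rewrite big_cons.
- exact: measurable_sum.
- by move=> w; exact: sumr_ge0.
Qed.

Lemma wexp_powR_sum_le (I : Type) (s : seq I) q c (a : I -> T -> R) : 1 <= q ->
  0 <= c -> (forall i, measurable_fun setT (a i)) ->
  (forall i, List.In i s -> (wexp (fun w => `|a i w| `^ q)%R <= c%:E)%E) ->
  (wexp (fun w => `|\sum_(i <- s) a i w| `^ q)%R <= ((size s)%:R `^ q * c)%:E)%E.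
Proof.
move=> q1 c0 ma ac; have q0 : 0 < q by lra.
have mp (f : T -> R) : measurable_fun setT f -> measurable_fun setT (fun w => `|f w| `^ q).
  move=> mf; apply: (measurableT_comp (measurable_powR _)).
  exact: measurableT_comp.
apply: (@le_trans _ _ (wexp (fun w => (size s)%:R `^ (q - 1) * \sum_(i <- s) `|a i w| `^ q)%R)).
  apply: le_wexp.
  - by apply: mp; exact: measurable_sum.
  - by apply: measurable_funM => //; apply: measurable_sum => i; exact: mp.
  - by move=> w; rewrite powR_ge0.
  - move=> w; apply: (le_trans _ (@powR_sum_le _ _ s q (fun i => `|a i w|) q1 (fun i => normr_ge0 _))).
    apply: ge0_ler_powR; rewrite ?nnegrE ?(ltW q0)//; first by apply: sumr_ge0.
    exact: ler_norm_sum.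
rewrite wexpZ ?powR_ge0//; last 2 first.
- by apply: measurable_sum => i; exact: mp.
- by move=> w; apply: sumr_ge0 => i _; rewrite powR_ge0.
rewrite wexp_sum//; last by move=> i; exact: mp.
have h : (\sum_(i <- s) wexp (fun w => `|a i w| `^ q)%R <= ((size s)%:R * c)%:E)%E.
  elim: s ac => [|i s ih] ac; first by rewrite big_nil mul0r.
  rewrite big_cons -natr1 mulrDl mul1r addrC EFinD; apply: leeD.
    by apply: ih => j js; apply: ac; right.
  by apply: ac; left.
case: s ac h => [_ _|i s ac h].
  by rewrite big_nil mule0 lee_fin mulr_ge0// powR_ge0.
apply: (le_trans (lee_wpmul2l _ h)); first by rewrite lee_fin powR_ge0.
by rewrite -EFinM lee_fin mulrA -(mulrC (size (i :: s))%:R) mulr_powRB1.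
Qed.

End weighted_expectation.
Section block_moments.
Context (R : realType) d (T : measurableType d) (P : probability T R).
Variables (W : set (R * R) -> {RV P >-> R}) (wnW : white_noise W).
Variables (g p q : R) (l k : nat) (t0 : R).
Hypotheses (g0 : 0 < g) (p0 : 0 < p) (q2 : 2 < q) (lk : (l <= k.+2)%N).
Implicit Types t s : R.
Local Notation Phi := (log_field W l).
Local Notation G := (noise_span W).
Let gsG := gaussian_noise_span wnW.
Let V : R := log_cov l 0.
Let q0 : 0 < q. Proof. exact: lt_trans q2. Qed.

Definition chaos t w : R := expR (g * Phi t w - g ^+ 2 / 2 * log_cov l 0).

Definition chaos_ratio t w : R := expR (g * (Phi t w - Phi t0 w)).

Definition chaos_weight w : R := chaos t0 w `^ p.

(** The p-th moment of [chaos] at any time, hence the total mass of [chaos_weight]. *)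
Definition chaos_moment : R := expR (g ^+ 2 * (p ^+ 2 - p) / 2 * log_cov l 0).

Let E0 := chaos_moment.

Lemma chaosE t w : chaos t w = chaos t0 w * chaos_ratio t w.
Proof. by rewrite /chaos /chaos_ratio -expRD; congr expR; ring. Qed.

Lemma chaos_weightE w : chaos_weight w =
  expR (- (p * (g ^+ 2 / 2 * V))) * expR (p * g * Phi t0 w).
Proof. by rewrite /chaos_weight /chaos -expRM -expRD; congr expR; rewrite -/V; ring. Qed.

Lemma chaos_weight_ge0 w : 0 <= chaos_weight w.
Proof. exact: powR_ge0. Qed.

Let mPhi t : measurable_fun setT (Phi t).
Proof. exact: (gs_measurable gsG (noise_span_log wnW l t)). Qed.

Lemma measurable_chaos t : measurable_fun setT (chaos t).
Proof.
apply: measurableT_comp => //; apply: measurable_funB => //.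
exact: measurable_funM.
Qed.

Lemma measurable_chaos_ratio t : measurable_fun setT (chaos_ratio t).
Proof.
apply: measurableT_comp => //; apply: measurable_funM => //.
exact: measurable_funB.
Qed.

Lemma measurable_chaos_weight : measurable_fun setT chaos_weight.
Proof. exact: (measurableT_comp (measurable_powR _) (measurable_chaos t0)). Qed.

Local Notation wE := (wexp P chaos_weight).

(** Cameron-Martin shift: under the weight, Y acquires the mean p g cov(Phi t0, Y) and keeps its
    variance. *)
Lemma wexp_expR_le (Y : T -> R) (c1 c2 : R) : G Y -> `|cov P (Phi t0) Y| <= c1 ->
  cov P Y Y <= c2 ->
  (wE (fun w => expR (Y w))%R <= (chaos_moment * expR (p * g * c1 + c2 / 2))%:E)%E.
Proof.
move=> GY hc1 hc2; have GPhi := noise_span_log wnW l t0.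
have GL : G (fun w => (p * g) * Phi t0 w + Y w) by apply: (gsD gsG) => //; exact: (gsZ gsG).
have [_ _ eL] := gs_moments gsG GL.
have -> : wE (fun w => expR (Y w)) =
    ((expR (- (p * (g ^+ 2 / 2 * V))))%:E * \int[P]_w (expR ((p * g) * Phi t0 w + Y w))%:E)%E.
  rewrite -ge0_integralZl//.
  - apply: eq_integral => w _; rewrite chaos_weightE -EFinM; congr (_%:E).
    by rewrite -mulrA -expRD.
  - apply/measurable_EFinP; apply: measurableT_comp => //.
    exact: (gs_measurable gsG GL).
rewrite eL -EFinM lee_fin -expRD /chaos_moment -expRD ler_expR.
have GpPhi : G (fun w => p * g * Phi t0 w) by exact: (gsZ gsG).
rewrite (covDl gsG GpPhi GY GL) (covDr gsG GpPhi GpPhi GY) (covDr gsG GY GpPhi GY).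
rewrite (covZl gsG _ GPhi GpPhi) (covZr gsG _ GPhi GPhi) (covZl gsG _ GPhi GY).
rewrite (covZr gsG _ GY GPhi) (covC P Y (Phi t0)).
rewrite (cov_log_field wnW) subrr normr0 -/V.
have h : p * g * cov P (Phi t0) Y <= p * g * c1.
  rewrite ler_wpM2l ?mulr_ge0 ?(ltW p0) ?(ltW g0)//.
  exact: le_trans (ler_norm _) hc1.
move: (cov P _ _) (cov P Y Y) h hc2 => a b h hb; rewrite -subr_ge0.
have -> : g ^+ 2 * (p ^+ 2 - p) / 2 * V + (p * g * c1 + c2 / 2) -
  (- (p * (g ^+ 2 / 2 * V)) + (p * g * (p * g * V) + p * g * a + (p * g * a + b)) / 2)
  = (p * g * c1 - p * g * a) + (c2 - b) / 2 by field.
by rewrite addr_ge0// ?subr_ge0// divr_ge0// subr_ge0.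
Qed.

Lemma noise_span_incr t s : G (fun w => Phi t w - Phi s w).
Proof. by apply: (gsB gsG); exact: (noise_span_log wnW). Qed.

Lemma cov_incr_le t s :
  `|cov P (Phi t0) (fun w => Phi t w - Phi s w)| <= 4 * 2 ^+ k * `|t - s|.
Proof.
rewrite covC (covBl gsG); [|exact: (noise_span_log wnW)..].
rewrite !(cov_log_field wnW); apply: le_trans (log_cov_lip _ _ _) _ => //.
apply: ler_pM => //.
- have -> : 4 * 2 ^+ k = 2 ^+ k.+2 :> R by rewrite !exprS; ring.
  by rewrite ler_eXn2l// ltr1n.
- apply: le_trans (ler_dist_dist _ _) _.
  by rewrite opprB addrA subrK.
Qed.

(** The variance of an increment is twice log_cov l 0 - log_cov l |t - s|, hence linear in the
    distance; this is the source of the order 1/2 of the increments of the density. *)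
Lemma var_incr_le t s :
  cov P (fun w => Phi t w - Phi s w) (fun w => Phi t w - Phi s w) <= 8 * 2 ^+ k * `|t - s|.
Proof.
have Gi := noise_span_incr t s.
rewrite (covBl gsG); [|exact: (noise_span_log wnW)|exact: (noise_span_log wnW)|by []].
rewrite (covC P (Phi t)) (covC P (Phi s)) !(covBl gsG); [|exact: (noise_span_log wnW)..].
rewrite !(cov_log_field wnW) !subrr !normr0 (distrC s t).
have h := @log_cov_lip R l 0 `|t - s| (lexx _) (normr_ge0 _).
rewrite sub0r normrN normr_id in h.
have h2 : 2 ^+ l * `|t - s| <= 2 ^+ k.+2 * `|t - s|.
  by rewrite ler_wpM2r// ler_eXn2l// ltr1n.
rewrite !exprS in h2; have := le_trans (ler_norm _) (le_trans h h2).
by move: (log_cov l 0) (log_cov l `|t - s|) => a b; lra.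
Qed.

(** The exponent of [wexp_expR_le] for q g (Phi t - Phi t0), whose covariance and variance are
    bounded by q g 4 and (q g)^2 8 within the block. *)
Definition ratio_const : R := expR (p * g * (q * g * 4) + (q * g) ^+ 2 * 8 / 2).

Lemma wexp_chaos_ratio t : `|t - t0| <= 2 ^- k ->
  (wE (fun w => chaos_ratio t w `^ q)%R <= (ratio_const * chaos_moment)%:E)%E.
Proof.
move=> tk; have d1 : 2 ^+ k * `|t - t0| <= 1.
  by rewrite mulrC -ler_pdivlMr ?exprn_gt0// mul1r.
have qg0 : 0 <= q * g by rewrite mulr_ge0 ?(ltW g0) ?(ltW q0).
have -> : (fun w => chaos_ratio t w `^ q) = (fun w => expR ((q * g) * (Phi t w - Phi t0 w))).
  by apply/funext => w; rewrite /chaos_ratio -expRM; congr expR; ring.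
rewrite (mulrC ratio_const); apply: wexp_expR_le.
- by apply: (gsZ gsG); exact: noise_span_incr.
- rewrite (covZr gsG); [|exact: (noise_span_log wnW)|exact: noise_span_incr].
  rewrite normrM (ger0_norm qg0) ler_wpM2l//.
  by apply: le_trans (cov_incr_le t t0) _; lra.
- rewrite (covZl gsG) ?(covZr gsG); try exact: noise_span_incr; last by apply: (gsZ gsG); exact: noise_span_incr.
  rewrite mulrA -expr2 ler_wpM2l ?sqr_ge0//.
  by apply: le_trans (var_incr_le t t0) _; lra.
Qed.

Lemma cov_ge0 (Y : T -> R) : 0 <= cov P Y Y.
Proof.
by apply: fine_ge0; apply: integral_ge0 => w _; rewrite lee_fin -expr2 sqr_ge0.
Qed.

Lemma covD_le (Y Z : T -> R) : G Y -> G Z ->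
  cov P (fun w => Y w + Z w) (fun w => Y w + Z w) <= 2 * cov P Y Y + 2 * cov P Z Z.
Proof.
move=> GY GZ; have := cov_ge0 (fun w => Y w - Z w).
rewrite (covBl gsG)//; last exact: (gsB gsG).
rewrite (covC P Y) (covC P Z) !(covBl gsG)// (covC P Z Y).
rewrite (covDl gsG) ?(covDr gsG)//; try exact: (gsD gsG).
rewrite (covC P Z Y).
by move: (cov P Y Y) (cov P Y Z) (cov P Z Z) => a b c; lra.
Qed.

(** The factor 2^q splits a q-th power of a sum, q^q comes from [powR_le_expR], 4 counts the
    exponentials in the final majorant, and the exponential bounds the weighted mean of each of
    them. *)
Definition incr_const : R := (2 * q) `^ q * 4 *
  expR (p * g * (4 * g + 4 * q * g) + (16 * g ^+ 2 + 16 * (q * g) ^+ 2) / 2).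

Lemma expR_diff_le (a b : R) : `|expR a - expR b| <= `|a - b| * (expR a + expR b).
Proof.
wlog ab : a b / b <= a.
  move=> h; have [|/ltW] := leP b a; first exact: h.
  by move=> ab; rewrite distrC (distrC a) (addrC (expR a)); exact: h.
rewrite !ger0_norm ?subr_ge0 ?ler_expR//.
have h : 1 + (b - a) <= expR (b - a) by exact: expR_ge1Dx.
have hb : expR b = expR a * expR (b - a) by rewrite -expRD; congr expR; ring.
have : expR a * (1 + (b - a)) <= expR a * expR (b - a) by rewrite ler_wpM2l ?expR_ge0.
have : 0 <= (a - b) * expR b by rewrite mulr_ge0 ?expR_ge0// subr_ge0.
rewrite -hb; lra.
Qed.

(** From |z|/q <= e^(|z|/q). It turns powers of Gaussian increments into exponentials, the only
    functions whose weighted means are computed. *)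
Lemma powR_le_expR (z : R) : `|z| `^ q <= q `^ q * (expR z + expR (- z)).
Proof.
apply: (@le_trans _ _ (q `^ q * expR `|z|)).
  have -> : expR `|z| = expR (`|z| / q) `^ q by rewrite -expRM divfK// gt_eqF.
  rewrite -powRM ?expR_ge0 ?(ltW q0)//.
  apply: ge0_ler_powR; rewrite ?nnegrE ?mulr_ge0 ?expR_ge0 ?(ltW q0)//.
  apply: (@le_trans _ _ (q * (`|z| / q))); first by rewrite mulrC divfK// gt_eqF.
  rewrite ler_wpM2l ?(ltW q0)//.
  by apply: le_trans (expR_ge1Dx _); rewrite lerDr.
rewrite ler_wpM2l ?powR_ge0//.
have [z0|z0] := leP 0 z; first by rewrite ger0_norm// lerDl expR_ge0.
by rewrite ltr0_norm// lerDr expR_ge0.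
Qed.

Lemma wexp_chaos_incr t s : `|t - t0| <= 2 ^- k -> `|s - t0| <= 2 ^- k ->
  `|t - s| <= 2 ^- k ->
  (wE (fun w => `|chaos_ratio t w - chaos_ratio s w| `^ q)%R <=
   (incr_const * (2 ^+ k * `|t - s|) `^ (q / 2) * chaos_moment)%:E)%E.
Proof.
move=> tk sk tsk; have d1 (u : R) : `|u| <= 2 ^- k -> 2 ^+ k * `|u| <= 1.
  by move=> uk; rewrite mulrC -ler_pdivlMr ?exprn_gt0// mul1r.
have c0 : 0 <= incr_const by rewrite !mulr_ge0 ?powR_ge0 ?expR_ge0.
have m0 : 0 <= chaos_moment by exact: expR_ge0.
have [->|ts] := eqVneq t s.
  rewrite /wexp; under eq_integral do rewrite subrr normr0 powR0 ?gt_eqF// mulr0.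
  by rewrite integral0 lee_fin !mulr_ge0 ?powR_ge0.
have st0 : 0 < `|t - s| by rewrite normr_gt0 subr_eq0.
pose z := 2 ^+ k * `|t - s|; have z0 : 0 < z by rewrite mulr_gt0 ?exprn_gt0.
have z1 : z <= 1 by exact: d1.
(* [sg] is the order of the standard deviation of Phi t - Phi s. Dividing by it leaves a variable
   with bounded exponential moments, and the factor sg^q is the desired power of the distance. *)
pose sg := Num.sqrt z; have sg0 : 0 < sg by rewrite sqrtr_gt0.
have sgE : sg ^+ 2 = z by rewrite sqr_sqrtr// ltW.
have sg1 : sg <= 1 by rewrite -sqrtr1 ler_sqrt.
have sgq : sg `^ q = z `^ (q / 2).
  by rewrite /sg -powR12_sqrt ?(ltW z0)// -powRrM mulrC.
pose Y (e : R) w := e * g / sg * (Phi t w - Phi s w).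
pose Z u w := q * g * (Phi u w - Phi t0 w).
have GY e : G (Y e) by apply: (gsZ gsG); exact: noise_span_incr.
have GZ u : G (Z u) by apply: (gsZ gsG); exact: noise_span_incr.
have GYZ e u : G (fun w => Y e w + Z u w) by exact: (gsD gsG).
have qg0 : 0 <= q * g by rewrite mulr_ge0 ?(ltW g0) ?(ltW q0).
have bound e u : `|e| = 1 -> `|u - t0| <= 2 ^- k ->
   (wE (fun w => expR (Y e w + Z u w))%R <= (chaos_moment *
     expR (p * g * (4 * g + 4 * q * g) + (16 * g ^+ 2 + 16 * (q * g) ^+ 2) / 2))%:E)%E.
  move=> e1 uk; have du := d1 _ uk; apply: wexp_expR_le; first exact: GYZ.
  - rewrite (covDr gsG)//; last exact: (noise_span_log wnW).
    rewrite !(covZr gsG); try exact: (noise_span_log wnW); try exact: noise_span_incr.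
    apply: le_trans (ler_normD _ _) _; rewrite !normrM e1 mul1r normfV.
    rewrite (gtr0_norm sg0) (gtr0_norm g0) (gtr0_norm q0); apply: lerD.
      rewrite mulrAC ler_pdivrMr//.
      apply: (@le_trans _ _ (g * (4 * z))).
        by rewrite ler_wpM2l ?(ltW g0)// /z mulrA; exact: cov_incr_le.
      have -> : g * (4 * z) = 4 * g * sg * sg by rewrite -sgE; ring.
      by rewrite ler_piMr// !mulr_ge0 ?(ltW g0) ?(ltW sg0).
    have -> : 4 * q * g = q * g * 4 by ring.
    by rewrite ler_wpM2l//; apply: le_trans (cov_incr_le u t0) _; lra.
  - apply: le_trans (covD_le (GY e) (GZ u)) _; apply: lerD.
      rewrite (covZl gsG); [|exact: noise_span_incr|exact: GY].
      rewrite (covZr gsG); [|exact: noise_span_incr..].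
      have := var_incr_le t s; rewrite -mulrA -/z.
      move: (cov P _ _) => c hc.
      have e2 : e ^+ 2 = 1 by rewrite -(@real_normK _ e) ?num_real// e1 expr1n.
      have -> : 2 * (e * g / sg * (e * g / sg * c)) = e ^+ 2 * (2 * (g ^+ 2 * (c / sg ^+ 2))).
        by field; rewrite gt_eqF.
      have -> : 16 * g ^+ 2 = 2 * (g ^+ 2 * 8) by ring.
      rewrite e2 mul1r ler_wpM2l// ler_wpM2l ?sqr_ge0// sgE.
      by rewrite ler_pdivrMr.
    rewrite (covZl gsG); [|exact: noise_span_incr|exact: GZ].
    rewrite (covZr gsG); [|exact: noise_span_incr..].
    have := var_incr_le u t0; move: (cov P _ _) => c hc.
    have -> : 2 * (q * g * (q * g * c)) = (q * g) ^+ 2 * (2 * c) by ring.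
    by rewrite (mulrC 16) ler_wpM2l ?sqr_ge0//; lra.
have mY (Y' : T -> R) : G Y' -> measurable_fun setT (fun w => expR (Y' w)).
  by move=> GY'; apply: measurableT_comp => //; exact: (gs_measurable gsG GY').
(* Both signs of the normalised increment, from [powR_le_expR], times both end points, from e^a +
   e^b. *)
pose F w := expR (Y 1 w + Z t w) + expR (Y (-1) w + Z t w) +
  (expR (Y 1 w + Z s w) + expR (Y (-1) w + Z s w)).
have F0 w : 0 <= F w by rewrite !addr_ge0 ?expR_ge0.
have mF : measurable_fun setT F.
  by apply: measurable_funD; apply: measurable_funD; exact: mY.
have wt0 := chaos_weight_ge0; have mwt := measurable_chaos_weight.
apply: (@le_trans _ _ (wE (fun w => ((2 * q) `^ q * sg `^ q) * F w)%R)).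
  apply: le_wexp => //.
  - apply: (measurableT_comp (measurable_powR _)); apply: measurableT_comp => //.
    by apply: measurable_funB; exact: measurable_chaos_ratio.
  - exact: measurable_funM.
  - move=> w; set a := g * (Phi t w - Phi t0 w); set b := g * (Phi s w - Phi t0 w).
    apply: (@le_trans _ _ ((`|a - b| * (expR a + expR b)) `^ q)).
      apply: ge0_ler_powR; rewrite ?nnegrE ?(ltW q0)//.
      exact: expR_diff_le.
    have abE : a - b = sg * Y 1 w by rewrite /Y /a /b; field; rewrite gt_eqF.
    have YN : - Y 1 w = Y (-1) w by rewrite /Y; ring.
    have ZE u : expR (Z u w) = expR (g * (Phi u w - Phi t0 w)) `^ q.
      by rewrite -expRM; congr expR; rewrite /Z; ring.
    rewrite abE normrM (gtr0_norm sg0).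
    have eab : 0 <= expR a + expR b by rewrite addr_ge0 ?expR_ge0.
    rewrite (powRM q (mulr_ge0 (ltW sg0) (normr_ge0 _)) eab).
    rewrite (powRM q (ltW sg0) (normr_ge0 _)).
    have hab : (expR a + expR b) `^ q <= 2 `^ q * (expR (Z t w) + expR (Z s w)).
      have := @norm_powRD_le R q (expR a) (expR b) (ltW q0).
      by rewrite !ger0_norm ?addr_ge0 ?expR_ge0// !ZE.
    apply: (@le_trans _ _ ((sg `^ q * (q `^ q * (expR (Y 1 w) + expR (Y (-1) w)))) *
        (2 `^ q * (expR (Z t w) + expR (Z s w))))).
      apply: ler_pM => //; rewrite ?mulr_ge0 ?powR_ge0//.
      by rewrite ler_wpM2l ?powR_ge0// -YN; exact: powR_le_expR.
    rewrite /F !expRD powRM ?(ltW q0)// le_eqVlt; apply/orP; left; apply/eqP.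
    by move: (expR _) (expR _) (expR _) (expR _) (sg `^ q) (q `^ q) (2 `^ q) => *; ring.
rewrite wexpZ//; last by rewrite mulr_ge0 ?powR_ge0.
have WF : (wE F <= (4 * (chaos_moment *
     expR (p * g * (4 * g + 4 * q * g) + (16 * g ^+ 2 + 16 * (q * g) ^+ 2) / 2)))%:E)%E.
  have N1 : `|1 : R| = 1 by rewrite normr1.
  have N2 : `|-1 : R| = 1 by rewrite normrN normr1.
  rewrite /F !wexpD//; do ?[by apply: measurable_funD; exact: mY| exact: mY| by move=> w; rewrite ?addr_ge0// ?expR_ge0].
  have -> (c : R) : ((4 * c)%:E = (c%:E + c%:E) + (c%:E + c%:E))%E.
    by rewrite -!EFinD; congr (_%:E); ring.
  by apply: leeD; apply: leeD; exact: bound.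
apply: (le_trans (lee_wpmul2l _ WF)); first by rewrite lee_fin mulr_ge0 ?powR_ge0.
rewrite -EFinM lee_fin sgq /incr_const -/z le_eqVlt; apply/orP; left; apply/eqP.
by move: (expR _) chaos_moment ((2 * q) `^ q) (z `^ _) => *; ring.
Qed.

End block_moments.

(** * Oscillating sums and the half-period shift *)

Section antiperiodic_sums.
Context (R : realType).
Implicit Types (c r : nat -> R) (a h M : nat).

Lemma big_iota_shift a h M (F : nat -> R) :
  \sum_(i <- iota (a + h) M) F i = \sum_(i <- iota a M) F (i + h)%N.
Proof.
by rewrite addnC iotaDl big_map; apply: eq_bigr => i _; rewrite addnC.
Qed.

(* Averaging the sum with its translate by half a period h. *)
Lemma antiperiodic_sum c r a h M : (h <= M)%N -> (forall i, c (i + h)%N = - c i) ->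
  2 * \sum_(i <- iota a M) c i * r i =
  \sum_(i <- iota a h) c i * r i + \sum_(i <- iota (a + (M - h)) h) c i * r i
    + \sum_(i <- iota a (M - h)) c i * (r i - r (i + h)%N).
Proof.
move=> hM ch.
have e1 : \sum_(i <- iota a M) c i * r i =
    \sum_(i <- iota a h) c i * r i - \sum_(i <- iota a (M - h)) c i * r (i + h)%N.
  rewrite -{1}(subnKC hM) iotaD big_cat/= big_iota_shift; congr (_ + _).
  by rewrite -sumrN; apply: eq_bigr => i _; rewrite ch mulNr.
have e2 : \sum_(i <- iota a M) c i * r i =
    \sum_(i <- iota a (M - h)) c i * r i + \sum_(i <- iota (a + (M - h)) h) c i * r i.
  by rewrite -{1}(subnK hM) iotaD big_cat.
have e3 : \sum_(i <- iota a (M - h)) c i * (r i - r (i + h)%N) =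
   \sum_(i <- iota a (M - h)) c i * r i - \sum_(i <- iota a (M - h)) c i * r (i + h)%N.
  by rewrite -sumrB; apply: eq_bigr => i _; rewrite mulrBr.
rewrite e3 mulr_natl mulr2n {1}e1 e2; ring.
Qed.

End antiperiodic_sums.

Section weighted_antiperiodic.
Context d (T : measurableType d) (R : realType) (mu : {measure set T -> \bar R}).
Variables (wt : T -> R) (wt0 : forall w, 0 <= wt w) (mwt : measurable_fun setT wt).
Variables (q : R) (q1 : 1 <= q) (r : nat -> T -> R) (c : nat -> R).
Hypotheses (mr : forall i, measurable_fun setT (r i)) (c1 : forall i, `|c i| <= 1).
Local Notation wE := (wexp mu wt).

Let mcr i : measurable_fun setT (fun w => c i * r i w).
Proof. exact: measurable_funM. Qed.

Lemma measurable_norm_powR (f : T -> R) : measurable_fun setT f ->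
  measurable_fun setT (fun w => `|f w| `^ q).
Proof.
move=> mf; apply: (measurableT_comp (measurable_powR _)).
exact: measurableT_comp.
Qed.

Lemma wexp_coef_sum_le (s : seq nat) (C : R) : 0 <= C ->
  (forall i, List.In i s -> (wE (fun w => `|r i w| `^ q)%R <= C%:E)%E) ->
  (wE (fun w => `|\sum_(i <- s) c i * r i w| `^ q)%R <= ((size s)%:R `^ q * C)%:E)%E.
Proof.
move=> C0 hC; apply: (wexp_powR_sum_le wt0 mwt q1 C0 mcr) => i si.
apply: le_trans (hC i si).
apply: le_wexp => //; [exact: measurable_norm_powR|exact: measurable_norm_powR|move=> w].
apply: ge0_ler_powR; rewrite ?nnegrE//; first by apply: le_trans q1.
by rewrite normrM ler_piMl.
Qed.

Lemma In_iota a M i : List.In i (iota a M) -> (a <= i < a + M)%N.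
Proof.
elim: M a => [//|M ih] a /= [<-|]; first by rewrite leqnn addnS ltnS leq_addr.
by move/ih => /andP[h1 h2]; rewrite (ltnW h1) -addSnnS.
Qed.

(** The first and the last half period have no partner and are bounded term by term, with 2 h^q A;
    the remaining terms are increments over a half period. The factor 4^q comes from splitting a
    q-th power twice. *)
Lemma wexp_antiperiodic_le a h M (A B : R) : (h <= M)%N -> 0 <= A -> 0 <= B ->
  (forall i, c (i + h)%N = - c i) ->
  (forall i, (a <= i < a + M)%N -> (wE (fun w => `|r i w| `^ q)%R <= A%:E)%E) ->
  (forall i, (a <= i)%N -> (i + h < a + M)%N ->
    (wE (fun w => `|r i w - r (i + h)%N w| `^ q)%R <= B%:E)%E) ->
  (wE (fun w => `|\sum_(i <- iota a M) c i * r i w| `^ q)%R <=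
    (4 `^ q * (2 * (h%:R `^ q * A) + M%:R `^ q * B))%:E)%E.
Proof.
move=> hM A0 B0 ch hA hB; have q0 : 0 <= q by exact: le_trans q1.
pose S w := \sum_(i <- iota a M) c i * r i w.
pose S1 w := \sum_(i <- iota a h) c i * r i w.
pose S2 w := \sum_(i <- iota (a + (M - h)) h) c i * r i w.
pose S3 w := \sum_(i <- iota a (M - h)) c i * (r i w - r (i + h)%N w).
have mS1 : measurable_fun setT S1 by apply: measurable_sum.
have mS2 : measurable_fun setT S2 by apply: measurable_sum.
have md i : measurable_fun setT (fun w => r i w - r (i + h)%N w).
  exact: measurable_funB.
have mS3 : measurable_fun setT S3 by apply: measurable_sum => i; exact: measurable_funM.
have mS : measurable_fun setT S by apply: measurable_sum.
have le w : `|S w| `^ q <= 4 `^ q * (`|S1 w| `^ q + `|S2 w| `^ q + `|S3 w| `^ q).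
  have SE : 2 * S w = (S1 w + S2 w) + S3 w.
    exact: (@antiperiodic_sum R c (fun i => r i w) a h M hM ch).
  apply: (@le_trans _ _ (`|2 * S w| `^ q)).
    by apply: ge0_ler_powR; rewrite ?nnegrE// normrM ger0_norm// ler_peMl// ler1n.
  rewrite SE; apply: le_trans (norm_powRD_le _ _ q0) _.
  have -> : 4 = 2 * 2 :> R by ring.
  rewrite powRM// -mulrA ler_wpM2l ?powR_ge0// mulrDr.
  apply: lerD; first exact: norm_powRD_le.
  rewrite ler_peMl ?powR_ge0//.
  by rewrite -[leLHS](powRr0 2) ler_powR// ler1n.
apply: (@le_trans _ _ (wE (fun w => 4 `^ q * (`|S1 w| `^ q + `|S2 w| `^ q + `|S3 w| `^ q))%R)).
  apply: le_wexp => //; first exact: measurable_norm_powR.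
  by apply: measurable_funM => //; apply: measurable_funD; [apply: measurable_funD|];
      exact: measurable_norm_powR.
have m12 : measurable_fun setT (fun w => `|S1 w| `^ q + `|S2 w| `^ q).
  by apply: measurable_funD; exact: measurable_norm_powR.
have p12 w : 0 <= `|S1 w| `^ q + `|S2 w| `^ q by rewrite addr_ge0 ?powR_ge0.
rewrite wexpZ ?powR_ge0//; last by apply: measurable_funD => //; exact: measurable_norm_powR.
rewrite EFinM lee_wpmul2l ?lee_fin ?powR_ge0//.
rewrite wexpD//; last exact: measurable_norm_powR.
rewrite wexpD//; [|exact: measurable_norm_powR|exact: measurable_norm_powR].
rewrite EFinD; apply: leeD.
  rewrite mulr_natl mulr2n EFinD; apply: leeD.
    have := @wexp_coef_sum_le (iota a h) A A0; rewrite size_iota; apply.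
    move=> i /In_iota/andP[ai ih]; apply: hA; rewrite ai/= (leq_trans ih)//.
    by rewrite leq_add2l.
  have := @wexp_coef_sum_le (iota (a + (M - h)) h) A A0; rewrite size_iota; apply.
  move=> i /In_iota; rewrite -addnA subnK// => /andP[ai ih]; apply: hA.
  by rewrite ih andbT (leq_trans _ ai)// leq_addr.
apply: (@le_trans _ _ (((M - h)%:R `^ q * B)%:E)); last first.
  rewrite lee_fin ler_wpM2r//; apply: ge0_ler_powR; rewrite ?nnegrE//.
  by rewrite ler_nat leq_subr.
rewrite -[X in X%:R](size_iota a (M - h)).
apply: (wexp_powR_sum_le wt0 mwt q1 B0) => [i|i]; first exact: measurable_funM.
move=> /In_iota/andP[ai ih]; apply: le_trans (hB i ai _); last first.
  by move: ih; rewrite -(ltn_add2r h) -addnA subnK.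
apply: le_wexp => //.
- by apply: measurable_norm_powR; exact: measurable_funM.
- exact: measurable_norm_powR.
- move=> w; apply: ge0_ler_powR; rewrite ?nnegrE//.
  by rewrite normrM ler_piMl.
Qed.

End weighted_antiperiodic.

Section frequency_sum.
Context (R : realType).

(** Beyond P the terms telescope, since 1/(K+1)^2 <= 1/K - 1/(K+1). The induction carries the
    explicit remainder P^2/K, which makes the bound uniform in K. *)
Lemma sum_inv_sqr_le (P K : nat) : (0 < P)%N ->
  \sum_(n < K) (if (n.+1 <= P)%N then 1 else (P%:R / n.+1%:R) ^+ 2) <= 2 * P%:R :> R.
Proof.
move=> P0; have P0' : 0 < P%:R :> R by rewrite ltr0n.
apply: (@le_trans _ _ (if (K <= P)%N then K%:R else 2 * P%:R - P%:R ^+ 2 / K%:R)); last first.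
  case: leqP => KP; last by rewrite gerBl divr_ge0 ?sqr_ge0.
  have : K%:R <= P%:R :> R by rewrite ler_nat.
  by lra.
elim: K => [|K ih]; first by rewrite big_ord0.
rewrite big_ord_recr/=; case: (leqP K.+1 P) ih => KP.
  by rewrite (ltnW KP) -natr1 lerD2r.
have K1 : 0 < K.+1%:R :> R by rewrite ltr0n.
have P1 : P%:R <= K%:R :> R by rewrite ler_nat -ltnS.
have K0 : 0 < K%:R :> R by exact: lt_le_trans P1.
have h : (P%:R / K.+1%:R) ^+ 2 <= P%:R ^+ 2 / K%:R - P%:R ^+ 2 / K.+1%:R :> R.
  have -> : P%:R ^+ 2 / K%:R - P%:R ^+ 2 / K.+1%:R = P%:R ^+ 2 * (K%:R * K.+1%:R)^-1 :> R.
    by rewrite -natr1; field; rewrite !gt_eqF// natr1.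
  rewrite exprMn ler_wpM2l ?sqr_ge0// exprVn lef_pV2 ?posrE ?mulr_gt0 ?exprn_gt0//.
  by rewrite expr2 ler_wpM2r ?ler_nat// ltW.
have : (if (K <= P)%N then K%:R else 2 * P%:R - P%:R ^+ 2 / K%:R) <= 2 * P%:R - P%:R ^+ 2 / K%:R :> R.
  case: leqP => // KP'; have -> : K = P by apply/eqP; rewrite eqn_leq KP' -ltnS.
  by rewrite expr2 mulfK ?gt_eqF//; lra.
move=> h1 ih; apply: le_trans (lerD (le_trans ih h1) h) _.
by rewrite addrA subrK.
Qed.

(** With x = P/n <= 1, the left side is P^(tau q/2) x^(q(1-tau)/2), and the exponent of x is at
    least 2. This is the role of q > 4/(1-tau). *)
Lemma frequency_weight_le (tau q : R) (P n : nat) : 0 <= tau -> 2 < q ->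
  2 <= q * (1 - tau) / 2 -> (0 < P)%N -> (0 < n)%N ->
  n%:R `^ (tau / 2 * q) * (if (n <= P)%N then 1 else (P%:R / n%:R) `^ (q / 2)) <=
  P%:R `^ (tau / 2 * q) * (if (n <= P)%N then 1 else (P%:R / n%:R) ^+ 2) :> R.
Proof.
move=> tau0 q2 tq P0 n0; have tq0 : 0 <= tau / 2 * q by rewrite mulr_ge0 ?divr_ge0//; lra.
have P0' : 0 < P%:R :> R by rewrite ltr0n.
have n0' : 0 < n%:R :> R by rewrite ltr0n.
case: leqP => nP.
  by rewrite !mulr1; apply: ge0_ler_powR; rewrite ?nnegrE ?ler0n ?ler_nat.
set x := P%:R / n%:R; have x0 : 0 < x by rewrite divr_gt0.
have x1 : x <= 1 by rewrite ler_pdivrMr// mul1r ler_nat ltnW.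
have -> : n%:R = P%:R * x^-1 :> R by rewrite /x; field; rewrite !gt_eqF.
rewrite powRM ?invr_ge0 ?(ltW x0) ?(ltW P0')// -mulrA ler_wpM2l ?powR_ge0//.
rewrite -(powR_inv1 (ltW x0)) -powRrM mulN1r -gt0_powRD//.
rewrite -powR_mulrn ?(ltW x0)//; apply: ger_powR; first by rewrite x0.
by lra.
Qed.

End frequency_sum.
Section trigonometric_weights.
Context (R : realType).
Implicit Types (b : bool) (t : R).

(** Real and imaginary parts of the character; indexing by a frequency and a boolean turns the
    complex sequence into a real one. *)
Definition fourier_trig b n t : R :=
  if b then cos (- (2 * pi * n%:R * t)) else sin (- (2 * pi * n%:R * t)).

Lemma fourier_trig_le1 b n t : `|fourier_trig b n t| <= 1.
Proof.
by case: b; rewrite /fourier_trig ler_norml ?cos_geN1 ?cos_le1 ?sin_geN1 ?sin_le1.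
Qed.

Lemma fourier_trig_half b n t : (0 < n)%N ->
  fourier_trig b n (t + (2 * n%:R)^-1) = - fourier_trig b n t.
Proof.
move=> n0; rewrite /fourier_trig.
have -> : - (2 * pi * n%:R * (t + (2 * n%:R)^-1)) = - (2 * pi * n%:R * t) - pi :> R.
  by field; rewrite pnatr_eq0 -lt0n.
have h (x : R) : x = (x - pi) + pi by rewrite subrK.
by case: b; rewrite [in RHS](h (- (2 * pi * n%:R * t))) ?cosDpi ?sinDpi opprK.
Qed.

(** A substitute for Jensen's inequality under a weight that is not a probability. It loses only a
    constant when A^q is of the order of the weighted mean of [a] divided by the total mass. *)
Lemma powR_ratio_le p q A (a : R) : 0 < p <= q -> 0 < A -> 0 <= a ->
  a `^ (p / q) <= A `^ p + A `^ (p - q) * a.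
Proof.
move=> /andP[p0 pq] A0 a0; have q0 : 0 < q by exact: lt_le_trans pq.
have [aA|Aa] := leP a (A `^ q).
  apply: (@le_trans _ _ ((A `^ q) `^ (p / q))).
    by apply: ge0_ler_powR; rewrite ?nnegrE ?divr_ge0 ?(ltW p0) ?(ltW q0)// powR_ge0.
  by rewrite -powRrM mulrCA divff ?gt_eqF// mulr1 lerDl mulr_ge0 ?powR_ge0.
have Aq : 0 < A `^ q by rewrite powR_gt0.
have ap := lt_trans Aq Aa.
apply: (@le_trans _ _ (A `^ (p - q) * a)); last by rewrite lerDr powR_ge0.
have -> : p / q = (p / q - 1) + 1 by ring.
rewrite gt0_powRD// powRr1// ler_wpM2r//.
have -> : p / q - 1 = - ((q - p) / q) by field; rewrite gt_eqF.
rewrite powRN -(opprB q p) powRN lef_pV2 ?posrE ?powR_gt0//.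
have -> : A `^ (q - p) = (A `^ q) `^ ((q - p) / q).
  by rewrite -powRrM mulrCA divff ?gt_eqF// mulr1.
by apply: ge0_ler_powR; rewrite ?nnegrE ?divr_ge0 ?subr_ge0 ?(ltW q0)// ?(ltW Aq) ?(ltW Aa) ?(ltW ap).
Qed.

End trigonometric_weights.

Section frequency_estimate.
Context (R : realType) d (T : measurableType d) (P : probability T R).
Variables (W : set (R * R) -> {RV P >-> R}) (wnW : white_noise W).
Variables (g p q : R) (l k N M b : nat).
Hypotheses (g0 : 0 < g) (p0 : 0 < p) (q2 : 2 < q) (lk : (l <= k.+2)%N).
Hypotheses (M0 : (0 < M)%N) (NE : N = (2 ^ k * M)%N).
Local Notation grid i := (i%:R / N%:R : R).
Let t0 : R := grid (b * M)%N.
Local Notation wE := (wexp P (chaos_weight W g p l t0)).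
Let E0 : R := chaos_moment g p l.
Let q1 : 1 <= q. Proof. by move: q2 => h; lra. Qed.
Let q0 : 0 < q. Proof. by move: q2 => h; lra. Qed.

Let N0 : 0 < N%:R :> R.
Proof. by rewrite ltr0n NE muln_gt0 expn_gt0. Qed.

Let MN : M%:R / N%:R = 2 ^- k :> R.
Proof.
have M0' : M%:R != 0 :> R by rewrite pnatr_eq0 -lt0n.
by rewrite NE natrM natrX invfM mulrCA mulfV// mulr1.
Qed.

Let grid_dist i j : (i <= j)%N -> (j <= i + M)%N -> `|grid j - grid i| <= 2 ^- k.
Proof.
move=> ij jM; rewrite -mulrBl -natrB// ger0_norm ?divr_ge0 ?(ltW N0)//.
by rewrite -MN ler_wpM2r ?invr_ge0 ?(ltW N0)// ler_nat leq_subLR.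
Qed.

(** Two unpaired half periods contribute [ratio_const], the paired terms [incr_const]. *)
Definition freq_const : R := 4 `^ q * (2 * ratio_const g p q + incr_const g p q).

Let r0 : 0 <= ratio_const g p q. Proof. exact: expR_ge0. Qed.
Let i0 : 0 <= incr_const g p q.
Proof. by rewrite !mulr_ge0 ?powR_ge0 ?expR_ge0. Qed.
Let E00 : 0 <= E0. Proof. exact: expR_ge0. Qed.

Lemma freq_const_ge0 : 0 <= freq_const.
Proof. by apply: mulr_ge0 => //; apply: addr_ge0 => //; exact: mulr_ge0. Qed.

(** Up to n = 2^k a half period need not fit well into the block, and the trivial bound is used.
    Beyond, both the unpaired ends and the increments over a half period are small. *)
Lemma wexp_block_frequency e n : (0 < n)%N -> (2 * n %| N)%N ->
  (wE (fun w => `|\sum_(i <- iota (b * M) M)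
      fourier_trig e n (grid i) * chaos_ratio W g l t0 (grid i) w| `^ q)%R <=
   (M%:R `^ q * (freq_const * E0) *
     (if (n <= 2 ^ k)%N then 1 else ((2 ^ k)%:R / n%:R) `^ (q / 2)))%:E)%E.
Proof.
move=> n0 nN.
have n0' : 0 < n%:R :> R by rewrite ltr0n.
have mr i : measurable_fun setT (chaos_ratio W g l t0 (grid i)).
  exact: measurable_chaos_ratio.
have c1 i : `|fourier_trig e n (grid i)| <= 1 by exact: fourier_trig_le1.
have wt0 w : 0 <= chaos_weight W g p l t0 w by exact: chaos_weight_ge0.
have mwt : measurable_fun setT (chaos_weight W g p l t0) by exact: measurable_chaos_weight.
have hA i : (b * M <= i < b * M + M)%N ->
    (wE (fun w => `|chaos_ratio W g l t0 (grid i) w| `^ q)%R <= (ratio_const g p q * E0)%:E)%E.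
  move=> /andP[h1 h2].
  have -> : (fun w => `|chaos_ratio W g l t0 (grid i) w| `^ q) =
            (fun w => chaos_ratio W g l t0 (grid i) w `^ q).
    by apply/funext => w; rewrite ger0_norm// expR_ge0.
  by apply: (wexp_chaos_ratio wnW) lk _ _ => //; apply: grid_dist => //; exact: ltnW.
case: leqP => nk.
  rewrite mulr1.
  apply: (@le_trans _ _ ((size (iota (b * M) M))%:R `^ q * (ratio_const g p q * E0))%:E).
    apply: wexp_coef_sum_le => //; first by rewrite mulr_ge0.
    by move=> i /In_iota; exact: hA.
  rewrite size_iota lee_fin ler_wpM2l ?powR_ge0// ler_wpM2r//.
  rewrite /freq_const; apply: (@le_trans _ _ (1 * (2 * ratio_const g p q + incr_const g p q))).
    by rewrite mul1r; move: r0 i0 => *; lra.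
  apply: ler_wpM2r; first by apply: addr_ge0 => //; exact: mulr_ge0.
  by rewrite -[leLHS](powRr0 4) ler_powR// ?ler1n// ltW.
have [h hE] := dvdnP nN.
have hN : h%:R / N%:R = (2 * n%:R)^-1 :> R.
  have h0 : (0 < h)%N.
    by rewrite lt0n; apply/eqP => hh; move: N0; rewrite hE hh mul0n ltxx.
  have h0' : h%:R != 0 :> R by rewrite pnatr_eq0 -lt0n.
  by rewrite hE !natrM invfM mulrA mulfV// mul1r.
(* The block has M = N/2^k points and the half period h = N/(2n) grid steps, so that h = M x / 2. *)
set x := (2 ^ k)%:R / n%:R.
have P0 : 0 < (2 ^ k)%:R :> R by rewrite ltr0n expn_gt0.
have x0 : 0 < x by rewrite divr_gt0.
have x1 : x <= 1 by rewrite ler_pdivrMr// mul1r ler_nat ltnW.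
have hM : h%:R <= M%:R * x :> R.
  have -> : h%:R = M%:R * x / 2 :> R.
    have -> : h%:R = N%:R * (h%:R / N%:R) :> R by rewrite mulrC divfK// gt_eqF.
    rewrite hN {1}NE natrM /x; field; exact: lt0r_neq0.
  by rewrite ler_pdivrMr// ler_peMr ?mulr_ge0 ?(ltW x0)// ler1n.
have hM' : (h <= M)%N.
  by rewrite -(ler_nat R); apply: le_trans hM _; rewrite ler_piMr.
apply: le_trans.
  apply: (@wexp_antiperiodic_le _ _ _ _ _ wt0 mwt q q1 _ _ mr c1 (b * M) h M
     (ratio_const g p q * E0) (incr_const g p q * x `^ (q / 2) * E0)) => //.
  - by rewrite mulr_ge0.
  - by rewrite !mulr_ge0 ?powR_ge0.
  - by move=> i; rewrite natrD mulrDl hN fourier_trig_half.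
  - move=> i h1 h2; have ih : `|grid i - grid (i + h)%N| <= 2 ^- k.
      rewrite distrC; apply: grid_dist; first exact: leq_addr.
      by rewrite leq_add2l.
    apply: le_trans (wexp_chaos_incr wnW g0 p0 q2 lk _ _ ih) _.
    + by apply: grid_dist => //; apply: ltnW; apply: leq_ltn_trans h2; exact: leq_addr.
    + by apply: grid_dist; [apply: leq_trans h1 _; exact: leq_addr|exact: ltnW].
    rewrite lee_fin ler_wpM2r// ler_wpM2l//; apply: ge0_ler_powR.
    + by rewrite divr_ge0// ltW.
    + by rewrite nnegrE mulr_ge0.
    + by rewrite nnegrE ltW.
    rewrite distrC -mulrBl -natrB ?leq_addr// addKn hN.
    have -> : `|(2 * n%:R)^-1| = n%:R^-1 / 2 :> R.
      by rewrite ger0_norm ?invr_ge0 ?mulr_ge0// invfM mulrC.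
    rewrite /x natrX ler_wpM2l// ler_pdivrMr// ler_peMr// ?invr_ge0//.
    by rewrite ler1n.
rewrite lee_fin.
(* The ends are in fact of order x^q; they are weakened to the order x^(q/2) of the increments. *)
have hq : h%:R `^ q <= M%:R `^ q * x `^ (q / 2).
  apply: (@le_trans _ _ ((M%:R * x) `^ q)).
    by apply: ge0_ler_powR; rewrite ?nnegrE ?mulr_ge0 ?(ltW q0) ?(ltW x0).
  rewrite powRM ?(ltW x0)// ler_wpM2l ?powR_ge0//.
  apply: ger_powR; first by rewrite x0.
  by rewrite ler_pdivrMr// ler_peMr ?(ltW q0)// ler1n.
have -> : M%:R `^ q * (freq_const * E0) * x `^ (q / 2) =
  4 `^ q * (2 * (M%:R `^ q * x `^ (q / 2) * (ratio_const g p q * E0)) +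
     M%:R `^ q * (incr_const g p q * x `^ (q / 2) * E0)) by rewrite /freq_const; ring.
rewrite ler_wpM2l ?powR_ge0// lerD2r ler_wpM2l// ler_wpM2r// mulr_ge0//.
Qed.

End frequency_estimate.
Section block_estimate.
Context (R : realType) d (T : measurableType d) (P : probability T R).
Variables (W : set (R * R) -> {RV P >-> R}) (wnW : white_noise W).
Variables (g p q tau : R).
Hypotheses (g0 : 0 < g) (p12 : 1 < p < 2) (q2 : 2 < q) (tau0 : 0 <= tau).
Hypotheses (tq : 2 <= q * (1 - tau) / 2).
Variables (K : nat).
Local Notation grid N i := (i%:R / N%:R : R).

Definition fourier_weight N (nu : 'I_K * bool) i : R :=
  (nu.1.+1)%:R `^ (tau / 2) * (N%:R^-1 * fourier_trig nu.2 nu.1.+1 (grid N i)).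

Definition chaos_sum N l (s : seq nat) (nu : 'I_K * bool) w : R :=
  \sum_(i <- s) fourier_weight N nu i * chaos W g l (grid N i) w.

Lemma measurable_chaos_sum N l s nu : measurable_fun setT (chaos_sum N l s nu).
Proof.
apply: measurable_sum => i; apply: measurable_funM => //.
exact: measurable_chaos.
Qed.

Definition decay_exponent : R :=
  (p - 1) * (1 - g ^+ 2 * p / 2) - tau * p / 2 - p / q.

(** The 4 is 2 for cosine and sine times 2 from [sum_inv_sqr_le]. The exponential collects the
    variance that does not grow with k: the bound 1 at level 0 and ln 2 for each of the two levels
    by which l may exceed k. *)
Definition block_const : R :=
  (1 + 4 * freq_const g p q) * expR (g ^+ 2 * (p ^+ 2 - p) / 2 * (1 + 2 * ln 2)).

Let p0 : 0 < p. Proof. by move: p12 => h; lra. Qed.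
Let q0 : 0 < q. Proof. by move: q2 => h; lra. Qed.
Let f0 : 0 <= freq_const g p q. Proof. exact: freq_const_ge0. Qed.

Lemma block_const_ge0 : 0 <= block_const.
Proof. by apply: mulr_ge0; rewrite ?expR_ge0 ?addr_ge0 ?(mulr_ge0 _ f0). Qed.

Lemma chaos_moment_le l k : (l <= k.+2)%N ->
  chaos_moment g p l <= expR (g ^+ 2 * (p ^+ 2 - p) / 2 * (1 + 2 * ln 2)) *
    (2 ^ k)%:R `^ (g ^+ 2 * (p ^+ 2 - p) / 2).
Proof.
move=> lk; have P0 : (2 ^ k)%:R != 0 :> R by rewrite pnatr_eq0 -lt0n expn_gt0.
have ln20 : 0 <= ln 2 :> R by rewrite ln_ge0// ler1n.
rewrite /powR (negbTE P0) -expRD ler_expR natrX lnXn// -mulrDr ler_wpM2l//.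
  rewrite divr_ge0// mulr_ge0 ?sqr_ge0// subr_ge0 expr2.
  by move: p12 => h; rewrite ler_peMr//; lra.
apply: le_trans (log_cov0_le _ _) _.
have : l%:R <= k%:R + 2 :> R by rewrite -natrD ler_nat addn2.
move/(ler_wpM2r ln20) => h; rewrite -[ln 2 *+ k]mulr_natl.
by move: h; rewrite mulrDl; move: (_ * ln 2) (k%:R * _) => *; lra.
Qed.

Section block.
Variables (l k N M b : nat).
Hypotheses (lk : (l <= k.+2)%N) (M0 : (0 < M)%N) (NE : N = (2 ^ k * M)%N).
Hypothesis NK : forall n, (0 < n <= K)%N -> (2 * n %| N)%N.
Let t0 : R := grid N (b * M)%N.
Let P2 : R := (2 ^ k)%:R.
Let E0 : R := chaos_moment g p l.
Local Notation wE := (wexp P (chaos_weight W g p l t0)).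

Let P20 : 0 < P2. Proof. by rewrite ltr0n expn_gt0. Qed.

Let zsum (nu : 'I_K * bool) w := \sum_(i <- iota (b * M) M)
  fourier_trig nu.2 nu.1.+1 (grid N i) * chaos_ratio W g l t0 (grid N i) w.

Let chaos_sumE nu w : chaos_sum N l (iota (b * M) M) nu w =
  chaos W g l t0 w * ((nu.1.+1)%:R `^ (tau / 2) * N%:R^-1 * zsum nu w).
Proof.
rewrite /chaos_sum /zsum mulr_sumr mulr_sumr; apply: eq_bigr => i _.
by rewrite (chaosE W g l t0 (grid N i)) /fourier_weight; ring.
Qed.

Let mz nu : measurable_fun setT (zsum nu).
Proof.
apply: measurable_sum => i; apply: measurable_funM => //.
exact: measurable_chaos_ratio.
Qed.

Let wt0 w : 0 <= chaos_weight W g p l t0 w.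
Proof. exact: chaos_weight_ge0. Qed.

Let mwt : measurable_fun setT (chaos_weight W g p l t0).
Proof. exact: measurable_chaos_weight. Qed.

Let NM : N%:R^-1 * M%:R = P2^-1.
Proof.
have M0' : M%:R != 0 :> R by rewrite pnatr_eq0 -lt0n.
by rewrite NE natrM invfM -mulrA mulVf// mulr1.
Qed.

(** The expected size of the l^q norm of a block relative to the density at its left end: -1 from
    the block length, tau/2 from the weights at n about 2^k, and 1/q from the number of such
    frequencies. *)
Let A : R := P2 `^ (-1 + tau / 2 + 1 / q).

Lemma wexp_frequency_le (nu : 'I_K * bool) :
  (wE (fun w => `|((nu.1.+1)%:R `^ (tau / 2) * N%:R^-1) * zsum nu w| `^ q)%R <=
   (freq_const g p q * E0 * P2 `^ (- q + tau / 2 * q) *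
     (if (nu.1.+1 <= 2 ^ k)%N then 1 else (P2 / (nu.1.+1)%:R) ^+ 2))%:E)%E.
Proof.
set n := nu.1.+1; have nK : (0 < n <= K)%N by rewrite /= ltn_ord.
have n0 : (0 < n)%N by [].
have a0 : 0 <= n%:R `^ (tau / 2) * N%:R^-1 :> R by rewrite mulr_ge0 ?powR_ge0 ?invr_ge0.
have -> : (fun w => `|(n%:R `^ (tau / 2) * N%:R^-1) * zsum nu w| `^ q) =
   (fun w => (n%:R `^ (tau / 2) * N%:R^-1) `^ q * `|zsum nu w| `^ q).
  by apply/funext => w; rewrite normrM (ger0_norm a0) (powRM _ a0).
rewrite wexpZ ?powR_ge0//; last exact: measurable_norm_powR.
apply: le_trans.
  apply: lee_wpmul2l; first by rewrite lee_fin powR_ge0.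
  exact: (wexp_block_frequency wnW b g0 p0 q2 lk M0 NE nu.2 n0 (NK nK)).
rewrite -EFinM lee_fin powRM ?powR_ge0 ?invr_ge0// -powRrM.
have e1 : N%:R^-1 `^ q * M%:R `^ q = P2 `^ (- q).
  by rewrite -powRM ?invr_ge0// NM powRN -powR_inv1 ?(ltW P20)// -powRrM mulN1r powRN.
have := frequency_weight_le tau0 q2 tq (expn_gt0 2 k) n0.
rewrite -/P2 => h.
rewrite gt0_powRD// -[chaos_moment _ _ _]/E0.
have F0 : 0 <= freq_const g p q * E0 * P2 `^ (- q).
  by rewrite mulr_ge0 ?powR_ge0// mulr_ge0 ?expR_ge0.
have := ler_wpM2l F0 h; rewrite -e1.
move: (if _ then 1 else _ `^ _) (if _ then 1 else _ ^+ _) => u v.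
move: (P2 `^ _) (n%:R `^ _) (_^-1 `^ _) (M%:R `^ _) (freq_const _ _ _) => c1 c2 c3 c4 c5.
move: E0 => e; congr (_ <= _); ring.
Qed.

Lemma wexp_lq_sum_le :
  (wE (fun w => lq_sum q (fun nu : 'I_K * bool =>
     ((nu.1.+1)%:R `^ (tau / 2) * N%:R^-1) * zsum nu w))%R <=
   (4 * freq_const g p q * E0 * A `^ q)%:E)%E.
Proof.
have mf (nu : 'I_K * bool) : measurable_fun setT (fun w => (nu.1.+1)%:R `^ (tau / 2) * N%:R^-1 * zsum nu w).
  exact: measurable_funM.
rewrite /lq_sum wexp_sum//; last by move=> nu; exact: measurable_norm_powR.
apply: le_trans; first by apply: lee_sum => nu _; exact: wexp_frequency_le.
rewrite sumEFin lee_fin -mulr_sumr.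
have -> : 4 * freq_const g p q * E0 * A `^ q =
   freq_const g p q * E0 * P2 `^ (- q + tau / 2 * q) * (4 * P2).
  have -> : A `^ q = P2 `^ (- q + tau / 2 * q) * P2.
    rewrite -powRrM -{3}(powRr1 (ltW P20)) -gt0_powRD//; congr (_ `^ _).
    by field; rewrite gt_eqF.
  ring.
apply: ler_wpM2l; first by rewrite mulr_ge0 ?powR_ge0// mulr_ge0 ?expR_ge0.
rewrite -(pair_big xpredT xpredT (fun (i : 'I_K) (_ : bool) =>
  if (i.+1 <= 2 ^ k)%N then 1 else (P2 / i.+1%:R) ^+ 2))/=.
under eq_bigr do rewrite big_bool.
rewrite big_split/=.
have := @sum_inv_sqr_le R _ K (expn_gt0 2 k); rewrite -/P2.
by move: (\sum_(_ < K) _) => s hs; lra.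
Qed.

(** The density at the left end factors out of every coefficient, and its p-th power becomes the
    weight. The power p/q of the remaining sum is then linearised at scale [A], where its weighted
    mean is known. *)
Lemma chaos_sum_block_le :
  (\int[P]_w (lq_sum q (fun nu => chaos_sum N l (iota (b * M) M) nu w) `^ (p / q))%:E <=
   (block_const * P2 `^ (- (1 + decay_exponent)))%:E)%E.
Proof.
have pq : 0 < p <= q by rewrite p0/=; move: p12 q2 => *; lra.
have A0 : 0 < A by exact: powR_gt0.
pose z w := lq_sum q (fun nu : 'I_K * bool =>
     ((nu.1.+1)%:R `^ (tau / 2) * N%:R^-1) * zsum nu w).
have mzz : measurable_fun setT z.
  by apply: measurable_lq_sum => nu; exact: measurable_funM.
have z0 w : 0 <= z w by exact: lq_sum_ge0.
apply: (@le_trans _ _ (wE (fun w => A `^ p * (fun=> 1) w + A `^ (p - q) * z w)%R)).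
  apply: ge0_le_integralT.
  - by move=> w; rewrite lee_fin powR_ge0.
  - apply/measurable_EFinP; apply: (measurableT_comp (measurable_powR _)).
    by apply: measurable_lq_sum => nu; exact: measurable_chaos_sum.
  - apply/measurable_EFinP; apply: measurable_funM => //.
    by apply: measurable_funD => //; exact: measurable_funM.
  - move=> w; rewrite lee_fin.
    have -> : lq_sum q (fun nu => chaos_sum N l (iota (b * M) M) nu w) =
        chaos W g l t0 w `^ q * z w.
      rewrite /z /lq_sum mulr_sumr; apply: eq_bigr => nu _.
      by rewrite chaos_sumE normrM powRM// ger0_norm// expR_ge0.
    rewrite powRM ?powR_ge0// -powRrM mulrCA divff ?gt_eqF// mulr1.
    rewrite mulr1; apply: ler_wpM2l; first exact: powR_ge0.
    exact: powR_ratio_le.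
(* Total mass of the weight, as the case Y = 0 of the exponential estimate. *)
have w1 : (wE (fun=> 1%R) <= E0%:E)%E.
  have G0 : noise_span W (fun=> 0) by apply: (gs0 (gaussian_noise_span wnW)).
  have c0 : cov P (log_field W l t0) (fun=> 0) = 0.
    by rewrite covC cov0l.
  have c00 : cov P (fun=> 0) (fun=> 0) = 0 :> R.
    by rewrite cov0l.
  have := wexp_expR_le wnW (c1 := 0) (c2 := 0) g0 p0 G0 _ _.
  move=> /(_ l t0); rewrite c0 c00 normr0 => /(_ (lexx _) (lexx _)).
  by rewrite mulr0 mul0r addr0 expR0 mulr1.
rewrite wexpD//; last 3 first.
- exact: measurable_funM.
- by move=> w; rewrite mulr_ge0 ?powR_ge0.
- by move=> w; rewrite mulr_ge0 ?powR_ge0.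
rewrite wexpZ ?powR_ge0// wexpZ ?powR_ge0//.
apply: le_trans.
  apply: leeD; first by apply: lee_wpmul2l w1; rewrite lee_fin powR_ge0.
  by apply: lee_wpmul2l wexp_lq_sum_le; rewrite lee_fin powR_ge0.
rewrite -!EFinM -EFinD lee_fin.
have -> : A `^ p * E0 + A `^ (p - q) * (4 * freq_const g p q * E0 * A `^ q) =
    A `^ p * (1 + 4 * freq_const g p q) * E0.
  have <- : A `^ (p - q) * A `^ q = A `^ p by rewrite -gt0_powRD// subrK.
  ring.
apply: (@le_trans _ _ (A `^ p * (1 + 4 * freq_const g p q) *
   (expR (g ^+ 2 * (p ^+ 2 - p) / 2 * (1 + 2 * ln 2)) * P2 `^ (g ^+ 2 * (p ^+ 2 - p) / 2)))).
  apply: ler_wpM2l; last exact: chaos_moment_le.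
  by rewrite mulr_ge0 ?powR_ge0// addr_ge0// (mulr_ge0 _ f0).
have -> : P2 `^ (- (1 + decay_exponent)) = A `^ p * P2 `^ (g ^+ 2 * (p ^+ 2 - p) / 2).
  rewrite -powRrM -gt0_powRD//; congr (_ `^ _); rewrite /decay_exponent.
  by field; rewrite gt_eqF.
rewrite /block_const le_eqVlt; apply/orP; left; apply/eqP; ring.
Qed.

End block.
End block_estimate.
(** * Martingale bound on the grid *)

Section lq_sum_powers.
Context (R : realType) (I : finType).

Lemma lq_sumD_powR_le p q (f h : I -> R) : 0 < p -> 0 < q ->
  lq_sum q (fun i => f i + h i) `^ (p / q) <=
  2 `^ p * 2 `^ (p / q) * (lq_sum q f `^ (p / q) + lq_sum q h `^ (p / q)).
Proof.
move=> p0 q0; have pq : 0 <= p / q by rewrite divr_ge0 ?(ltW p0) ?(ltW q0).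
apply: (@le_trans _ _ ((2 `^ q * (lq_sum q f + lq_sum q h)) `^ (p / q))).
  apply: ge0_ler_powR; rewrite ?nnegrE ?lq_sum_ge0//.
    by rewrite mulr_ge0 ?powR_ge0// addr_ge0 ?lq_sum_ge0.
  by apply: lq_sumD_le; exact: ltW.
rewrite powRM ?powR_ge0 ?addr_ge0 ?lq_sum_ge0// -powRrM mulrCA divff ?gt_eqF// mulr1.
rewrite -mulrA ler_wpM2l ?powR_ge0//.
have := norm_powRD_le (lq_sum q f) (lq_sum q h) pq.
by rewrite !ger0_norm ?addr_ge0 ?lq_sum_ge0.
Qed.

Lemma lq_sumN q (f : I -> R) : lq_sum q (fun i => - f i) = lq_sum q f.
Proof. by apply: eq_bigr => i _; rewrite normrN. Qed.

Lemma powR_exprn (a s : R) n : 0 <= a -> (a `^ s) ^+ n = (a ^+ n) `^ s.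
Proof.
move=> a0; rewrite -powR_mulrn ?powR_ge0// -powRrM mulrC powRrM.
by congr (_ `^ _); exact: powR_mulrn.
Qed.

Lemma geometric_sum_le (r : R) n : 0 <= r < 1 -> \sum_(k < n) r ^+ k <= (1 - r)^-1.
Proof.
move=> /andP[r0 r1]; have r1' : 0 < 1 - r by rewrite subr_gt0.
rewrite -[leRHS]mul1r ler_pdivlMr// mulrC.
have -> : (1 - r) * \sum_(k < n) r ^+ k = 1 - r ^+ n.
  by rewrite -[in RHS]opprB subrX1 -mulNr opprB.
by rewrite gerBl exprn_ge0.
Qed.

Lemma big_ord_double n (F : nat -> R) :
  \sum_(b < 2 * n) F b = \sum_(b < n) F (2 * b)%N + \sum_(b < n) F (2 * b + 1)%N.
Proof.
elim: n => [|n ih]; first by rewrite muln0 !big_ord0 addr0.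
by rewrite mulnS !big_ord_recr/= ih addn1; ring.
Qed.

Lemma big_iota_blocks n M (F : nat -> R) :
  \sum_(i <- iota 0 (n * M)) F i = \sum_(b < n) \sum_(i <- iota (b * M) M) F i.
Proof.
elim: n => [|n ih]; first by rewrite big_nil big_ord0.
by rewrite mulSn addnC iotaD big_cat/= ih big_ord_recr.
Qed.

End lq_sum_powers.

Section martingale.
Context (R : realType) d (T : measurableType d) (P : probability T R).
Variables (W : set (R * R) -> {RV P >-> R}) (wnW : white_noise W).
Variables (g p q tau : R).
Hypotheses (p12 : 1 < p < 2) (q2 : 2 < q).
Variables (K N : nat).
Local Notation grid i := (i%:R / N%:R : R).
Local Notation G := (noise_span W).
Local Notation csum := (@chaos_sum R d T P W g tau K N).
Local Notation fweight := (@fourier_weight R tau K N).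
Local Notation norm_mean x := (\int[P]_w (lq_sum q (fun nu : 'I_K * bool => x nu w) `^ (p / q))%:E)%E.
Let gsG := gaussian_noise_span wnW.
Let p0 : 0 < p. Proof. by move: p12 => h; lra. Qed.
Let q0 : 0 < q. Proof. by move: q2 => h; lra. Qed.

Definition scaled_cone l (s : seq nat) (j : 'I_(size s)) w : R :=
  g * cone_field W l (grid (nth 0%N s j)) w.

Lemma noise_span_scaled_cone l s (j : 'I_(size s)) : G (scaled_cone l j).
Proof. by apply: (gsZ gsG); exact: noise_span_cone. Qed.

Definition chaos_incr l (s : seq nat) (nu : 'I_K * bool) w : R :=
  csum l.+1 s nu w - csum l s nu w.

Lemma chaosS l t w : chaos W g l.+1 t w =
  chaos W g l t w * expR (g * cone_field W l t w - g ^+ 2 * kappa l 0 / 2).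
Proof.
rewrite /chaos -expRD; congr expR; rewrite log_fieldS.
have -> : log_cov l.+1 0 = log_cov l 0 + kappa l 0 :> R.
  by rewrite /log_cov -addn1 iotaD big_cat/= big_seq1.
ring.
Qed.

Lemma wick_scaled_cone l s (j : 'I_(size s)) w :
  wick_exp P (@scaled_cone l s) j w =
  expR (g * cone_field W l (grid (nth 0%N s j)) w - g ^+ 2 * kappa l 0 / 2).
Proof.
rewrite /wick_exp /scaled_cone; congr (expR (_ - _)).
have Gc := noise_span_cone W l (grid (nth 0%N s j)).
rewrite (covZl gsG)//; last exact: (gsZ gsG).
rewrite covC (covZl gsG)// (cov_cone_field wnW) eqxx subrr normr0; ring.
Qed.

Lemma chaos_incrE l s nu w : chaos_incr l s nu w =
  \sum_(j < size s) fweight nu (nth 0%N s j) * chaos W g l (grid (nth 0%N s j)) w *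
     (wick_exp P (@scaled_cone l s) j w - 1).
Proof.
rewrite /chaos_incr /chaos_sum -sumrB (big_nth 0%N) big_mkord; apply: eq_bigr => j _.
rewrite wick_scaled_cone chaosS; ring.
Qed.

Section orthogonality.
Variables (l : nat) (s : seq nat).
Local Notation orthm := (orth_measurable P G (@scaled_cone l s)).

Lemma orth_chaos t : orthm (chaos W g l t).
Proof.
have h : orthm (log_field W l t).
  apply: orthogonal_measurable; split; first exact: (noise_span_log wnW).
  move=> j; rewrite covC (covZl gsG); last exact: (noise_span_log wnW).
    by rewrite covC (cov_log_cone wnW) ltnn mulr0.
  exact: noise_span_cone.
rewrite /orth_measurable; apply: measurableT_comp => //.
by apply: measurable_funB => //; exact: measurable_funM.
Qed.

Lemma orth_chaos_sum s' nu : orthm (csum l s' nu).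
Proof.
rewrite /orth_measurable; apply: measurable_sum => i.
by apply: measurable_funM => //; exact: orth_chaos.
Qed.

(** Levels below l are uncorrelated with level l because their cones have disjoint heights; the
    level-l variables over [s'] are uncorrelated with those over [s] by the hypothesis on
    [kappa]. *)
Lemma orth_chaos_incr s' nu :
  (forall i j, i \in s' -> j \in s -> kappa l `|grid i - grid j| = 0) ->
  orthm (chaos_incr l s' nu).
Proof.
move=> far; rewrite /orth_measurable.
have -> : chaos_incr l s' nu = (fun w => \sum_(j < size s')
   fweight nu (nth 0%N s' j) * chaos W g l (grid (nth 0%N s' j)) w *
     (expR (g * cone_field W l (grid (nth 0%N s' j)) w - g ^+ 2 * kappa l 0 / 2) - 1)).
  apply/funext => w; rewrite chaos_incrE; apply: eq_bigr => j _.
  by rewrite wick_scaled_cone.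
apply: measurable_sum => j.
have h : orthm (cone_field W l (grid (nth 0%N s' j))).
  apply: orthogonal_measurable; split; first exact: noise_span_cone.
  move=> i; rewrite covC (covZl gsG); try exact: noise_span_cone.
  by rewrite covC (cov_cone_field wnW) eqxx far ?mulr0// mem_nth.
apply: measurable_funM.
  by apply: measurable_funM => //; exact: orth_chaos.
apply: measurable_funB => //; apply: measurableT_comp => //.
by apply: measurable_funB => //; exact: measurable_funM.
Qed.

Lemma chaos_integrable_powR t : (\int[P]_w (chaos W g l t w `^ p)%:E < +oo)%E.
Proof.
have GL : G (fun w => p * g * log_field W l t w).
  by apply: (gsZ gsG); exact: (noise_span_log wnW).
under eq_integral do rewrite -/(chaos_weight W g p l t _) chaos_weightE EFinM.
have [_ _ e] := gs_moments gsG GL.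
rewrite ge0_integralZl//; last first.
  apply/measurable_EFinP; apply: measurableT_comp => //; exact: (gs_measurable gsG GL).
by rewrite e -EFinM ltry.
Qed.

Lemma martingale_step (x : 'I_K * bool -> T -> R) :
  (forall nu, orthm (x nu)) -> (norm_mean x < +oo)%E ->
  (norm_mean (fun nu w => x nu w + chaos_incr l s nu w)%R <=
   norm_mean x + (type_const p q)%:E * norm_mean (chaos_incr l s))%E.
Proof.
move=> ox ix.
pose c (nu : 'I_K * bool) (j : 'I_(size s)) w :=
  fweight nu (nth 0%N s j) * chaos W g l (grid (nth 0%N s j)) w.
have := @wick_martingale_type _ _ _ _ _ gsG _ _ (@noise_span_scaled_cone l s) _
  p q x c p12 q2 ox _ ix _.
have E nu w : chaos_incr l s nu w = \sum_j c nu j w * (wick_exp P (@scaled_cone l s) j w - 1).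
  exact: chaos_incrE.
under [X in (_ -> _ -> (_ <= _ + _ * X)%E) -> _]eq_integral => w _.
  under eq_lq_sum do rewrite -E.
  over.
under [X in (_ -> _ -> (X <= _)%E) -> _]eq_integral => w _.
  under eq_lq_sum do rewrite -E.
  over.
apply.
- move=> nu j; rewrite /orth_measurable; apply: measurable_funM => //.
  exact: orth_chaos.
- move=> nu j; rewrite /c.
  under eq_integral => w _.
    rewrite normrM powRM// (ger0_norm (expR_ge0 _)) EFinM.
    over.
  rewrite ge0_integralZl//.
  + by apply: lte_mul_pinfty; [rewrite lee_fin powR_ge0|by []|exact: chaos_integrable_powR].
  + apply/measurable_EFinP; apply: (measurableT_comp (measurable_powR _)).
    exact: measurable_chaos.
Qed.

End orthogonality.
End martingale.
Section martingale_bound.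
Context (R : realType) d (T : measurableType d) (P : probability T R).
Variables (W : set (R * R) -> {RV P >-> R}) (wnW : white_noise W).
Variables (g p q tau : R).
Hypotheses (g0 : 0 < g) (p12 : 1 < p < 2) (q2 : 2 < q) (tau0 : 0 <= tau).
Hypotheses (tq : 2 <= q * (1 - tau) / 2).
Variables (K N : nat).
Hypotheses (NK : forall n, (0 < n <= K)%N -> (2 * n %| N)%N) (N0 : (0 < N)%N).
Local Notation grid i := (i%:R / N%:R : R).
Local Notation csum := (@chaos_sum R d T P W g tau K N).
Local Notation cincr := (@chaos_incr R d T P W g tau K N).
Definition norm_mean (x : 'I_K * bool -> T -> R) : \bar R :=
  (\int[P]_w (lq_sum q (fun nu => x nu w) `^ (p / q))%:E)%E.
Local Notation decay := (decay_exponent g p q tau).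
Local Notation BC := (block_const g p q).
Let p0 : 0 < p. Proof. by move: p12 => h; lra. Qed.
Let q0 : 0 < q. Proof. by move: q2 => h; lra. Qed.
Let C := type_const p q.
Let C0 : 0 <= C. Proof. by rewrite type_const_ge0 ?(ltW p0)// ltW. Qed.
Let c2 : R := 2 `^ p * 2 `^ (p / q).
Let c20 : 0 <= c2. Proof. by rewrite mulr_ge0 ?powR_ge0. Qed.
Let B0 : 0 <= BC. Proof. exact: block_const_ge0. Qed.

Lemma norm_meanD_le (x y : 'I_K * bool -> T -> R) :
  (forall nu, measurable_fun setT (x nu)) -> (forall nu, measurable_fun setT (y nu)) ->
  (norm_mean (fun nu w => x nu w + y nu w)%R <= c2%:E * (norm_mean x + norm_mean y))%E.
Proof.
move=> mx my.
have mp (z : 'I_K * bool -> T -> R) : (forall nu, measurable_fun setT (z nu)) ->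
    measurable_fun setT (fun w => (lq_sum q (fun nu => z nu w) `^ (p / q))%:E).
  by move=> mz; apply/measurable_EFinP; exact: measurable_lq_sum_powR.
rewrite /norm_mean -ge0_integralD//; try by [exact: mp|move=> w _; rewrite lee_fin powR_ge0].
rewrite -ge0_integralZl//; last 2 first.
- by apply: emeasurable_funD; exact: mp.
- by move=> w _; rewrite adde_ge0 ?lee_fin ?powR_ge0.
apply: ge0_le_integralT.
- by move=> w; rewrite lee_fin powR_ge0.
- by apply: mp => nu; exact: measurable_funD.
- by apply: measurable_funeM; apply: emeasurable_funD; exact: mp.
- by move=> w; rewrite -EFinD -EFinM lee_fin; exact: lq_sumD_powR_le.
Qed.

Lemma measurable_chaos_incr l s nu : measurable_fun setT (cincr l s nu).
Proof. by apply: measurable_funB; exact: measurable_chaos_sum. Qed.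

(** No cancellation between the levels is used: both densities satisfy the block estimate. The upper
    one has l = k + 2, which is why the block estimates allow this excess. *)
Lemma norm_mean_block_incr k M b : (0 < M)%N -> N = (2 ^ k * M)%N ->
  (norm_mean (cincr k.+1 (iota (b * M) M)) <=
    (c2 * (2 * BC) * (2 ^ k)%:R `^ (- (1 + decay)))%:E)%E.
Proof.
move=> M0 NE; set s := iota _ _.
have h l : (l <= k.+2)%N -> (norm_mean (csum l s) <= (BC * (2 ^ k)%:R `^ (- (1 + decay)))%:E)%E.
  by move=> lk; exact: (chaos_sum_block_le wnW g0 p12 q2 tau0 tq).
have mc l nu := measurable_chaos_sum wnW g tau N l s (nu : 'I_K * bool).
have -> : cincr k.+1 s = (fun nu w => csum k.+2 s nu w + - csum k.+1 s nu w) by [].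
apply: le_trans.
  by apply: norm_meanD_le => nu; [exact: mc|apply: measurable_funN; exact: mc].
have -> : norm_mean (fun nu w => - csum k.+1 s nu w) = norm_mean (csum k.+1 s).
  by apply: eq_integral => w _; rewrite lq_sumN.
rewrite -[(c2 * _ * _)%R]mulrA [(c2 * (_ * _))%:E]EFinM; apply: lee_wpmul2l; first by rewrite lee_fin.
rewrite -mulrA mulr_natl mulr2n EFinD; apply: leeD; exact: h.
Qed.

(** With one full block in between, the points are at least M/N = 2^-k apart, which is the maximal
    width of the cones of level k + 1. *)
Lemma kappa_far_blocks k M b b' i j : (0 < M)%N -> N = (2 ^ k * M)%N -> (b + 2 <= b')%N ->
  i \in iota (b * M) M -> j \in iota (b' * M) M -> kappa k.+1 `|grid i - grid j| = 0 :> R.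
Proof.
move=> M0 NE bb'; rewrite !mem_iota => /andP[_ hi] /andP[hj _].
have N0' : 0 < N%:R :> R by rewrite ltr0n.
have ij : (i + M <= j)%N.
  apply: leq_trans hj; apply: leq_trans (leq_mul bb' (leqnn M)).
  by rewrite mulnDl mul2n -addnn addnA leq_add2r ltnW.
apply: kappa_far; rewrite distrC -mulrBl ger0_norm; last first.
  by rewrite divr_ge0 ?(ltW N0')// subr_ge0 ler_nat; apply: leq_trans ij; exact: leq_addr.
rewrite -natrB; last by apply: leq_trans ij; exact: leq_addr.
have -> : 2 / 2 ^+ k.+1 = (2 ^+ k)^-1 :> R by rewrite exprS invfM mulrA mulfV// mul1r.
rewrite ler_pdivlMr// NE natrM natrX mulrA mulVf ?gt_eqF ?exprn_gt0// mul1r ler_nat.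
by rewrite leq_subRL ?(leq_trans (leq_addr _ _) ij).
Qed.

Let far_const k : R := c2 * (2 * BC) * (2 ^ k)%:R `^ (- (1 + decay)).
Let far_const_ge0 k : 0 <= far_const k.
Proof. by rewrite mulr_ge0 ?powR_ge0// mulr_ge0// mulr_ge0. Qed.

(* Blocks of equal parity are at distance at least the range of the cones of level k.+1. *)
Lemma norm_mean_parity k M par n : (0 < M)%N -> N = (2 ^ k * M)%N ->
  (norm_mean (fun nu w => \sum_(b < n) cincr k.+1 (iota ((2 * b + par) * M) M) nu w)%R <=
   (n%:R * ((1 + C) * far_const k))%:E)%E.
Proof.
move=> M0 NE; elim: n => [|n ih].
  rewrite mul0r /norm_mean integral0_eq// => w _.
  rewrite /lq_sum big1 ?powR0 ?gt_eqF ?divr_gt0// => nu _.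
  by rewrite big_ord0 normr0 powR0// gt_eqF.
pose x nu w := \sum_(b < n) cincr k.+1 (iota ((2 * b + par) * M) M) nu w.
have -> : (fun nu w => \sum_(b < n.+1) cincr k.+1 (iota ((2 * b + par) * M) M) nu w) =
   (fun nu w => x nu w + cincr k.+1 (iota ((2 * n + par) * M) M) nu w).
  by apply/funext => nu; apply/funext => w; rewrite big_ord_recr.
(* The blocks of one parity are added one at a time: the new increment is a martingale difference
   over the previous ones, so the p-th moments add up. *)
apply: le_trans.
  apply: (@martingale_step _ _ _ _ _ wnW g p q tau p12 q2 K N k.+1 (iota ((2 * n + par) * M) M) x).
    move=> nu; rewrite /orth_measurable; apply: measurable_sum => b.
    apply: (orth_chaos_incr wnW) => i j; apply: kappa_far_blocks M0 NE _.
    by rewrite -addnA (addnC par) addnA leq_add2r [(2 * b + 2)%N]addnC -mulnS leq_mul2l/= ltn_ord.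
  by apply: le_lt_trans ih _; rewrite ltry.
have := norm_mean_block_incr (2 * n + par) M0 NE; rewrite -/(far_const k) => hb.
apply: le_trans.
  by apply: leeD; [exact: ih|apply: lee_wpmul2l hb; rewrite lee_fin].
rewrite -EFinM -EFinD lee_fin -natr1 [in leRHS]mulrDl mul1r lerD2l.
by rewrite ler_wpM2r// lerDr.
Qed.

(** From the outside in: the martingale step between levels, the splitting by parity, the sum over
    one parity class, and the bound for one block. *)
Let step_const : R := C * (c2 * ((1 + C) * (c2 * (2 * BC)))).

(** The increment lives on 2^(k+1) blocks of moment of order 2^(-(k+1)(1+eps)); their number cancels
    the 1 in the exponent and leaves the term of a geometric series. *)
Lemma norm_mean_chaosS k M : (0 < M)%N -> N = (2 ^ k.+1 * M)%N ->
  (norm_mean (csum k.+2 (iota 0 N)) < +oo)%E ->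
  (norm_mean (csum k.+3 (iota 0 N)) <=
   norm_mean (csum k.+2 (iota 0 N)) + (step_const * (2 `^ (- decay)) ^+ k.+1)%:E)%E.
Proof.
move=> M0 NE fin; set n := (2 ^ k)%N.
have -> : csum k.+3 (iota 0 N) =
    (fun nu w => csum k.+2 (iota 0 N) nu w + cincr k.+2 (iota 0 N) nu w).
  by apply/funext => nu; apply/funext => w; rewrite /chaos_incr addrC subrK.
apply: le_trans.
  by apply: (@martingale_step _ _ _ _ _ wnW g p q tau p12 q2 K N k.+2 (iota 0 N) (csum k.+2 (iota 0 N))) => // nu; exact: (orth_chaos_sum wnW).
apply: leeD => //.
have NE' : N = (2 * n * M)%N by rewrite NE expnS.
have -> : cincr k.+2 (iota 0 N) = (fun nu w =>
   \sum_(b < n) cincr k.+2 (iota ((2 * b + 0) * M) M) nu w +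
   \sum_(b < n) cincr k.+2 (iota ((2 * b + 1) * M) M) nu w).
  apply/funext => nu; apply/funext => w.
  rewrite /chaos_incr /chaos_sum NE' !big_iota_blocks -sumrB.
  rewrite (big_ord_double n (fun b => \sum_(i <- iota (b * M) M) _ - \sum_(i <- iota (b * M) M) _)).
  by under [in RHS]eq_bigr do rewrite addn0.
have mS par nu : measurable_fun setT (fun w =>
    \sum_(b < n) cincr k.+2 (iota ((2 * b + par) * M) M) nu w).
  by apply: measurable_sum => b; exact: measurable_chaos_incr.
apply: le_trans.
  by apply: lee_wpmul2l; [rewrite lee_fin|apply: norm_meanD_le => nu; exact: mS].
apply: le_trans.
  apply: lee_wpmul2l; first by rewrite lee_fin.
  apply: lee_wpmul2l; first by rewrite lee_fin.
  by apply: leeD; exact: norm_mean_parity.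
have P0 : 0 < (2 ^ k.+1)%:R :> R by rewrite ltr0n expn_gt0.
have e : (2 `^ (- decay)) ^+ k.+1 = (2 * n%:R) * (2 ^ k.+1)%:R `^ (- (1 + decay)) :> R.
  have -> : 2 * n%:R = (2 ^ k.+1)%:R :> R by rewrite expnS natrM.
  have := gt0_powRD 1 (- (1 + decay)) P0; rewrite powRr1 ?(ltW P0)// => <-.
  move: (decay_exponent _ _ _ _) => z; have -> : 1 - (1 + z) = - z by ring.
  by rewrite natrX powR_exprn.
rewrite -EFinD -!EFinM lee_fin e /step_const /far_const.
rewrite -/C; move: c2 C BC (_ `^ _) n%:R => a b c f h.
by rewrite le_eqVlt; apply/orP; left; apply/eqP; ring.
Qed.

Definition chaos_norm_const : R := BC + step_const * (1 - 2 `^ (- decay))^-1.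

Hypothesis decay0 : 0 < decay.

Lemma norm_mean_chaos_le m : (2 ^ m %| N)%N ->
  (norm_mean (csum m.+1 (iota 0 N)) <= chaos_norm_const%:E)%E.
Proof.
move=> mN; set r : R := 2 `^ (- decay).
have r01 : 0 <= r < 1.
  rewrite powR_ge0/= /r /powR pnatr_eq0/= expR_lt1 mulNr oppr_lt0 mulr_gt0//.
  by rewrite ln_gt0// ltr1n.
have S0 : 0 <= step_const.
  by do 3 (apply: mulr_ge0 => //); [exact: addr_ge0|do 2 (apply: mulr_ge0 => //)].
(* For k = 0 the whole grid is a single block, and the block estimate covers l <= 2; the martingale
   steps start from there. *)
have base l : (l <= 2)%N -> (norm_mean (csum l (iota 0 N)) <= BC%:E)%E.
  move=> l2; have := @chaos_sum_block_le _ _ _ _ _ wnW _ _ _ _ g0 p12 q2 tau0 tq K l 0 N N 0 l2 N0.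
  by rewrite expn0 mul1n mul0n powR1 mulr1; exact.
suff h : (norm_mean (csum m.+1 (iota 0 N)) <= (BC + step_const * \sum_(k < m) r ^+ k)%:E)%E.
  apply: le_trans h _; rewrite lee_fin lerD2l ler_wpM2l//; exact: geometric_sum_le.
elim: m mN => [|m ih] mN.
  by rewrite big_ord0 mulr0 addr0; exact: base.
case: m ih mN => [|m] ih mN.
  apply: le_trans (base 2%N isT) _.
  by rewrite lee_fin lerDl mulr_ge0// big_ord_recr big_ord0 /= add0r.
have {}ih : (norm_mean (csum m.+2 (iota 0 N)) <= (BC + step_const * \sum_(k < m.+1) r ^+ k)%:E)%E.
  by apply: ih; apply: dvdn_trans mN; rewrite [X in (_ %| X)%N]expnS dvdn_mull.
have mN' : (2 ^ m.+1 %| N)%N by apply: dvdn_trans mN; rewrite [X in (_ %| X)%N]expnS dvdn_mull.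
have [M NE] := dvdnP mN'.
have M0 : (0 < M)%N by rewrite lt0n; apply: contraTneq N0; rewrite NE => ->.
rewrite mulnC in NE.
apply: le_trans (norm_mean_chaosS M0 NE _) _.
  by apply: le_lt_trans ih _; rewrite ltry.
apply: le_trans; first by apply: leeD; [exact: ih|exact: lexx].
have -> : \sum_(k < m.+2) r ^+ k = \sum_(k < m.+1) r ^+ k + r ^+ m.+1 by exact: big_ord_recr.
by rewrite (mulrDr step_const) addrA EFinD.
Qed.

End martingale_bound.
(** * Removing the grid *)

Section riemann_sums.
Context (R : realType).
Implicit Types (h : R -> R) (n i : nat) (t : R).
Let mu := @lebesgue_measure R.
(** Half-open, so that every point lies in exactly one cell. *)
Let D : set R := `[0, 1[%classic.
Let cell n i : set R := `[i%:R / n%:R, i.+1%:R / n%:R[%classic.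

Let step h n t : R := \sum_(i <- iota 0 n) h (i%:R / n%:R) * \1_(cell n i) t.

Let step_trunc h n t : (0 < n)%N -> D t ->
  step h n t = h ((Num.truncn (n%:R * t))%:R / n%:R).
Proof.
move=> n0; rewrite /D/= in_itv/= => /andP[t0 t1].
have n0' : 0 < n%:R :> R by rewrite ltr0n.
have nt0 : 0 <= n%:R * t by rewrite mulr_ge0.
set j := Num.truncn _.
have cellE i : cell n i t <-> j = i.
  rewrite /cell/= in_itv/= ler_pdivrMr// ltr_pdivlMr// (mulrC t); split.
    by move/truncn_def.
  by move=> <-; exact: truncn_itv.
have jn : j \in iota 0 n.
  rewrite mem_iota/= add0n truncn_lt_nat// -[ltRHS]mulr1.
  by rewrite ltr_pM2l.
rewrite /step (bigD1_seq j)//= ?iota_uniq// big1 => [|i ij].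
  by rewrite addr0 indicE mem_set ?mulr1//; apply/cellE.
rewrite indicE memNset ?mulr0// => /cellE ji.
by rewrite ji eqxx in ij.
Qed.

Let mcell n i : measurable (cell n i). Proof. exact: measurable_itv. Qed.

Let measurable_step h n : measurable_fun D (step h n).
Proof.
apply: measurable_sum => i; exact: measurable_funM.
Qed.

Let mu_cell n i : (0 < n)%N -> i \in iota 0 n -> mu (cell n i `&` D) = (n%:R^-1)%:E.
Proof.
move=> n0; rewrite mem_iota add0n => /andP[_ hi].
have n0' : 0 < n%:R :> R by rewrite ltr0n.
have -> : cell n i `&` D = cell n i.
  apply/setIidl => t; rewrite /cell /D/= !in_itv/= => /andP[h1 h2].
  rewrite (le_trans _ h1) ?divr_ge0//=; apply: lt_le_trans h2 _.
  by rewrite ler_pdivrMr// mul1r ler_nat.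
rewrite /mu /cell lebesgue_measure_itv/= lte_fin ltr_pM2r ?invr_gt0//.
by rewrite ltr_nat leqnn -EFinB -mulrBl -natrB// subSnn mul1r.
Qed.

Let integral_step h n : (0 < n)%N ->
  (\int[mu]_(t in D) (step h n t)%:E = (\sum_(i <- iota 0 n) n%:R^-1 * h (i%:R / n%:R))%:E)%E.
Proof.
move=> n0; have mD : measurable D by exact: measurable_itv.
have ii i : mu.-integrable D (EFin \o \1_(cell n i)).
  apply: (@integrableS _ _ _ mu setT) => //; exact: integrable_indic_itv.
under eq_integral do rewrite /step -sumEFin.
rewrite integral_sum//; last first.
  move=> i; under eq_fun do rewrite EFinM.
  by apply: integrableZl => //; exact: ii.
rewrite -sumEFin; apply: eq_big_seq => i hi.
under eq_integral do rewrite EFinM.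
rewrite integralZl//; last exact: ii.
rewrite [in RHS]mulrC EFinM; congr (_ * _)%E.
rewrite -(mu_cell n0 hi).
exact: (@integral_indic _ (measurableTypeR R) R lebesgue_measure D mD (cell n i) (mcell n i)).
Qed.

(** The sums are integrals of step functions, so dominated convergence applies: the left ends of the
    cells converge to t, and [h] is bounded on the compact interval. *)
Lemma riemann_sum_cvg h (N : nat -> nat) : (forall K, (K < N K)%N) ->
  {within `[0, 1], continuous h} ->
  (fun K => \sum_(i <- iota 0 (N K)) (N K)%:R^-1 * h (i%:R / (N K)%:R)) @ \oo
     --> \int[mu]_(t in `[0, 1]) h t.
Proof.
move=> NK ch; have N0 K : (0 < N K)%N by exact: leq_ltn_trans (NK K).
have mD : measurable D by exact: measurable_itv.
have DI : D `<=` `[0, 1]%classic.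
  by move=> t; rewrite /D/= !in_itv/= => /andP[-> /ltW ->].
have ih01 := continuous_compact_integrable (@segment_compact R 0 1) ch.
have ih : mu.-integrable D (EFin \o h).
  by apply: integrableS ih01 => //; exact: measurable_itv.
have [M hM] : exists M : R, forall t, t \in `[0, 1] -> `|h t| <= M.
  have /compact_bounded[M [_ mrt]] := continuous_compact ch (@segment_compact R 0 1).
  exists (M + 1) => t t01; apply: (mrt (M + 1)); first by rewrite ltrDl.
  by exists t.
pose s K t := (Num.truncn ((N K)%:R * t))%:R / (N K)%:R : R.
have sD K t : D t -> s K t \in `[0, 1] /\ `|s K t - t| <= K.+1%:R^-1.
  move=> Dt; have := Dt; rewrite /D/= in_itv/= => /andP[t0 t1].
  have n0' : 0 < (N K)%:R :> R by rewrite ltr0n.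
  have /andP[h1 h2] := truncn_itv (mulr_ge0 (ltW n0') t0).
  have st : s K t <= t by rewrite /s ler_pdivrMr// (mulrC t).
  split.
    by rewrite in_itv/= divr_ge0//= (le_trans st (ltW t1)).
  rewrite distrC ger0_norm ?subr_ge0//; apply: (@le_trans _ _ ((N K)%:R^-1)).
    rewrite lerBlDl -(ler_pM2l n0') mulrDr mulfV ?gt_eqF// /s mulrCA mulfV ?gt_eqF//.
    by rewrite mulr1 natr1 ltW.
  by rewrite lef_pV2 ?posrE// ler_nat.
have cvg_s t : D t -> h (s K t) @[K --> \oo] --> h t.
  move=> Dt; have /subspace_continuousP/(_ t (DI t Dt)) ct := ch.
  have : s ^~ t @ \oo --> within `[0, 1]%classic (nbhs t).
    move=> A [e e0 eA]; suff : \forall K \near \oo, A (s K t) by [].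
    near=> K; apply: eA; last by case: (sD K t Dt).
    have [_ h1] := sD K t Dt; rewrite /ball_/= distrC.
    apply: le_lt_trans h1 _; near: K; exact: near_infty_natSinv_lt (PosNum e0).
  by move=> sw; exact: (cvg_comp (s ^~ t) h sw ct).
have hD : (\int[mu]_(t in `[0, 1]) h t)%R = \int[mu]_(t in D) h t.
  by rewrite -Rintegral_itv_bndo_bndc.
have [] := @dominated_convergence _ _ _ mu D mD (fun K => EFin \o step h (N K))
  (EFin \o h) (cst M%:E).
- by move=> K; apply/measurable_EFinP; exact: measurable_step.
- exact: measurable_int ih.
- apply: aeW => t Dt; apply: (@cvg_trans _ ((fun K => (h (s K t))%:E) @ \oo)).
    by apply: near_eq_cvg; apply: nearW => K /=; rewrite step_trunc.
  by apply: cvg_EFin; [exact: nearW|exact: cvg_s].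
- have iM : lebesgue_measure.-integrable `[0, 1]%classic (EFin \o (cst M : R -> R)).
    apply: continuous_compact_integrable; first exact: segment_compact.
    by apply: continuous_subspaceT => ?; exact: cvg_cst.
  by apply: integrableS iM => //; exact: measurable_itv.
- apply: aeW => t K Dt; rewrite /= step_trunc// lee_fin; apply: hM.
  by have [] := sD K t Dt.
move=> _ _ cv; rewrite hD.
have -> : (fun K => \sum_(i <- iota 0 (N K)) (N K)%:R^-1 * h (i%:R / (N K)%:R)) =
    fine \o (fun K => \int[mu]_(t in D) (step h (N K) t)%:E)%E.
  by apply/funext => K /=; rewrite integral_step.
apply: fine_cvg; rewrite fineK//.
exact: integrable_fin_num.
Unshelve. all: by end_near. Qed.

End riemann_sums.
Section density_Rintegral.
Context (R : realType) (nu : {measure set (measurableTypeR R) -> \bar R}).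
Variables (D : set (measurableTypeR R)) (f : R -> R).
Hypotheses (mD : measurable D) (f0 : forall t, 0 <= f t).
Hypothesis (mf : measurable_fun D f).
Hypothesis nuE : forall A : set (measurableTypeR R), measurable A ->
  nu A = (\int[lebesgue_measure]_(t in A `&` D) (f t)%:E)%E.

Let ge0_integral_nu (g : measurableTypeR R -> \bar R) :
  measurable_fun setT g -> (forall t, 0 <= g t)%E ->
  (\int[nu]_(t in D) g t = \int[lebesgue_measure]_(t in D) (g t * (f t)%:E))%E.
Proof.
move=> mg g0; rewrite integral_mkcond.
have mg' : measurable_fun setT (g \_ D).
  by apply/(measurable_restrictT _ mD); exact: measurable_funTS.
have gD0 t : (0 <= (g \_ D) t)%E by rewrite /patch; case: ifP.
rewrite (@ge0_integral_density _ _ _ _ _ lebesgue_measure nu id D f)//.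
by apply: eq_integral => t tD; rewrite /patch tD.
Qed.

Lemma Rintegral_density (h : R -> R) : measurable_fun setT (h : measurableTypeR R -> R) ->
  (\int[nu]_(t in D) h t = \int[lebesgue_measure]_(t in D) (h t * f t))%R.
Proof.
move=> mh; have mh' : measurable_fun setT (EFin \o h : measurableTypeR R -> \bar R).
  exact/measurable_EFinP.
rewrite /Rintegral; congr fine; rewrite integralE [in RHS]integralE.
congr (_ - _)%E.
  rewrite ge0_integral_nu//; last exact: measurable_funepos.
  apply: eq_integral => t; rewrite inE => Dt.
  rewrite !funeposE -EFin_max -EFinM -EFin_max; congr (_%:E).
  by rewrite maxr_pMl // mul0r.
rewrite ge0_integral_nu//; last exact: measurable_funeneg.
apply: eq_integral => t; rewrite inE => Dt.
rewrite !funenegE -!EFinN -EFin_max -EFinM -EFin_max; congr (_%:E).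
by rewrite maxr_pMl // mul0r mulNr.
Qed.

End density_Rintegral.

(** * Lower limits and truncation of the l^q norm *)

Section extended_limits.
Context (R : realType).
Local Open Scope ereal_scope.

Lemma cvg_le_limn_einf (u v : (\bar R)^nat) l : v @ \oo --> l ->
  (\forall k \near \oo, v k <= u k) -> l <= limn_einf u.
Proof.
move=> vl vu; rewrite -(cvg_limn_einf_sup vl).1 !limn_einf_lim.
apply: lee_lim; [exact: is_cvg_einfs|exact: is_cvg_einfs|].
case: vu => n0 _ vu; exists n0 => // n n0n; apply: le_ereal_inf_tmp.
move=> _ [k nk <-]; apply: le_trans (vu k _); last exact: leq_trans nk.
by apply: ereal_inf_lbound; exists k.
Qed.

(** The integral of a nonnegative function is a supremum over simple functions below it, so
    monotonicity holds without measurability. Thus the l^q norm need not be shown measurable in the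
    outcome. *)
Lemma ge0_le_integral_any d (T : measurableType d) (mu : {measure set T -> \bar R})
    (f g : T -> \bar R) : (forall w, 0 <= f w) -> (forall w, f w <= g w) ->
  \int[mu]_w f w <= \int[mu]_w g w.
Proof.
move=> f0 fg; have g0 w : 0 <= g w by exact: le_trans (fg w).
rewrite !ge0_integralTE//; apply: ereal_sup_le => _ [h hf <-].
by exists h => // x; apply: le_trans (fg x); exact: hf.
Qed.

Lemma lq_norm_poweR_le (p q : R) (a : nat -> R[i]) (b : nat -> R) (L : \bar R) :
  (0 < p)%R -> (0 < q)%R -> 0 <= L ->
  (forall k, Normc.normc (a k.+1) `^ q <= b k)%R ->
  (forall n, ((\sum_(k < n) b k) `^ (p / q))%:E <= L) ->
  lq_norm q a `^ p <= L.
Proof.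
move=> p0 q0 L0 ab bL; rewrite /lq_norm Lnorm_counting// -poweRrM.
have b0 k : (0 <= b k)%R by apply: le_trans (ab k); exact: powR_ge0.
have pq : (0 < p / q)%R by rewrite divr_gt0.
have qp : (0 < q / p)%R by rewrite divr_gt0.
have Lq : (L `^ (q / p)) `^ (p / q) = L.
  by rewrite -poweRrM (_ : (q / p * (p / q))%R = 1%R) ?poweRe1//; field; rewrite !gt_eqF.
have pos (x : \bar R) : 0 <= x -> x \in `[0, +oo].
  by move=> x0; rewrite in_itv/= x0 leey.
rewrite -{1}Lq mulrC; apply: gt0_ler_poweR; rewrite ?(ltW pq)//.
- by apply: pos; apply: nneseries_ge0 => k _ _; exact: poweR_ge0.
- by apply: pos; exact: poweR_ge0.
apply: lime_le; first by apply: is_cvg_nneseries => k _ _; exact: poweR_ge0.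
apply: nearW => n; rewrite big_mkord.
apply: (@le_trans _ _ (\sum_(k < n) b k)%:E).
  rewrite -sumEFin; apply: lee_sum => k _.
  rewrite abse_EFin poweR_EFin lee_fin; apply: le_trans (ab k).
  by rewrite ger0_norm//; case: (a k.+1) => x y; exact: sqrtr_ge0.
have S0 : (0 <= \sum_(k < n) b k)%R by apply: sumr_ge0.
have -> : (\sum_(k < n) b k)%:E = (((\sum_(k < n) b k) `^ (p / q))%:E) `^ (q / p).
  rewrite poweR_EFin -powRrM (_ : (p / q * (q / p))%R = 1%R) ?powRr1//.
  by field; rewrite !gt_eqF.
by apply: gt0_ler_poweR; rewrite ?(ltW qp)// ?pos ?lee_fin ?powR_ge0.
Qed.

End extended_limits.

Section version_identification.
Context (R : realType) d (T : measurableType d) (P : probability T R).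
Variables (W : set (R * R) -> {RV P >-> R}) (wnW : white_noise W).
Variables (phi : nat -> R -> {RV P >-> R}) (vphi : continuous_version W phi).
Variables (g : R).
Implicit Types (t : R) (j l m : nat).

Lemma chaos_factorE j t w : t \in `[0, 1] ->
  chaos_factor g phi j t w = expR (g * phi j t w - g ^+ 2 * kappa j 0 / 2).
Proof.
move=> t01; rewrite /chaos_factor.
suff -> : fine ('E_P[fun w' => (phi j t w' ^+ 2)%R])%E = kappa j 0.
  by congr expR; ring.
have := white_noise_cov wnW (finite_control_cone j t) (finite_control_cone j t).
rewrite control_measure_coneI subrr normr0 kappaE// unlock => h.
suff -> : (\int[P]_w (phi j t w ^+ 2)%:E = \int[P]_w (W (cone j t) w * W (cone j t) w)%:E)%E.
  by rewrite h.
apply: ae_eq_integral => //.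
- by apply/measurable_EFinP; apply: measurable_funX.
- by apply/measurable_EFinP; apply: measurable_funM.
- by apply: filterS (version_ae vphi j t01) => v -> _; rewrite expr2.
Qed.

Definition version_chaos l t w : R :=
  \prod_(j < l) expR (g * phi j t w - g ^+ 2 * kappa j 0 / 2).

Lemma version_chaos_ge0 l t w : 0 <= version_chaos l t w.
Proof. by apply: prodr_ge0 => j _; exact: expR_ge0. Qed.

Lemma measurable_version_chaos l t : measurable_fun setT (version_chaos l t).
Proof.
apply: measurable_prod => j _; apply: measurableT_comp => //.
by apply: measurable_funB => //; exact: measurable_funM.
Qed.

Lemma continuous_version_chaos l w :
  {within `[0, 1], continuous (fun t => version_chaos l t w)}.
Proof.
apply/subspace_continuousP => t t01; elim: l => [|l ih].
  rewrite (_ : (version_chaos 0)^~ w = cst 1); first exact: cvg_cst.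
  by apply/funext => s; rewrite /version_chaos big_ord0.
rewrite (_ : (version_chaos l.+1)^~ w = (fun s => version_chaos l s w *
    expR (g * phi l s w - g ^+ 2 * kappa l 0 / 2))); last first.
  by apply/funext => s; rewrite /version_chaos big_ord_recr.
apply: cvgM => //.
have /subspace_continuousP/(_ t t01) ct := @version_continuous _ _ _ _ _ _ vphi l w.
apply: (@cvg_comp _ _ _ (fun t => g * phi l t w - g ^+ 2 * kappa l 0 / 2) expR); last first.
  exact: continuous_expR.
by apply: cvgB; [apply: cvgM => //; exact: cvg_cst|exact: cvg_cst].
Qed.

Lemma version_chaosE l t w : (forall j, phi j t w = W (cone j t) w) ->
  version_chaos l t w = chaos W g l t w.
Proof.
move=> e; rewrite /version_chaos; elim: l => [|l ih].
  by rewrite big_ord0 /chaos /log_field /log_cov !big_nil !mulr0 subrr expR0.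
by rewrite big_ord_recr/= ih chaosS e.
Qed.

(** Each equality fails on a null set depending on the time; only countably many times and levels
    can be treated at once, and a grid needs no more. *)
Lemma ae_version_grid N : {ae P, forall w, forall i j, (i <= N)%N ->
  phi j (i%:R / N%:R) w = W (cone j (i%:R / N%:R)) w}.
Proof.
apply: ae_foralln => i; apply: ae_foralln => j.
have [iN|iN] := leqP i N; last by apply: aeW.
have t01 : i%:R / N%:R \in `[0 : R, 1].
  rewrite in_itv/= divr_ge0//=; case: N iN => [|N] iN; first by rewrite invr0 mulr0.
  by rewrite ler_pdivrMr// mul1r ler_nat.
by apply: filterS (version_ae vphi j t01) => w.
Qed.

End version_identification.
Section powR_limits.
Context (R : realType).

Lemma cvg_powR (s a : R) (u : nat -> R) : 0 < s -> (forall k, 0 <= u k) ->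
  u @ \oo --> a -> (fun k => u k `^ s) @ \oo --> a `^ s.
Proof.
move=> s0 u0 ua; have a0 : 0 <= a.
  by rewrite -(cvg_lim _ ua)//; apply: limr_ge; [apply/cvg_ex; exists a|exact: nearW].
(* The formula u^s = e^(s ln u) gives continuity at positive limits only; at 0 the inequality u <
   e^(1/s) is raised to the power s > 0. *)
have [a0'|a0'] := eqVneq a 0.
  rewrite a0' powR0 ?gt_eqF//; rewrite a0' in ua; apply/cvgrPdist_lt => e e0.
  have e1 : 0 < e `^ s^-1 by exact: powR_gt0.
  move/cvgrPdist_lt/(_ _ e1): ua; apply: filterS => k.
  rewrite !sub0r !normrN !ger0_norm ?powR_ge0// => uk.
  have -> : e = (e `^ s^-1) `^ s by rewrite -powRrM mulVf ?gt_eqF// powRr1// ltW.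
  by apply: gt0_ltr_powR; rewrite ?nnegrE ?powR_ge0.
have {a0 a0'}a0 : 0 < a by rewrite lt_neqAle eq_sym a0'.
have -> : a `^ s = expR (s * ln a) by rewrite /powR gt_eqF.
apply: (@cvg_trans _ ((fun k => expR (s * ln (u k))) @ \oo)).
  apply: near_eq_cvg; move/cvgrPdist_lt/(_ _ a0): ua; apply: filterS => k.
  rewrite ltr_distlC => /andP[]; rewrite subrr => uk _.
  by rewrite /powR gt_eqF.
apply: (cvg_comp (fun k => s * ln (u k)) expR); last exact: continuous_expR.
apply: cvgM; first exact: cvg_cst.
by apply: continuous_cvg => //; exact: continuous_ln.
Qed.

Lemma cvg_sum_ord n (u : nat -> nat -> R) (l : nat -> R) :
  (forall k, u^~ k @ \oo --> l k) ->
  (fun K => \sum_(k < n) u K k) @ \oo --> \sum_(k < n) l k.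
Proof.
move=> ul; elim: n => [|n ih].
  by rewrite big_ord0; under eq_fun do rewrite big_ord0; exact: cvg_cst.
by rewrite big_ord_recr/=; under eq_fun do rewrite big_ord_recr/=; apply: cvgD.
Qed.

Lemma cvg_lq_pair n q (u : nat -> nat -> bool -> R) (l : nat -> bool -> R) : 0 < q ->
  (forall k b, (fun K => u K k b) @ \oo --> l k b) ->
  (fun K => lq_sum q (fun nu : 'I_n * bool => u K nu.1 nu.2)) @ \oo -->
    \sum_(k < n) (`|l k true| `^ q + `|l k false| `^ q).
Proof.
move=> q0 ul.
have E (v : nat -> bool -> R) : lq_sum q (fun nu : 'I_n * bool => v nu.1 nu.2) =
    \sum_(k < n) (`|v k true| `^ q + `|v k false| `^ q).
  rewrite /lq_sum -(pair_big xpredT xpredT (fun (i : 'I_n) b => `|v i b| `^ q))/=.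
  by apply: eq_bigr => i _; rewrite big_bool.
under eq_fun do rewrite E.
apply: (@cvg_sum_ord n (fun K k => `|u K k true| `^ q + `|u K k false| `^ q)
  (fun k => `|l k true| `^ q + `|l k false| `^ q)) => k.
by apply: cvgD; apply: cvg_powR => //; apply: cvg_norm; exact: ul.
Qed.

Lemma lq_pair_le n K q (u : nat -> bool -> R) : (n <= K)%N ->
  lq_sum q (fun nu : 'I_n * bool => u nu.1 nu.2) <=
  lq_sum q (fun nu : 'I_K * bool => u nu.1 nu.2).
Proof.
move=> nK.
have E j : lq_sum q (fun nu : 'I_j * bool => u nu.1 nu.2) =
    \sum_(0 <= k < j) \sum_b `|u k b| `^ q.
  rewrite /lq_sum -(pair_big xpredT xpredT (fun (i : 'I_j) b => `|u i b| `^ q))/=.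
  by rewrite big_mkord.
rewrite !E (big_cat_nat (leq0n n) nK)//= lerDl; apply: sumr_ge0 => k _.
by apply: sumr_ge0 => b _; exact: powR_ge0.
Qed.

End powR_limits.

Section fixed_level.
Context (R : realType) d (T : measurableType d) (P : probability T R).
Variables (W : set (R * R) -> {RV P >-> R}) (wnW : white_noise W).
Variables (phi : nat -> R -> {RV P >-> R}) (vphi : continuous_version W phi).
Variables (g p q tau : R).
Variables (mu : nat -> T -> {measure set (measurableTypeR R) -> \bar R}).
Hypotheses (muE : chaos_measure g phi mu).
Hypotheses (g0 : 0 < g) (p12 : 1 < p < 2) (q2 : 2 < q) (tau0 : 0 <= tau).
Hypotheses (tq : 2 <= q * (1 - tau) / 2) (decay0 : 0 < decay_exponent g p q tau).
Variable m : nat.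
Local Notation vch t w := (version_chaos phi g m.+1 t w).
Implicit Types (K n : nat) (b : bool).
Let p0 : 0 < p. Proof. by move: p12 => h; lra. Qed.
Let q0 : 0 < q. Proof. by move: q2 => h; lra. Qed.

(** The factor 2^m provides the dyadic blocks needed up to level m, the factor 2 (K+1)! makes 2n a
    divisor for every n <= K, and the product exceeds K, so that the mesh tends to 0. *)
Let N K := (2 ^ m * (2 * (K.+1)`!))%N.

Let N_gt K : (K < N K)%N.
Proof.
apply: (@leq_trans (K.+1)`!); first exact: fact_geq.
by rewrite /N mulnA leq_pmull// muln_gt0 expn_gt0.
Qed.

Let N_dvd K n : (0 < n <= K)%N -> (2 * n %| N K)%N.
Proof.
move=> /andP[n0 nK]; rewrite dvdn_mull// dvdn_pmul2l//.
by rewrite dvdn_fact// n0 leqW.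
Qed.

Let rsum K n b w : R := \sum_(i <- iota 0 (N K))
  n.+1%:R `^ (tau / 2) * ((N K)%:R^-1 * fourier_trig b n.+1 (i%:R / (N K)%:R))
   * vch (i%:R / (N K)%:R) w.

Let coef n b w : R := n.+1%:R `^ (tau / 2) *
  \int[lebesgue_measure]_(t in `[0, 1]) (fourier_trig b n.+1 t * vch t w).

Lemma continuous_fourier_trig b n : continuous (fourier_trig b n : R -> R).
Proof.
move=> t; have ct : continuous (fun t : R => - (2 * pi * n%:R * t)).
  by move=> s; apply: cvgN; apply: cvgM; [exact: cvg_cst|exact: cvg_id].
by case: b; [exact: (continuous_comp (ct t) (@continuous_cos R _))
            |exact: (continuous_comp (ct t) (@continuous_sin R _))].
Qed.

Lemma cvg_rsum n b w : (fun K => rsum K n b w) @ \oo --> coef n b w.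
Proof.
have -> : (fun K => rsum K n b w) = (fun K => n.+1%:R `^ (tau / 2) *
    \sum_(i <- iota 0 (N K)) (N K)%:R^-1 *
      (fourier_trig b n.+1 (i%:R / (N K)%:R) * vch (i%:R / (N K)%:R) w)).
  by apply/funext => K; rewrite mulr_sumr; apply: eq_bigr => i _; ring.
apply: cvgM; first exact: cvg_cst.
apply: (@riemann_sum_cvg R (fun t => fourier_trig b n.+1 t * vch t w) N N_gt).
apply/subspace_continuousP => t t01; apply: cvgM.
  by apply: cvg_within_filter; exact: continuous_fourier_trig.
by have /subspace_continuousP/(_ t t01) := @continuous_version_chaos _ _ _ _ _ _ vphi g m.+1 w.
Qed.

Let bound K w : \bar R := (lq_sum q (fun nu : 'I_K * bool => rsum K nu.1 nu.2 w) `^ (p / q))%:E.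

Let measurable_rsum K n b : measurable_fun setT (rsum K n b).
Proof.
apply: measurable_sum => i; apply: measurable_funM => //.
exact: measurable_version_chaos.
Qed.

Lemma fourier_coefE n w : weighted_fourier tau (mu m w) n.+1 =
  (coef n true w +i* coef n false w)%C.
Proof.
have muE' (A : set (measurableTypeR R)) : measurable A ->
    mu m w A = (\int[lebesgue_measure]_(t in A `&` `[0%R, 1%R]) (vch t w)%:E)%E.
  move=> mA; rewrite muE//; apply: eq_integral => t; rewrite inE => -[_ t01].
  congr (_%:E); apply: eq_bigr => j _; rewrite (chaos_factorE wnW vphi)//.
have mv : measurable_fun (`[0, 1]%classic : set (measurableTypeR R)) (fun t => vch t w).
  apply: (@subspace_continuous_measurable_fun R `[0, 1]%classic (fun t => vch t w)).
    exact: measurable_itv.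
  exact: (@continuous_version_chaos _ _ _ _ _ _ vphi g m.+1 w).
have H b : (\int[mu m w]_(t in `[0, 1]) fourier_trig b n.+1 t)%R =
    (\int[lebesgue_measure]_(t in `[0, 1]) (fourier_trig b n.+1 t * vch t w))%R.
  apply: Rintegral_density => //.
  - by move=> t; exact: version_chaos_ge0.
  - by apply: continuous_measurable_fun; exact: continuous_fourier_trig.
rewrite /weighted_fourier /fourier_coef /complex_integral.
rewrite (H true) (H false).
by apply/eqP; rewrite eq_complex/= !mul0r subr0 addr0 !eqxx.
Qed.

(** The factor 2^p comes from |x + iy| <= |x| + |y|, which passes from the complex coefficients to
    the pairs of real ones. *)
Lemma lq_norm_le_liminf w :
  (lq_norm q (weighted_fourier tau (mu m w)) `^ p <=
   (2 `^ p)%:E * limn_einf (fun K => bound K w))%E.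
Proof.
have L0 : (0 <= limn_einf (fun K => bound K w))%E.
  apply: (@cvg_le_limn_einf _ _ (cst 0%E)); first exact: cvg_cst.
  by apply: nearW => K; rewrite lee_fin powR_ge0.
apply: (@lq_norm_poweR_le _ p q _
  (fun k => 2 `^ q * (`|coef k true w| `^ q + `|coef k false w| `^ q))) => //.
- by rewrite mule_ge0 ?lee_fin ?powR_ge0.
- move=> k; rewrite fourier_coefE/=.
  set x := coef k true w; set y := coef k false w.
  rewrite -(normr_id x) -(normr_id y).
  apply: le_trans (norm_powRD_le _ _ (ltW q0)).
  apply: ge0_ler_powR; rewrite ?nnegrE ?sqrtr_ge0 ?(ltW q0)//.
  rewrite [leRHS]ger0_norm ?addr_ge0// -[leRHS]ger0_norm ?addr_ge0// -sqrtr_sqr.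
  rewrite ler_wsqrtr// sqrrD !real_normK ?num_real// lerD2r lerDl.
  by rewrite mulrn_wge0// mulr_ge0.
move=> n; rewrite -mulr_sumr powRM ?powR_ge0//; last first.
  by apply: sumr_ge0 => k _; rewrite addr_ge0 ?powR_ge0.
rewrite -powRrM mulrCA divff ?gt_eqF// mulr1 EFinM.
apply: lee_wpmul2l; first by rewrite lee_fin powR_ge0.
(* Only the first [n] frequencies are kept, so that the limit in K passes through a finite sum; for
   K >= n they are among those of [bound K]. *)
pose v K := (lq_sum q (fun nu : 'I_n * bool => rsum K nu.1 nu.2 w) `^ (p / q))%:E.
apply: (@cvg_le_limn_einf _ _ v).
  apply: cvg_EFin; first exact: nearW.
  apply: cvg_powR; [exact: divr_gt0|by move=> K; exact: lq_sum_ge0|].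
  apply: (@cvg_lq_pair R n q (fun K k b => rsum K k b w) (fun k b => coef k b w)) => // k b.
  exact: cvg_rsum.
exists n => // K nK; rewrite lee_fin; apply: ge0_ler_powR.
- by rewrite divr_ge0 ?(ltW p0) ?(ltW q0).
- by rewrite nnegrE lq_sum_ge0.
- by rewrite nnegrE lq_sum_ge0.
exact: (@lq_pair_le _ _ _ _ (fun k b => rsum K k b w)).
Qed.

Lemma integral_bound_le K : (\int[P]_w bound K w <= (chaos_norm_const g p q tau)%:E)%E.
Proof.
apply: le_trans (@norm_mean_chaos_le _ _ _ _ _ wnW g p q tau g0 p12 q2 tau0 tq K (N K)
  (@N_dvd K) _ decay0 m _); last 2 first.
- by exact: leq_ltn_trans (N_gt K).
- exact: dvdn_mulr.
rewrite le_eqVlt; apply/orP; left; apply/eqP; apply: ae_eq_integral => //.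
- by apply/measurable_EFinP; apply: measurable_lq_sum_powR => nu; exact: measurable_rsum.
- apply/measurable_EFinP; apply: measurable_lq_sum_powR => nu.
  exact: measurable_chaos_sum.
apply: filterS (ae_version_grid vphi (N K)) => w h _; congr ((_ `^ _)%:E).
apply: eq_lq_sum => nu; apply: eq_big_seq => i; rewrite mem_iota add0n => /andP[_ iN].
by congr (_ * _); apply: version_chaosE => j; apply: h; exact: ltnW.
Qed.

Lemma integral_lq_norm_le :
  (\int[P]_w (lq_norm q (weighted_fourier tau (mu m w)) `^ p) <=
   (2 `^ p * chaos_norm_const g p q tau)%:E)%E.
Proof.
have mb K : measurable_fun setT (bound K).
  by apply/measurable_EFinP; apply: measurable_lq_sum_powR => nu; exact: measurable_rsum.
have b0 K w : (0 <= bound K w)%E by rewrite lee_fin powR_ge0.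
have lb0 w : (0 <= limn_einf (fun K => bound K w))%E.
  apply: (@cvg_le_limn_einf _ _ (cst 0%E)); first exact: cvg_cst.
  exact: nearW.
apply: le_trans.
  apply: (ge0_le_integral_any P (g := fun w => (2 `^ p)%:E * limn_einf (fun K => bound K w))%E).
  - by move=> w; exact: poweR_ge0.
  - exact: lq_norm_le_liminf.
rewrite ge0_integralZl//; last first.
  apply: (emeasurable_fun_cvg (fun n w => einfs (fun K => bound K w) n)).
    exact: measurable_fun_einfs.
  by move=> w _; rewrite limn_einf_lim; exact: is_cvg_einfs.
rewrite EFinM; apply: lee_wpmul2l; first by rewrite lee_fin powR_ge0.
apply: le_trans (fatou _ _ _ _) _ => //.
rewrite limn_einf_lim; apply: lime_le; first exact: is_cvg_einfs.
apply: nearW => n; apply: le_trans (integral_bound_le n).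
by apply: ereal_inf_lbound; exists n => /=.
Qed.

End fixed_level.
(** * Existence of the exponents *)

Section exponents.
Context (R : realType).
Implicit Types gamma tau p q : R.

Lemma D_lt1 gamma : 0 < gamma < Num.sqrt 2 -> D_ gamma < 1.
Proof.
move=> /andP[g0 g2]; rewrite /D_; case: ifPn => [_|].
  by rewrite gtrBl exprn_gt0.
rewrite -leNgt => gs; have s2 : Num.sqrt 2 ^+ 2 = 2 :> R by rewrite sqr_sqrtr.
apply: (@le_lt_trans _ _ ((Num.sqrt 2 / 2) ^+ 2)).
  by rewrite ler_pXn2r ?nnegrE ?subr_ge0 ?divr_ge0 ?sqrtr_ge0 ?(ltW g2)//; lra.
by rewrite expr_div_n s2; lra.
Qed.

Lemma exists_admissible_p gamma tau : 0 < gamma < Num.sqrt 2 -> 0 < tau < D_ gamma ->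
  exists2 p, 1 < p < 2 & 0 < (p - 1) * (1 - gamma ^+ 2 * p / 2) - tau * p / 2.
Proof.
move=> g02 /andP[t0 tD]; have tau1 := lt_trans tD (D_lt1 g02).
have /andP[g0 g2] := g02.
have s2 : Num.sqrt 2 ^+ 2 = 2 :> R by rewrite sqr_sqrtr.
have s0 : 0 < Num.sqrt 2 :> R by rewrite sqrtr_gt0.
have g20 : 0 < gamma ^+ 2 by rewrite exprn_gt0.
have near2 : tau < 1 - gamma ^+ 2 -> exists2 p, 1 < p < 2 &
    0 < (p - 1) * (1 - gamma ^+ 2 * p / 2) - tau * p / 2.
  (* This is the strict inequality at p = 2, hence it persists just below 2. *)
  move: (gamma ^+ 2) g20 => c c0 tc; pose e := 1 - c - tau.
  have e01 : 0 < e < 1 by rewrite /e; lra.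
  exists (2 - e / 2); first by lra.
  have -> : (2 - e / 2 - 1) * (1 - c * (2 - e / 2) / 2) - tau * (2 - e / 2) / 2 =
    (e - e / 2 * (1 - c)) + (1 - e / 2) * c * e / 4 + tau * e / 4 by rewrite /e; field.
  have h1 : 0 < tau * e by rewrite mulr_gt0//; lra.
  have h2 : 0 < (1 - e / 2) * c * e by rewrite !mulr_gt0//; lra.
  have h3 : e / 2 * (1 - c) < e / 2 * 1 by rewrite ltr_pM2l; lra.
  by lra.
move: tD; rewrite /D_; case: ifPn => [_|]; first exact: near2.
rewrite -leNgt le_eqVlt => /orP[/eqP gE|gs] tD.
  (* At gamma = sqrt 2 / 2 both formulas for [D_] give 1/2, but the maximizer used below would be p
     = 2, which is excluded. *)
  apply: near2; apply: lt_le_trans tD _; rewrite -gE.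
  have -> : Num.sqrt 2 - Num.sqrt 2 / 2 = Num.sqrt 2 / 2 :> R by field.
  by rewrite expr_div_n s2; lra.
(* p is the maximizer of (p - 1) (1 / p - gamma ^ 2 / 2) *)
exists (Num.sqrt 2 / gamma).
  rewrite ltr_pdivlMr// mul1r g2/= ltr_pdivrMr//.
  by move: gs; rewrite ltr_pdivrMr// mulrC.
have -> : (Num.sqrt 2 / gamma - 1) * (1 - gamma ^+ 2 * (Num.sqrt 2 / gamma) / 2)
    - tau * (Num.sqrt 2 / gamma) / 2 =
    (Num.sqrt 2 / gamma / 2) * ((Num.sqrt 2 - gamma) ^+ 2 - tau).
  move: s2; move: (Num.sqrt 2) => s s2.
  have -> : 1 - gamma ^+ 2 * (s / gamma) / 2 = s * (s - gamma) / 2.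
    by rewrite mulrBr -expr2 s2; field; rewrite gt_eqF.
  by field; rewrite gt_eqF.
by rewrite mulr_gt0 ?subr_gt0 ?divr_gt0.
Qed.

Lemma exists_admissible_exponents gamma tau : 0 < gamma < Num.sqrt 2 ->
  0 < tau < D_ gamma -> exists p q, admissible_exponents gamma tau p q.
Proof.
move=> g02 tD; have [p p12 h0] := exists_admissible_p g02 tD.
(* The two entries of the maximum give q > 4/(1 - tau) and p/q < h; adding 1 makes both strict. *)
set h := _ - _ in h0; exists p, (Num.max (4 / (1 - tau)) (p / h) + 1); split => //.
  by apply: (@le_lt_trans _ _ (Num.max (4 / (1 - tau)) (p / h))); rewrite ?le_max ?lexx// ltrDl.
have ph : 0 < p / h by rewrite divr_gt0//; lra.
set q := _ + 1; have q1 : p / h < q.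
  by apply: (@le_lt_trans _ _ (Num.max (4 / (1 - tau)) (p / h))); rewrite ?le_max ?lexx ?orbT// ltrDl.
have q0 := lt_trans ph q1.
rewrite -/h subr_gt0 ltr_pdivrMr// mulrC.
by move: q1; rewrite ltr_pdivrMr// mulrC.
Qed.

End exponents.
Theorem theorem1p4 (R : realType) (gamma tau : R)
    (hgamma : 0 < gamma < Num.sqrt 2) (htau : 0 < tau < D_ gamma) :
  (exists p q : R, admissible_exponents gamma tau p q) /\
  (forall (d : measure_display) (T : measurableType d) (P : probability T R)
      (W : set (R * R) -> {RV P >-> R}) (phi : nat -> R -> {RV P >-> R})
      (mu : nat -> T -> {measure set (measurableTypeR R) -> \bar R}),
    white_noise W -> continuous_version W phi -> chaos_measure gamma phi mu ->
    forall p q : R, admissible_exponents gamma tau p q ->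
    (ereal_sup [set \int[P]_w (lq_norm q (weighted_fourier tau (mu m w)) `^ p)
               | m in [set: nat]] < +oo)%E).
Proof.
split; first exact: exists_admissible_exponents.
move=> d T P W phi mu wnW vphi muE p q [p12 tq decay0].
have /andP[g0 _] := hgamma; have /andP[t0 tD] := htau.
have t1 : 0 < 1 - tau by rewrite subr_gt0; exact: lt_trans tD (D_lt1 hgamma).
have q4 : 4 < q * (1 - tau) by rewrite -ltr_pdivrMr.
have q2 : 2 < q.
  apply: le_lt_trans tq; rewrite ler_pdivlMr//; lra.
apply: (@le_lt_trans _ _ (2 `^ p * chaos_norm_const gamma p q tau)%:E); last exact: ltry.
apply: ge_ereal_sup => _ [m _ <-].
apply: (integral_lq_norm_le wnW vphi muE) => //; first exact: ltW.
by lra.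
Qed.
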